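(* Let $k,r$ be integers with $k\ge1$ and $r\ge0$. Then there are real constants $\mathcal{F}_{r,k}>0$ such that $$\prod_{\nu=1}^n(k\nu)!^{\,\nu^r}\;\sim\;\mathcal{F}_{r,k}\,\mathcal{A}_r^{\frac12}\,\mathcal{A}_{r+1}^{k}\,P_{r,k}(n)\,Q_r(n)^{\frac12}\,Q_{r+1}(n)^k\quad\text{as } n\to\infty,$$ where the constants $\mathcal{F}_{r,k}$ and the functions $P_{r,k}$ satisfy $\lim_{k\to\infty}\mathcal{F}_{r,k}=1$ (for each fixed $r$) and $\log P_{r,k}\in\Omega_{r+2}$, with $$\log P_{r,k}(n)=\frac12S_r(n)\log(2\pi k)+k\,S_{r+1}(n)\log(k/e)+\widehat{B}_{r+2,k}\log n+\sum_{j=1}^{\lfloor\frac{r+1}2\rfloor}\widehat{B}_{2j,k}\,S_{r+1-2j}(n).$$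
   Context: $f\sim g$ means $f/g\to1$. $B_m$ are the Bernoulli numbers, $z/(e^z-1)=\sum_{m\ge0}B_mz^m/m!$ (so $B_1=-\frac12$); $\zeta$ is the Riemann zeta function; $H_0=0$, $H_n=\sum_{\nu=1}^n\frac1\nu$. For $r\ge0$, $S_r(n)=\sum_{\nu=1}^n\nu^r=\sum_{j=0}^r\binom rj(-1)^{r-j}B_{r-j}\frac{n^{j+1}}{j+1}$ (a polynomial in $n$). $\widehat{B}_{m,k}=\dfrac{B_m}{m(m-1)k^{m-1}}$ for $m\ge2$. $\Omega_n$ is the real linear span of the functions $x^\nu,\ x^\nu\log x$ ($0\le\nu\le n$) on $\mathbb{R}^+$. For $r\ge0$, the generalized Glaisher--Kinkelin constant $\mathcal{A}_r$ is defined by $\log\mathcal{A}_r=-\zeta(-r)H_r-\zeta'(-r)$, and $Q_r$ is defined by $$\log Q_r(n)=(S_r(n)-\zeta(-r))\log n+\sum_{j=0}^r\binom rj(-1)^{r-j}B_{r-j}\frac{n^{j+1}}{j+1}\,(H_r-H_{j+1}).$$ *)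

(* Defs.v *)
From Stdlib Require Import Reals List Factorial.
From Coquelicot Require Import Coquelicot.

Open Scope R_scope.

(* [C] is Coquelicot's type of complex numbers; the real-valued binomial
   coefficient of the standard library is therefore written [Binomial.C]. *)

Definition Cexp (z : C) : C := (exp (Re z) * cos (Im z), exp (Re z) * sin (Im z)).

(* m^s with the real logarithm of m, for m >= 1. *)
Definition natCpow (m : nat) (s : C) : C := Cexp (s * RtoC (ln (INR m)))%C.

Definition analytic_at (f : C -> C) (s0 : C) : Prop :=
  exists (a : nat -> C) (d : posreal),
    forall s : C, Cmod (s - s0)%C < d ->
      is_pseries (K := C_AbsRing) (V := C_NormedModule) a (s - s0)%C (f s).

(* The analytic continuation to C \ {1} of the Dirichlet series
   1^-s + 2^-s + ...; as C \ {1} is connected, it is unique there.  The value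
   at the pole s = 1 is left arbitrary and is never used. *)
Definition is_riemann_zeta (zeta : C -> C) : Prop :=
  (forall s : C, 1 < Re s ->
     is_series (K := C_AbsRing) (V := C_NormedModule)
       (fun n : nat => natCpow (S n) (- s)%C) (zeta s)) /\
  (forall s : C, s <> RtoC 1 -> analytic_at zeta s).

(* zeta is real on the real axis away from 1, hence so are zeta(-r) and
   zeta'(-r); [Re] only changes their type. *)
Definition zeta_neg (zeta : C -> C) (r : nat) : R := Re (zeta (RtoC (- INR r))).
Definition zeta'_neg (zeta : C -> C) (r : nat) : R :=
  Re (C_derive zeta (RtoC (- INR r))).

(* z / (e^z - 1) = sum_m B_m z^m / m! near 0; z = 0 is excluded only because
   the left-hand side is 0/0 there, and the B_m are still determined. *)
Definition is_bernoulli (B : nat -> R) : Prop :=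
  exists rho : posreal, forall z : R, 0 < Rabs z < rho ->
    is_pseries (fun m : nat => B m / INR (fact m)) z (z / (exp z - 1)).

Definition Bhat (B : nat -> R) (m k : nat) : R :=
  B m / (INR m * (INR m - 1) * INR k ^ (m - 1)).

(* The coefficient of x^(j+1) in S_r(x). *)
Definition Scoef (B : nat -> R) (r j : nat) : R :=
  Binomial.C r j * (-1) ^ (r - j) * B (r - j)%nat / INR (j + 1).

(* S_r as a polynomial in a real variable; S_r(n) = 1^r + ... + n^r. *)
Definition Spoly (B : nat -> R) (r : nat) (x : R) : R :=
  sum_n_m (fun j : nat => Scoef B r j * x ^ (j + 1)) 0 r.

Definition harmonic (n : nat) : R := sum_n_m (fun i : nat => / INR i) 1 n.

Definition glaisher (zeta : C -> C) (r : nat) : R :=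
  exp (- zeta_neg zeta r * harmonic r - zeta'_neg zeta r).

Definition logQ (zeta : C -> C) (B : nat -> R) (r : nat) (x : R) : R :=
  (Spoly B r x - zeta_neg zeta r) * ln x
  + sum_n_m (fun j : nat =>
      Scoef B r j * x ^ (j + 1) * (harmonic r - harmonic (j + 1))) 0 r.

Definition Qfun (zeta : C -> C) (B : nat -> R) (r : nat) (x : R) : R :=
  exp (logQ zeta B r x).

(* In the last sum 2j <= r+1, so the natural-number subtraction is exact. *)
Definition logP (B : nat -> R) (r k : nat) (x : R) : R :=
  / 2 * Spoly B r x * ln (2 * PI * INR k)
  + INR k * Spoly B (r + 1) x * ln (INR k / exp 1)
  + Bhat B (r + 2) k * ln x
  + sum_n_m (fun j : nat => Bhat B (2 * j) k * Spoly B (r + 1 - 2 * j) x)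
      1 (Nat.div (r + 1) 2).

Definition Pfun (B : nat -> R) (r k : nat) (x : R) : R := exp (logP B r k x).

(* f agrees on R^+ with an element of the real span of
   x^nu, x^nu log x, 0 <= nu <= n. *)
Definition Omega (n : nat) (f : R -> R) : Prop :=
  exists a b : nat -> R, forall x : R, 0 < x ->
    f x = sum_n_m (fun nu : nat => a nu * x ^ nu + b nu * (x ^ nu * ln x)) 0 n.

Definition prod_1_n (f : nat -> R) (n : nat) : R :=
  fold_right Rmult 1 (map f (seq 1 n)).

Definition fact_prod (r k n : nat) : R :=
  prod_1_n (fun nu : nat => INR (fact (k * nu)) ^ (nu ^ r)) n.

Definition asymp_equiv (f g : nat -> R) : Prop :=
  is_lim_seq (fun n : nat => f n / g n) 1.

(* Main.v *)
Require Import Defs.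
From Stdlib Require Import Reals Lra Lia Factorial List Classical IndefiniteDescription Wf_nat.
From Coquelicot Require Import Coquelicot.

Open Scope R_scope.

(** Taking logarithms, Stirling's series gives, for [nu = 1, ..., n],

      [log (k nu)! = k nu log nu + (1/2) log nu + k nu log (k/e)
                     + (1/2) log (2 pi k) + sum_(2<=m<=r+2) Bhat_(m,k) nu^(1-m)
                     + rest].

    After multiplication by [nu^r] and summation over [nu], the terms free of
    [log nu] with [m <= r+1] become the power sums [S_j(n)] of [log P_(r,k)].
    The term [m = r+2] becomes [Bhat_(r+2,k)] times a harmonic number, that is
    [log n + gamma + o(1)].  The rests are [O(k^-(r+2) nu^-2)], so they form a
    convergent series whose sum vanishes as [k] grows.  This is where
    [F_(r,k) = exp (gamma Bhat_(r+2,k) + sum of the rests)] and its limit [1]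
    come from ([ln_fact_prod_expansion], [stirling_rem_sum_lim]).  What remains
    are the sums of [nu^r log nu] and [nu^(r+1) log nu], and [glaisher_limit]
    says that the sum of [nu^r log nu] minus [log Q_r(n)] tends to [log A_r].

    All sums are handled by one device, [em_step].  For a function [g] put
    [T = sum_(m<=M) (-1)^m B_m/m! g^(m)].  Then [g'(n)] differs from
    [T(n) - T(n-1)] by at most a constant times the maximum of [|g^(M+1)|]
    between [n-1] and [n]: this is Taylor's inequality combined with the
    recurrence of the Bernoulli numbers.  If that maximum is [O(n^-2)], the sum
    of [g'] minus [T] converges.  A power of [t] as [g] has error zero and yields
    [S_r] ([sum_powers]); [g = t log t - t] yields Stirling's series
    ([stirling_rem_bound], with the constant supplied by Wallis' integrals);
    [g = log t] yields Euler's constant ([harmonic_asymptotic]).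

    The zeta function enters through [g(t) = t^(1-s)].  Write [s = h - r] and
    expand in powers of [h].  For each [j] the coefficient of [h^j] is a real
    function of [t] to which [em_step] applies, with error [O(t^-2 R^-j)].
    Hence in

      [(1-s) sum_(nu<=N) nu^-s - T_N(s) = sum_j W_(N,j) h^j]

    the coefficients converge to numbers [c_j] as [N] grows and are [O(R^-j)]
    uniformly in [N].  So [G(h) = sum_j c_j h^j] is analytic for [|h| < R], and
    it equals [(1-s) zeta(s)] for [Re s > 1], where [T_N(s)] tends to [0]
    ([zeta_em_C_lim]).  The segment from [2+i] to [-r] avoids the point [1];
    the identity theorem along it ([identity_on_segment]) carries the equality
    to a neighbourhood of [s = -r], so that [c_0] and [c_1] determine [zeta(-r)]
    and [zeta'(-r)] ([zeta_from_em]).  But [c_0] and [c_1] are also the limits of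
    the explicit sequences [W_(N,0)] and [W_(N,1)], the second of which
    contains the sum of [nu^r log nu].  Comparing the two gives
    [glaisher_limit]. *)

(** * Finite sums and series of reals *)

(** A sum [sum_n] over the reals has the carrier of an abelian monoid as its
    type, which [ring] and [field] do not identify with [R]. *)
Ltac eq_R := match goal with |- @eq _ ?x ?y => change (@eq R x y) end.
Ltac ringR := eq_R; ring.

Lemma sum_n_ext_R (a b : nat -> R) (n : nat) :
  (forall i, (i <= n)%nat -> a i = b i) -> sum_n a n = sum_n b n.
Proof. exact (sum_n_ext_loc a b n). Qed.

Lemma sum_n_S (a : nat -> R) (n : nat) : sum_n a (S n) = sum_n a n + a (S n).
Proof. exact (sum_Sn a n). Qed.

Lemma sum_n_add (a b : nat -> R) (n : nat) :
  sum_n (fun i => a i + b i) n = sum_n a n + sum_n b n.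
Proof. exact (sum_n_plus a b n). Qed.

Lemma sum_n_mul (c : R) (a : nat -> R) (n : nat) :
  sum_n (fun i => c * a i) n = c * sum_n a n.
Proof. exact (sum_n_mult_l (K := R_Ring) c a n). Qed.

Lemma sum_n_sub (a b : nat -> R) (n : nat) :
  sum_n (fun i => a i - b i) n = sum_n a n - sum_n b n.
Proof.
  rewrite (sum_n_ext_R _ (fun i => a i + (-1) * b i)) by (intros; ring).
  rewrite sum_n_add, sum_n_mul. ringR.
Qed.

Lemma sum_n_first (a : nat -> R) (n : nat) :
  sum_n a (S n) = a O + sum_n (fun i => a (S i)) n.
Proof.
  induction n as [|n IH].
  - rewrite sum_n_S, !sum_O. ringR.
  - rewrite sum_n_S, IH, sum_n_S. ringR.
Qed.

Lemma sum_n_le (a b : nat -> R) (n : nat) :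
  (forall i, (i <= n)%nat -> a i <= b i) -> sum_n a n <= sum_n b n.
Proof.
  induction n as [|n IH]; intros H.
  - rewrite !sum_O. apply H; lia.
  - rewrite !sum_n_S. apply Rplus_le_compat; [apply IH; intros|]; apply H; lia.
Qed.

Lemma sum_n_abs (a : nat -> R) (n : nat) :
  Rabs (sum_n a n) <= sum_n (fun i => Rabs (a i)) n.
Proof.
  induction n as [|n IH].
  - rewrite !sum_O. lra.
  - rewrite !sum_n_S. eapply Rle_trans; [apply Rabs_triang|]. lra.
Qed.

Lemma sum_n_triangle (F : nat -> nat -> R) (M : nat) :
  sum_n (fun m => sum_n (F m) (M - m)) M =
  sum_n (fun l => sum_n (fun m => F m (l - m)%nat) l) M.
Proof.
  induction M as [|M IH].
  - rewrite !sum_O. reflexivity.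
  - rewrite (sum_n_S (fun l => sum_n _ l)), <- IH.
    rewrite (sum_n_S _ M), sum_n_S. rewrite !Nat.sub_diag, sum_O.
    rewrite <- Rplus_assoc, <- sum_n_add. f_equal.
    apply sum_n_ext_loc. intros m Hm.
    replace (S M - m)%nat with (S (M - m)) by lia. rewrite sum_n_S. reflexivity.
Qed.

Lemma is_series_shift (a : nat -> R) (l : R) :
  is_series (fun n => a (S n)) (l - a O) <-> is_series a l.
Proof.
  split; intros H.
  - apply (is_series_decr_1 (V := R_NormedModule) a). exact H.
  - apply (is_series_incr_1 (V := R_NormedModule) a).
    refine (eq_ind l (fun x => is_series a x) H _ _).
    unfold plus; simpl; ring.
Qed.

(** * Bernoulli numbers *)

Definition exp_m1_coef (n : nat) : R := match n with O => 0 | S _ => / INR (fact n) end.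

Lemma is_pseries_exp_m1 (z : R) : is_pseries exp_m1_coef z (exp z - 1).
Proof.
  apply is_pseries_R.
  assert (H := proj1 (is_pseries_R _ _ _) (is_exp_Reals z)).
  apply is_series_shift in H. apply is_series_shift. simpl in *.
  replace (exp z - 1 - 0 * 1) with (exp z - / 1 * 1) by field. exact H.
Qed.

Lemma is_series_zero_tail (a : nat -> R) (N : nat) (l : R) :
  (forall n, (N < n)%nat -> a n = 0) -> sum_n a N = l -> is_series a l.
Proof.
  intros H Hl. change (is_lim_seq (sum_n a) l). apply is_lim_seq_ext_loc with (fun _ => l); [|apply is_lim_seq_const].
  exists N. intros n Hn. induction n as [|n IH].
  - replace O with N by lia. auto.
  - destruct (Nat.eq_dec N (S n)) as [<-|Hne]; auto.
    rewrite sum_n_S, H by lia. rewrite <- IH by lia. ring.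
Qed.

Lemma CV_radius_pos_of_pseries (a : nat -> R) (rho : R) :
  0 < rho -> (forall z, 0 < Rabs z < rho -> ex_pseries a z) ->
  forall z, Rabs z < rho -> Rbar_lt (Rabs z) (CV_radius a).
Proof.
  intros Hr H z Hz.
  set (y := (Rabs z + rho) / 2). assert (0 <= Rabs z) by apply Rabs_pos.
  assert (Hy : Rabs y = y) by (apply Rabs_pos_eq; unfold y; lra).
  apply Rbar_lt_le_trans with y; [simpl; unfold y; lra|].
  destruct (Rbar_le_lt_dec y (CV_radius a)) as [|Hlt]; auto. exfalso.
  apply (CV_disk_outside a y); [rewrite Hy; exact Hlt|].
  apply (ex_series_lim_0 (fun n => a n * y ^ n)).
  destruct (H y) as [l Hl]; [rewrite Hy; unfold y; lra|].
  exists l. apply is_pseries_R. exact Hl.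
Qed.

Lemma CV_radius_gt_0 (a : nat -> R) (rho : posreal) :
  (forall z, Rabs z < rho -> ex_pseries a z) -> Rbar_lt 0 (CV_radius a).
Proof.
  intros H. rewrite <- Rabs_R0 at 1. apply (CV_radius_pos_of_pseries _ rho (cond_pos rho)).
  - intros z Hz. apply H, Hz.
  - rewrite Rabs_R0. apply cond_pos.
Qed.

Section Bernoulli.
Variable B : nat -> R.
Hypothesis HB : is_bernoulli B.

Lemma bernoulli_coef_conv : exists rho : posreal,
  (forall z, Rabs z < rho -> Rbar_lt (Rabs z) (CV_radius (fun m => B m / INR (fact m)))) /\
  (forall z, 0 < Rabs z < rho ->
     PSeries (fun m => B m / INR (fact m)) z = z / (exp z - 1)).
Proof.
  destruct HB as [rho H]. exists rho. split.
  - apply CV_radius_pos_of_pseries; [apply cond_pos|].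
    intros z Hz. eexists. apply H, Hz.
  - intros z Hz. apply is_pseries_unique, H, Hz.
Qed.

Lemma CV_radius_exp_m1 (z : R) : Rbar_lt (Rabs z) (CV_radius exp_m1_coef).
Proof.
  apply (CV_radius_pos_of_pseries _ (Rabs z + 1)).
  - assert (H := Rabs_pos z). lra.
  - intros y _. eexists. apply is_pseries_exp_m1.
  - lra.
Qed.

Definition X_coef (n : nat) : R := if Nat.eqb n 1 then 1 else 0.

Lemma is_pseries_X (z : R) : is_pseries X_coef z z.
Proof.
  apply is_pseries_R. apply is_series_zero_tail with 1%nat.
  - intros n Hn. unfold X_coef. replace (Nat.eqb n 1) with false; [ring|].
    symmetry; apply Nat.eqb_neq; lia.
  - rewrite sum_n_S, sum_O. unfold X_coef; simpl. ringR.
Qed.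

Lemma exp_neq_1 (z : R) : z <> 0 -> exp z - 1 <> 0.
Proof.
  intros Hz H. apply Hz, exp_inv. rewrite exp_0. lra.
Qed.

(** Comparison of coefficients in [(z / (e^z - 1)) (e^z - 1) = z], which also
    holds at [z = 0] once both sides are power series. *)
Lemma bernoulli_recurrence (l : nat) :
  sum_n (fun m => B m / INR (fact m) * exp_m1_coef (l - m)) l =
  X_coef l.
Proof.
  destruct bernoulli_coef_conv as [rho [Hcv Hval]].
  set (a := fun m => B m / INR (fact m)) in *.
  rewrite sum_n_Reals. change (PS_mult a exp_m1_coef l = X_coef l).
  assert (Hp : forall z, Rabs z < rho ->
    PSeries (PS_mult a exp_m1_coef) z = z /\ ex_pseries (PS_mult a exp_m1_coef) z).
  { intros z Hz. split.
    - rewrite PSeries_mult; [|apply Hcv, Hz|apply CV_radius_exp_m1].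
      rewrite (is_pseries_unique _ _ _ (is_pseries_exp_m1 z)).
      destruct (Req_dec z 0) as [->|Hnz].
      + rewrite exp_0. ring.
      + rewrite Hval by (split; [apply Rabs_pos_lt|]; assumption).
        field. apply exp_neq_1, Hnz.
    - apply ex_pseries_mult; [apply Hcv, Hz|apply CV_radius_exp_m1]. }
  apply PSeries_ext_recip.
  - apply (CV_radius_gt_0 _ rho). intros z Hz. apply Hp, Hz.
  - apply (CV_radius_gt_0 _ rho). intros z Hz. eexists. apply is_pseries_X.
  - exists rho. intros z Hz. unfold ball in Hz; simpl in Hz.
    unfold AbsRing_ball, abs, minus, plus, opp in Hz; simpl in Hz.
    rewrite Ropp_0, Rplus_0_r in Hz.
    rewrite (is_pseries_unique _ _ _ (is_pseries_X z)). apply Hp, Hz.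
Qed.

(** The function [z / (e^z - 1) + z / 2] is even: replacing [z] by [-z] in
    [z / (e^z - 1)] adds [z].  The identity is multiplied by [z] before
    coefficients are compared, so that it holds at [z = 0] too. *)
Lemma bernoulli_odd (m : nat) : Nat.odd m = true -> m <> 1%nat -> B m = 0.
Proof.
  intros Hodd Hm1.
  destruct bernoulli_coef_conv as [rho [Hcv Hval]].
  set (a := fun m => B m / INR (fact m)) in *.
  set (d := fun n => (-1) ^ n * a n - a n).
  assert (Hd : forall z, Rabs z < rho -> is_pseries d z (PSeries a (- z) - PSeries a z)).
  { intros z Hz.
    assert (H1 : is_pseries a (-z) (PSeries a (-z))).
    { apply PSeries_correct, CV_radius_inside. apply Hcv. rewrite Rabs_Ropp. exact Hz. }
    assert (H2 : is_pseries a z (PSeries a z)).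
    { apply PSeries_correct, CV_radius_inside. apply Hcv. exact Hz. }
    apply is_pseries_R in H1. apply is_pseries_R in H2. apply is_pseries_R.
    assert (H3 := is_series_minus _ _ _ _ H1 H2).
    revert H3. apply is_series_ext. intros n.
    unfold d, minus, plus, opp; simpl.
    replace (- z) with ((-1) * z) by ring. rewrite Rpow_mult_distr. ring. }
  assert (HX : PS_incr_1 d (S m) = PS_incr_1 X_coef (S m)).
  { apply PSeries_ext_recip.
    - apply (CV_radius_gt_0 _ rho).
      intros z Hz. eexists. apply is_pseries_incr_1, Hd, Hz.
    - apply (CV_radius_gt_0 _ rho).
      intros z Hz. eexists. apply is_pseries_incr_1, is_pseries_X.
    - exists rho. intros z Hz. unfold ball in Hz; simpl in Hz.
      unfold AbsRing_ball, abs, minus, plus, opp in Hz; simpl in Hz.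
      rewrite Ropp_0, Rplus_0_r in Hz.
      rewrite (is_pseries_unique _ _ _ (is_pseries_incr_1 _ _ _ (Hd z Hz))).
      rewrite (is_pseries_unique _ _ _ (is_pseries_incr_1 _ _ _ (is_pseries_X z))).
      unfold scal; simpl; unfold mult; simpl.
      destruct (Req_dec z 0) as [->|Hnz]; [ring|].
      rewrite !Hval; try (rewrite ?Rabs_Ropp; split; [apply Rabs_pos_lt|]; assumption).
      assert (He := exp_neq_1 z Hnz). assert (Hp := exp_pos z).
      rewrite exp_Ropp. field. split; [|lra]. intro. apply He. lra. }
  unfold PS_incr_1, X_coef, d in HX.
  replace (Nat.eqb m 1) with false in HX by (symmetry; apply Nat.eqb_neq, Hm1).
  apply Nat.odd_spec in Hodd. destruct Hodd as [p ->].
  replace ((-1) ^ (2 * p + 1)) with (-1) in HX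
    by (rewrite pow_add, pow_1_even; ring).
  assert (Hf := INR_fact_neq_0 (2 * p + 1)).
  assert (Ha : a (2 * p + 1)%nat = 0) by lra.
  unfold a in Ha. apply Rmult_integral in Ha. destruct Ha as [Ha|Ha]; auto.
  apply Rinv_neq_0_compat in Hf. contradiction.
Qed.

End Bernoulli.

(** * Taylor's inequality *)
Lemma is_derive_const_R (c t : R) : is_derive (fun _ : R => c) t 0.
Proof. exact (is_derive_const (V := R_NormedModule) c t). Qed.

Lemma nonpos_of_derive_nonneg (f df : R -> R) (a b : R) :
  (forall t, a <= t <= b -> is_derive f t (df t)) ->
  (forall t, a <= t <= b -> 0 <= df t) -> f b = 0 ->
  forall t, a <= t <= b -> f t <= 0.
Proof.
  intros Hf Hdf Hb t Ht.
  destruct (MVT_gen f t b df) as [c [Hc E]].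
  - intros x Hx. rewrite Rmin_left, Rmax_right in Hx by lra. apply Hf. lra.
  - intros x Hx. rewrite Rmin_left, Rmax_right in Hx by lra.
    apply continuity_pt_filterlim. apply (ex_derive_continuous f).
    eexists. apply Hf. lra.
  - rewrite Rmin_left, Rmax_right in Hc by lra.
    assert (0 <= df c * (b - t)) by (apply Rmult_le_pos; [apply Hdf|]; lra). lra.
Qed.

Lemma INR_fact_S (n : nat) : INR (fact (S n)) = INR (S n) * INR (fact n).
Proof. rewrite fact_simpl, mult_INR. reflexivity. Qed.

Lemma INR_S_pos (n : nat) : 0 < INR (S n).
Proof. apply lt_0_INR. lia. Qed.

(** [f] and [- f] are both dominated by the primitive of the bound on [df]
    that vanishes at [b], by monotonicity of the differences. *)
Lemma integrate_power_bound (f df : R -> R) (a b K : R) (M : nat) :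
  (forall t, a <= t <= b -> is_derive f t (df t)) ->
  (forall t, a <= t <= b -> Rabs (df t) <= K * (b - t) ^ M / INR (fact M)) ->
  f b = 0 ->
  forall t, a <= t <= b -> Rabs (f t) <= K * (b - t) ^ (S M) / INR (fact (S M)).
Proof.
  intros Hf Hdf Hb t Ht.
  assert (Hfact := INR_fact_neq_0 M). assert (HS := INR_S_pos M).
  set (p := fun t => K * (b - t) ^ (S M) / INR (fact (S M))).
  assert (Hp : forall t, is_derive p t (- (K * (b - t) ^ M / INR (fact M)))).
  { intros x. unfold p. rewrite INR_fact_S. auto_derive; [trivial|].
    change (match M with O => 1 | S _ => INR M + 1 end) with (INR (S M)).
 change (b + - x) with (b - x). field. split; [exact Hfact|lra]. }
  assert (Hpb : p b = 0).
  { unfold p. rewrite Rminus_diag. simpl. unfold Rdiv. ring. }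
  assert (H1 : f t - p t <= 0).
  { apply (nonpos_of_derive_nonneg (fun t => f t - p t)
      (fun t => df t + K * (b - t) ^ M / INR (fact M)) a b); auto.
    - intros x Hx. replace (df x + _) with (df x - - (K * (b - x) ^ M / INR (fact M))) by ring.
      apply (is_derive_minus f p); auto.
    - intros x Hx. assert (H := Hdf x Hx). apply Rabs_le_between in H. lra.
    - rewrite Hb, Hpb. ring. }
  assert (H2 : - f t - p t <= 0).
  { apply (nonpos_of_derive_nonneg (fun t => - f t - p t)
      (fun t => - df t + K * (b - t) ^ M / INR (fact M)) a b); auto.
    - intros x Hx. replace (- df x + _) with (- df x - - (K * (b - x) ^ M / INR (fact M))) by ring.
      apply (is_derive_minus (fun t => - f t) p); auto.
      apply (is_derive_opp f); auto.
    - intros x Hx. assert (H := Hdf x Hx). apply Rabs_le_between in H. lra.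
    - rewrite Hb, Hpb. ring. }
  apply Rabs_le. fold (p t). lra.
Qed.

Lemma is_derive_taylor_poly (c : nat -> R) (b t : R) (M : nat) :
  is_derive (fun t => sum_n (fun i => c i * (t - b) ^ i / INR (fact i)) (S M)) t
    (sum_n (fun i => c (S i) * (t - b) ^ i / INR (fact i)) M).
Proof.
  apply is_derive_ext with
    (fun t => c O + sum_n (fun i => c (S i) * (t - b) ^ (S i) / INR (fact (S i))) M).
  { intros x. rewrite (sum_n_first (fun i => c i * (x - b) ^ i / INR (fact i))).
    simpl (_ ^ 0). simpl (fact 0). eq_R. f_equal. simpl. field. }
  rewrite <- (Rplus_0_l (sum_n _ M)).
  apply (is_derive_plus (fun _ => c O)); [apply is_derive_const_R|].
  apply (is_derive_sum_n (fun i t => c (S i) * (t - b) ^ (S i) / INR (fact (S i)))).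
  intros i _. rewrite INR_fact_S.
  assert (Hfact := INR_fact_neq_0 i). assert (HS := INR_S_pos i).
  auto_derive; [trivial|].
  change (match i with O => 1 | S _ => INR i + 1 end) with (INR (S i)).
  change (t + - b) with (t - b). eq_R. field. split; [exact Hfact|lra].
Qed.

(** Induction on [M]: the difference is a primitive of the same difference for
    the family shifted by one.  A family [D] with [(D m)' = D (S m)] stands for
    the iterated derivatives, so that each application can supply closed forms.
    The expansion is at the right end point because the Bernoulli terms below
    are taken at [n] and the sums have their last term at [n]. *)
Lemma taylor_bound (D : nat -> R -> R) (a b K : R) (M : nat) :
  (forall m t, a <= t <= b -> is_derive (D m) t (D (S m) t)) ->
  (forall t, a <= t <= b -> Rabs (D (S M) t) <= K) ->
  forall t, a <= t <= b ->
  Rabs (D O t - sum_n (fun i => D i b * (t - b) ^ i / INR (fact i)) M)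
    <= K * (b - t) ^ (S M) / INR (fact (S M)).
Proof.
  revert D. induction M as [|M IH]; intros D HD HK.
  - apply integrate_power_bound with (D 1%nat).
    + intros t Ht. apply is_derive_ext with (fun t => D O t - D O b).
      * intros x. rewrite sum_O. simpl. eq_R. field.
      * rewrite <- (Rminus_0_r (D 1%nat t)).
        apply (is_derive_minus (D O) (fun _ => D O b)); [apply HD, Ht|apply is_derive_const_R].
    + intros t Ht. simpl. replace (K * 1 / 1) with K by field. apply HK, Ht.
    + rewrite sum_O. simpl. field.
  - apply integrate_power_bound with
      (fun t => D 1%nat t - sum_n (fun i => D (S i) b * (t - b) ^ i / INR (fact i)) M).
    + intros t Ht. apply (is_derive_minus (D O)); [apply HD, Ht|].
      apply (is_derive_taylor_poly (fun i => D i b)).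
    + apply (IH (fun m => D (S m))); auto.
    + rewrite sum_n_first.
      rewrite (sum_n_ext_R _ (fun _ => 0 * 0)).
      * rewrite sum_n_mul. simpl. field.
      * intros i _. rewrite Rminus_diag. simpl (0 ^ S i). unfold Rdiv. ring.
Qed.

(** * Euler-Maclaurin summation *)

Section EulerMaclaurin.
Variable B : nat -> R.
Hypothesis HB : is_bernoulli B.

(** The sign makes [B_1] count as [+1/2], as it does in [S_r]: the summation
    includes its upper end point. *)
Definition em_coef (m : nat) : R := (-1) ^ m * B m / INR (fact m).

Definition em_sum (D : nat -> R -> R) (M : nat) (x : R) : R :=
  sum_n (fun m => em_coef m * D m x) M.

Definition em_const (M : nat) : R := sum_n (fun m => Rabs (em_coef m)) M.

(** Collected by the order [l = m + i] of the derivative, the double sum has the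
    coefficients of [bernoulli_recurrence], so only [l = 1] survives. *)
Lemma em_cancel (c : nat -> R) (M : nat) : (1 <= M)%nat ->
  sum_n (fun m => em_coef m *
     sum_n (fun i => (-1) ^ i * exp_m1_coef i * c (m + i)%nat) (M - m)) M = - c 1%nat.
Proof.
  intros HM.
  rewrite (sum_n_ext_R _ (fun m => sum_n (fun i =>
    em_coef m * ((-1) ^ i * exp_m1_coef i * c (m + i)%nat)) (M - m))).
  2:{ intros m _. symmetry. apply sum_n_mul. }
  rewrite (sum_n_triangle (fun m i => em_coef m * ((-1) ^ i * exp_m1_coef i * c (m + i)%nat))).
  rewrite (sum_n_ext_R _ (fun l => (-1) ^ l * c l * X_coef l)).
  2:{ intros l _. rewrite <- (bernoulli_recurrence B HB l), <- sum_n_mul.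
      apply sum_n_ext_R. intros m Hm. unfold em_coef.
      replace (m + (l - m))%nat with l by lia.
      replace ((-1) ^ l) with ((-1) ^ m * (-1) ^ (l - m)); [field; apply INR_fact_neq_0|].
      rewrite <- pow_add. f_equal. lia. }
  destruct M as [|M]; [lia|]. clear HM.
  induction M as [|M IH].
  - rewrite sum_n_S, sum_O. unfold X_coef. simpl. ringR.
  - rewrite sum_n_S, IH. unfold X_coef. simpl. ringR.
Qed.

(** Each [D m (n - 1)] is expanded by Taylor's formula at [n] up to the
    derivative of order [M]; by [em_cancel] the expansions contribute just
    [D 1 n], and the error consists of the Taylor remainders. *)
Lemma em_step (D : nat -> R -> R) (n K : R) (M : nat) : (1 <= M)%nat ->
  (forall m t, n - 1 <= t <= n -> is_derive (D m) t (D (S m) t)) ->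
  (forall t, n - 1 <= t <= n -> Rabs (D (S M) t) <= K) ->
  Rabs (D 1%nat n - (em_sum D M n - em_sum D M (n - 1))) <= K * em_const M.
Proof.
  intros HM HD HK.
  set (T := fun m => sum_n (fun i => (-1) ^ i * D (m + i)%nat n / INR (fact i)) (M - m)).
  assert (Hrem : forall m, (m <= M)%nat -> Rabs (D m (n - 1) - T m) <= K).
  { intros m Hm.
    assert (H := taylor_bound (fun i => D (m + i)%nat) (n - 1) n K (M - m)).
    specialize (H ltac:(intros i t Ht; cbv beta; rewrite <- plus_n_Sm; apply HD, Ht)).
    specialize (H ltac:(intros t Ht; cbv beta; replace (m + S (M - m))%nat with (S M) by lia; apply HK, Ht)).
    specialize (H (n - 1) ltac:(lra)).
    cbv beta in H. rewrite Nat.add_0_r in H.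
    replace (n - (n - 1)) with 1 in H by ring. rewrite pow1, Rmult_1_r in H.
    replace (T m) with (sum_n (fun i => D (m + i)%nat n * (n - 1 - n) ^ i / INR (fact i)) (M - m)).
    - eapply Rle_trans; [exact H|].
      assert (HK0 : 0 <= K).
      { eapply Rle_trans; [apply Rabs_pos|]. apply (HK n). lra. }
      assert (Hf : 1 <= INR (fact (S (M - m)))).
      { change 1 with (INR 1). apply le_INR. apply (fact_le 0). lia. }
      rewrite <- (Rmult_1_r K) at 2. apply Rmult_le_compat_l; [exact HK0|].
      rewrite <- Rinv_1. apply Rinv_le_contravar; lra.
    - apply sum_n_ext_R. intros i _. replace (n - 1 - n) with (-1) by ring.
      unfold Rdiv. ring. }
  assert (Hexp : forall m, (m <= M)%nat -> T m = D m n +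
     sum_n (fun i => (-1) ^ i * exp_m1_coef i * D (m + i)%nat n) (M - m)).
  { intros m _. unfold T. destruct (M - m)%nat as [|p].
    - rewrite !sum_O. rewrite Nat.add_0_r. simpl. eq_R. field.
    - rewrite !sum_n_first, Nat.add_0_r. simpl (exp_m1_coef 0). simpl (_ ^ 0). simpl (fact 0).
      rewrite (sum_n_ext_R (fun i => (-1) ^ S i * exp_m1_coef (S i) * D (m + S i)%nat n)
        (fun i => (-1) ^ S i * D (m + S i)%nat n / INR (fact (S i)))).
      + simpl INR. eq_R. field.
      + intros i _. unfold exp_m1_coef, Rdiv. ring. }
  replace (D 1%nat n - (em_sum D M n - em_sum D M (n - 1))) with
    (sum_n (fun m => em_coef m * (D m (n - 1) - T m)) M).
  - eapply Rle_trans; [apply sum_n_abs|].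
    unfold em_const. rewrite <- sum_n_mul. apply sum_n_le. intros m Hm.
    rewrite Rabs_mult, Rmult_comm. apply Rmult_le_compat_r; [apply Rabs_pos|apply Hrem, Hm].
  - unfold em_sum. rewrite <- sum_n_sub.
    replace (D 1%nat n) with (- (- D 1%nat n)) by ring.
    rewrite <- (em_cancel (fun m => D m n) M HM).
    rewrite (sum_n_ext_R _ (fun m => - 1 * (em_coef m * sum_n (fun i => (-1) ^ i * exp_m1_coef i * D (m + i)%nat n) (M - m))
       - (em_coef m * D m n - em_coef m * D m (n - 1)))).
    + rewrite sum_n_sub, sum_n_mul. eq_R. ring.
    + intros m Hm. rewrite (Hexp m Hm). ring.
Qed.
End EulerMaclaurin.

Lemma inv_sq_telescope (n : nat) : / INR (S n) ^ 2 <= 2 * (/ INR (S n) - / INR (S (S n))).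
Proof.
  assert (H := INR_S_pos n). rewrite (S_INR (S n)). set (x := INR (S n)) in *.
  assert (1 <= x). { unfold x. change 1 with (INR 1). apply le_INR. lia. }
  replace (/ x - / (x + 1)) with (/ (x * (x + 1))) by (field; lra).
  replace (2 * / (x * (x + 1))) with (/ (x * (x + 1) / 2)) by (field; lra).
  apply Rinv_le_contravar; nra.
Qed.

Lemma INR_S_ge_1 (n : nat) : 1 <= INR (S n).
Proof. change 1 with (INR 1). apply le_INR. lia. Qed.

Lemma is_lim_seq_inv_INR_S : is_lim_seq (fun n => / INR (S n)) 0.
Proof.
  apply (is_lim_seq_incr_1 (fun n => / INR n)).
  replace (Finite 0) with (Rbar_inv p_infty) by reflexivity.
  apply is_lim_seq_inv; [apply is_lim_seq_INR|discriminate].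
Qed.

(** From index [n] on, the factor [i^-p] of the increments is at most [n^-p], and
    what is left is compared with the telescoping differences of [2/i]. *)
Lemma lim_of_increments (W : nat -> R) (c : R) (p : nat) :
  (forall n, Rabs (W (S n) - W n) <= c / INR (S n) ^ (p + 2)) ->
  exists l : R, is_lim_seq W l /\ forall n, Rabs (W n - l) <= 2 * c / INR (S n) ^ p.
Proof.
  intros H.
  assert (Hc : 0 <= c).
  { assert (H0 := Rle_trans _ _ _ (Rabs_pos _) (H O)). rewrite pow1 in H0. lra. }
  assert (Hd : forall n k, Rabs (W (k + n)%nat - W n) <=
    2 * c / INR (S n) ^ p * (/ INR (S n) - / INR (S (k + n)))).
  { intros n k. assert (Hn := INR_S_pos n).
    assert (Hnp := pow_lt _ p Hn).
    induction k as [|k IH].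
    - simpl (0 + n)%nat. rewrite !Rminus_diag, Rabs_R0, Rmult_0_r. lra.
    - simpl (S k + n)%nat.
      replace (W (S (k + n)) - W n) with ((W (S (k + n)) - W (k + n)%nat) + (W (k + n)%nat - W n)) by ring.
      eapply Rle_trans; [apply Rabs_triang|].
      assert (H1 := H (k + n)%nat). assert (H2 := inv_sq_telescope (k + n)).
      assert (Hkn := INR_S_pos (k + n)).
      assert (Hle : INR (S n) <= INR (S (k + n))) by (apply le_INR; lia).
      assert (c / INR (S (k + n)) ^ (p + 2) <=
        c / INR (S n) ^ p * (2 * (/ INR (S (k + n)) - / INR (S (S (k + n)))))).
      { rewrite pow_add. unfold Rdiv. rewrite Rinv_mult, <- Rmult_assoc.
        apply Rmult_le_compat.
        - apply Rmult_le_pos; [exact Hc|]. left. apply Rinv_0_lt_compat, pow_lt, Hkn.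
        - left. apply Rinv_0_lt_compat, pow_lt, Hkn.
        - apply Rmult_le_compat_l; [exact Hc|]. apply Rinv_le_contravar; [exact Hnp|].
          apply pow_incr. lra.
        - exact H2. }
      replace (2 * c / INR (S n) ^ p * (/ INR (S n) - / INR (S (S (k + n))))) with
       (c / INR (S n) ^ p * (2 * (/ INR (S (k + n)) - / INR (S (S (k + n))))) +
        2 * c / INR (S n) ^ p * (/ INR (S n) - / INR (S (k + n)))); [lra|].
      field. assert (Hkn2 := INR_S_pos (S (k + n))). lra. }
  assert (Hd' : forall n k, Rabs (W (k + n)%nat - W n) <= 2 * c / INR (S n) ^ p * / INR (S n)).
  { intros n k. eapply Rle_trans; [apply Hd|].
    apply Rmult_le_compat_l.
    - apply Rmult_le_pos; [lra|]. left. apply Rinv_0_lt_compat, pow_lt, INR_S_pos.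
    - assert (Hx := Rinv_0_lt_compat _ (INR_S_pos (k + n))). lra. }
  assert (Hd1 : forall n k, Rabs (W (k + n)%nat - W n) <= 2 * c * / INR (S n)).
  { intros n k. eapply Rle_trans; [apply Hd'|].
    apply Rmult_le_compat_r; [left; apply Rinv_0_lt_compat, INR_S_pos|].
    unfold Rdiv. rewrite <- (Rmult_1_r (2 * c)) at 2. apply Rmult_le_compat_l; [lra|].
    rewrite <- Rinv_1. apply Rinv_le_contravar; [lra|].
    apply pow_R1_Rle, INR_S_ge_1. }
  assert (Hcv : ex_finite_lim_seq W).
  { apply ex_lim_seq_cauchy_corr. intros eps.
    destruct (archimed_cor1 (eps / (4 * c + 1))) as [N [HN HN0]].
    { apply Rdiv_lt_0_compat; [apply cond_pos|lra]. }
    exists N. intros n m Hn Hm.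
    assert (HNpos : 0 < INR N) by (apply lt_0_INR; lia).
    assert (HS : / INR (S N) <= / INR N).
    { apply Rinv_le_contravar; [exact HNpos|apply le_INR; lia]. }
    assert (H1 := Hd1 N (n - N)%nat). assert (H2 := Hd1 N (m - N)%nat).
    replace (n - N + N)%nat with n in H1 by lia. replace (m - N + N)%nat with m in H2 by lia.
    replace (W n - W m) with ((W n - W N) - (W m - W N)) by ring.
    eapply Rle_lt_trans; [apply Rabs_triang|]. rewrite Rabs_Ropp.
    assert (Hlt : (4 * c + 1) * / INR N < eps).
    { apply Rmult_lt_reg_r with (/ (4 * c + 1)); [apply Rinv_0_lt_compat; lra|].
      unfold Rdiv in HN. replace ((4 * c + 1) * / INR N * / (4 * c + 1)) with (/ INR N); [exact HN|].
      field. lra. }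
    assert (0 < / INR N) by (apply Rinv_0_lt_compat, HNpos).
    assert (2 * c * / INR (S N) <= 2 * c * / INR N) by (apply Rmult_le_compat_l; lra).
    lra. }
  destruct Hcv as [l Hl]. exists l. split; [exact Hl|].
  intros n.
  assert (Hlim : is_lim_seq (fun k => Rabs (W n - W (k + n)%nat)) (Rabs (W n - l))).
  { apply (is_lim_seq_abs _ (W n - l)). apply is_lim_seq_minus'; [apply is_lim_seq_const|].
    apply (is_lim_seq_incr_n W n). exact Hl. }
  refine (is_lim_seq_le _ (fun _ => _) _ _ _ Hlim (is_lim_seq_const _)).
  intros k. rewrite Rabs_minus_sym. eapply Rle_trans; [apply Hd'|].
  rewrite <- (Rmult_1_r (2 * c / INR (S n) ^ p)) at 2. apply Rmult_le_compat_l.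
  - apply Rmult_le_pos; [lra|]. left. apply Rinv_0_lt_compat, pow_lt, INR_S_pos.
  - rewrite <- Rinv_1. apply Rinv_le_contravar; [lra|apply INR_S_ge_1].
Qed.

Lemma sum_n_rev (a : nat -> R) (n : nat) : sum_n a n = sum_n (fun i => a (n - i)%nat) n.
Proof.
  induction n as [|n IH].
  - rewrite !sum_O. reflexivity.
  - rewrite (sum_n_first (fun i => a (S n - i)%nat)), sum_n_S, IH.
    rewrite Rplus_comm. reflexivity.
Qed.

Fixpoint falling_fact (x : R) (m : nat) : R :=
  match m with O => 1 | S m' => falling_fact x m' * (x - INR m') end.

Lemma falling_fact_quotient (n m : nat) : (m <= n)%nat ->
  falling_fact (INR n) m = INR (fact n) / INR (fact (n - m)).
Proof.
  induction m as [|m IH]; intros Hm.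
  - rewrite Nat.sub_0_r. simpl. field. apply INR_fact_neq_0.
  - simpl falling_fact. rewrite IH by lia.
    replace (n - m)%nat with (S (n - S m)) by lia. rewrite INR_fact_S.
    rewrite <- minus_INR by lia. replace (n - m)%nat with (S (n - S m)) by lia.
    field. split; [apply INR_fact_neq_0|]. apply Rgt_not_eq, INR_S_pos.
Qed.

Lemma falling_fact_0 (n m : nat) : (n < m)%nat -> falling_fact (INR n) m = 0.
Proof.
  induction m as [|m IH]; intros Hm; [lia|]. simpl.
  destruct (Nat.eq_dec n m) as [->|Hne]; [ring|]. rewrite IH by lia. ring.
Qed.

Definition pow_derivs (n m : nat) (t : R) : R := falling_fact (INR n) m * t ^ (n - m).

Lemma is_derive_pow_derivs (n m : nat) (t : R) :
  is_derive (pow_derivs n m) t (pow_derivs n (S m) t).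
Proof.
  unfold pow_derivs.
  destruct (Nat.lt_ge_cases m n) as [Hlt|Hge].
  - replace (n - m)%nat with (S (n - S m)) by lia. auto_derive; [trivial|].
    change (match (n - S m)%nat with O => 1 | S _ => INR (n - S m) + 1 end) with (INR (S (n - S m))).
    simpl falling_fact. rewrite <- minus_INR by lia. replace (n - m)%nat with (S (n - S m)) by lia.
    simpl pow. ring.
  - rewrite (falling_fact_0 n (S m)) by lia. rewrite Rmult_0_l.
    replace (n - m)%nat with O by lia. exact (is_derive_const_R (falling_fact (INR n) m * 1) t).
Qed.

Section Summation.
Variable B : nat -> R.
Hypothesis HB : is_bernoulli B.

(** The index [i] stands for the summand [i + 1], here and below: sums start at
    [1] while [sum_n] starts at [0]. *)
Definition em_diff (D : nat -> R -> R) (M n : nat) : R :=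
  sum_n (fun i => D 1%nat (INR (S i))) n - em_sum B D M (INR (S n)).

(** [em_step] bounds the increments of [em_diff]. *)
Lemma em_converges (D : nat -> R -> R) (M p : nat) (c : R) : (1 <= M)%nat ->
  (forall m t, 1 <= t -> is_derive (D m) t (D (S m) t)) ->
  (forall t, 1 <= t -> Rabs (D (S M) t) <= c / t ^ (p + 2)) ->
  exists l : R, is_lim_seq (em_diff D M) l /\
    forall n, Rabs (em_diff D M n - l) <= 2 * (c * em_const B M) / INR (S n) ^ p.
Proof.
  intros HM HD Hc. apply lim_of_increments. intros n.
  assert (H1 := INR_S_ge_1 n).
  assert (Hc0 : 0 <= c).
  { assert (H0 := Rle_trans _ _ _ (Rabs_pos _) (Hc 1 ltac:(lra))). rewrite pow1 in H0. lra. }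
  unfold em_diff. rewrite sum_n_S.
  replace (_ - _) with (D 1%nat (INR (S (S n))) -
    (em_sum B D M (INR (S (S n))) - em_sum B D M (INR (S (S n)) - 1))).
  - replace (c * em_const B M / INR (S n) ^ (p + 2)) with
      (c / INR (S n) ^ (p + 2) * em_const B M) by (unfold Rdiv; ring).
    rewrite (S_INR (S n)).
    apply em_step; auto.
    + intros m t Ht. apply HD. lra.
    + intros t Ht. eapply Rle_trans; [apply Hc; lra|].
      apply Rmult_le_compat_l; [exact Hc0|]. apply Rinv_le_contravar; [apply pow_lt; lra|].
      apply pow_incr. lra.
  - rewrite (S_INR (S n)). replace (INR (S n) + 1 - 1) with (INR (S n)) by ring. ring.
Qed.

Lemma B_0 : B O = 1.
Proof.
  assert (H := bernoulli_recurrence B HB 1). rewrite sum_n_S, sum_O in H.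
  unfold X_coef in H. simpl in H. lra.
Qed.

(** * Power sums *)

(** [S_r] is the Euler-Maclaurin polynomial of [t^(r+1)], up to the factor
    [r + 1] and a constant; this constant will be [- (r+1) zeta(-r)]. *)
Lemma Spoly_em_sum (r : nat) (x : R) :
  em_sum B (pow_derivs (S r)) (S r) x =
  INR (S r) * Spoly B r x + em_coef B (S r) * INR (fact (S r)).
Proof.
  unfold em_sum. rewrite sum_n_S.
  rewrite sum_n_rev. unfold Spoly. change (sum_n_m ?f 0 r) with (sum_n f r).
  rewrite <- sum_n_mul. f_equal.
  - apply sum_n_ext_R. intros j Hj. unfold Scoef, pow_derivs, em_coef, Binomial.C.
    rewrite falling_fact_quotient by lia.
    replace (S r - (r - j))%nat with (S j) by lia.
    replace (j + 1)%nat with (S j) by lia. rewrite !INR_fact_S.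
    field. repeat split; try apply INR_fact_neq_0; apply Rgt_not_eq, INR_S_pos.
  - unfold pow_derivs. rewrite falling_fact_quotient by lia. rewrite Nat.sub_diag. simpl (_ ^ 0).
    simpl (fact 0). simpl (INR 1). field.
Qed.

Lemma Spoly_0 (r : nat) : Spoly B r 0 = 0.
Proof.
  unfold Spoly. change (sum_n_m ?f 0 r) with (sum_n f r).
  rewrite (sum_n_ext_R _ (fun j => 0 * 0)).
  - rewrite sum_n_mul. eq_R. ring.
  - intros j _. replace (j + 1)%nat with (S j) by lia. simpl pow. ring.
Qed.

(** The Taylor remainders of a polynomial vanish, which makes [em_step] exact. *)
Lemma Spoly_step (r : nat) (x : R) : Spoly B r x - Spoly B r (x - 1) = x ^ r.
Proof.
  assert (H := em_step B HB (pow_derivs (S r)) x 0 (S r) ltac:(lia)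
    (fun m t _ => is_derive_pow_derivs (S r) m t)).
  rewrite Rmult_0_l, !Spoly_em_sum in H.
  assert (H' : Rabs (pow_derivs (S r) 1 x - (INR (S r) * (Spoly B r x - Spoly B r (x - 1)))) <= 0).
  { refine (Rle_trans _ _ _ (Req_le _ _ _) (H _)); [f_equal; ring|].
    intros t _. unfold pow_derivs. rewrite falling_fact_0 by lia. rewrite Rmult_0_l, Rabs_R0. lra. }
  assert (H2 := Rabs_eq_0 _ (Rle_antisym _ _ H' (Rabs_pos _))).
  unfold pow_derivs in H2. replace (S r - 1)%nat with r in H2 by lia. simpl falling_fact in H2.
  assert (Hr := INR_S_pos r). apply Rmult_eq_reg_l with (INR (S r)); [|lra].
  change (match r with O => 1 | S _ => INR r + 1 end) with (INR (S r)) in H2. lra.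
Qed.

Lemma sum_powers (r n : nat) : sum_n (fun i => INR (S i) ^ r) n = Spoly B r (INR (S n)).
Proof.
  induction n as [|n IH].
  - rewrite sum_O. rewrite <- Spoly_step. simpl (INR 1). rewrite Rminus_diag, Spoly_0. eq_R. ring.
  - rewrite sum_n_S, IH, <- Spoly_step. rewrite (S_INR (S n)).
    replace (INR (S n) + 1 - 1) with (INR (S n)) by ring. eq_R. ring.
Qed.

(** * Harmonic numbers *)

(** The successive derivatives of [t log t - t]. *)
Definition log_derivs (m : nat) (t : R) : R :=
  match m with
  | O => t * ln t - t
  | 1%nat => ln t
  | S (S m) => (-1) ^ m * INR (fact m) / t ^ (S m)
  end.

Lemma is_derive_log_derivs (m : nat) (t : R) : 0 < t ->
  is_derive (log_derivs m) t (log_derivs (S m) t).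
Proof.
  intros Ht. destruct m as [|[|m]]; unfold log_derivs.
  - auto_derive; [exact Ht|]. field. lra.
  - auto_derive; [exact Ht|]. simpl. field. lra.
  - assert (Hp := pow_lt t (S m) Ht). assert (Hp' := pow_lt t m Ht). auto_derive; [simpl in *; lra|].
    change (match m with O => 1 | S _ => INR m + 1 end) with (INR (S m)).
    rewrite INR_fact_S. simpl pow. field. lra.
Qed.

Lemma harmonic_asymptotic : exists gamma : R,
  is_lim_seq (fun n => sum_n (fun i => / INR (S i)) n - ln (INR (S n))) gamma.
Proof.
  destruct (em_converges (fun m => log_derivs (S m)) 1 0 1) as [l [Hl _]].
  - lia.
  - intros m t Ht. apply is_derive_log_derivs. lra.
  - intros t Ht. simpl. apply Req_le. unfold Rdiv. rewrite Rabs_mult.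
    rewrite Rabs_inv, (Rabs_pos_eq (t * _)).
    + f_equal. rewrite !Rmult_1_r. unfold Rabs; destruct Rcase_abs; lra.
    + nra.
  - exists l. apply is_lim_seq_ext with
      (fun n => em_diff (fun m => log_derivs (S m)) 1 n + em_coef B 1 * / INR (S n)).
    + intros n. unfold em_diff, em_sum. rewrite sum_n_S, sum_O.
      unfold em_coef at 1. rewrite B_0. unfold log_derivs.
      rewrite (sum_n_ext_R (fun i => (-1) ^ 0 * INR (fact 0) / INR (S i) ^ 1) (fun i => / INR (S i))).
      * simpl (fact 0). simpl (_ ^ 0). rewrite pow_1. simpl (INR 1). eq_R.
        field. apply Rgt_not_eq, INR_S_pos.
      * intros i _. rewrite pow_1. simpl (fact 0). simpl. field. apply Rgt_not_eq, INR_S_pos.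
    + replace l with (l + em_coef B 1 * 0) by ring. apply is_lim_seq_plus'; [exact Hl|].
      apply (is_lim_seq_scal_l _ _ 0), is_lim_seq_inv_INR_S.
Qed.

End Summation.

(** * Stirling's series *)

Definition wallis (n : nat) : R := RInt (fun x => sin x ^ n) 0 (PI / 2).

Lemma is_RInt_wallis (n : nat) : is_RInt (fun x => sin x ^ n) 0 (PI / 2) (wallis n).
Proof.
  apply (RInt_correct (V := R_CompleteNormedModule)), (ex_RInt_continuous (V := R_CompleteNormedModule)).
  intros z _. apply (ex_derive_continuous (fun x => sin x ^ n)). auto_derive. trivial.
Qed.

Lemma wallis_rec (n : nat) : INR (S (S n)) * wallis (S (S n)) = INR (S n) * wallis n.
Proof.
  assert (H : is_RInt (fun x => INR (S (S n)) * sin x ^ (S (S n)) - INR (S n) * sin x ^ n) 0 (PI / 2)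
    (INR (S (S n)) * wallis (S (S n)) - INR (S n) * wallis n)).
  { apply (is_RInt_minus (V := R_NormedModule)
      (fun x => INR (S (S n)) * sin x ^ (S (S n))) (fun x => INR (S n) * sin x ^ n));
    apply (is_RInt_scal (V := R_NormedModule)); apply is_RInt_wallis. }
  assert (H' : is_RInt (fun x => INR (S (S n)) * sin x ^ (S (S n)) - INR (S n) * sin x ^ n) 0 (PI / 2)
    (- cos (PI / 2) * sin (PI / 2) ^ (S n) - - cos 0 * sin 0 ^ (S n))).
  { apply (is_RInt_derive (V := R_CompleteNormedModule) (fun x => - cos x * sin x ^ (S n))).
    - intros x _. auto_derive; [trivial|].
      change (match n with O => 1 | S _ => INR n + 1 end) with (INR (S n)).
      assert (Hc : cos x * cos x = 1 - sin x * sin x).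
      { assert (E := sin2_cos2 x). unfold Rsqr in E. lra. }
      rewrite (S_INR (S n)). simpl pow.
      transitivity (sin x * (sin x * sin x ^ n) - (cos x * cos x) * INR (S n) * sin x ^ n); [ring|].
      rewrite Hc. ring.
    - intros x _. apply (ex_derive_continuous (fun x => INR (S (S n)) * sin x ^ (S (S n)) - INR (S n) * sin x ^ n)).
      auto_derive. trivial. }
  assert (E := is_RInt_unique _ _ _ _ H). rewrite (is_RInt_unique _ _ _ _ H') in E.
  rewrite cos_PI2, sin_0 in E. simpl (0 ^ S n) in E. lra.
Qed.

Lemma wallis_decr (n : nat) : wallis (S n) <= wallis n.
Proof.
  assert (Hpi := PI_RGT_0).
  apply (RInt_le (fun x => sin x ^ S n) (fun x => sin x ^ n)); try lra.
  - eexists; apply is_RInt_wallis.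
  - eexists; apply is_RInt_wallis.
  - intros x Hx. assert (H0 : 0 <= sin x) by (apply sin_ge_0; lra).
    assert (H1 := SIN_bound x). simpl. rewrite <- (Rmult_1_l (sin x ^ n)) at 2.
    apply Rmult_le_compat_r; [apply pow_le, H0|lra].
Qed.

Lemma wallis_0 : wallis 0 = PI / 2.
Proof.
  unfold wallis. rewrite (RInt_ext _ (fun _ => 1)).
  - rewrite RInt_const. unfold scal; simpl; unfold mult; simpl. ring.
  - reflexivity.
Qed.

Lemma wallis_1 : wallis 1 = 1.
Proof.
  assert (H : is_RInt (fun x => sin x ^ 1) 0 (PI / 2) (- cos (PI / 2) - - cos 0)).
  { apply (is_RInt_derive (V := R_CompleteNormedModule) (fun x => - cos x)).
    - intros x _. auto_derive; [trivial|]. ring.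
    - intros x _. apply (ex_derive_continuous (fun x => sin x ^ 1)). auto_derive. trivial. }
  unfold wallis. rewrite (is_RInt_unique _ _ _ _ H), cos_PI2, cos_0. ring.
Qed.

(** [4^n] over the central binomial coefficient. *)
Definition wallis_ratio (n : nat) : R := 4 ^ n * INR (fact n) ^ 2 / INR (fact (2 * n)).

Lemma wallis_ratio_pos (n : nat) : 0 < wallis_ratio n.
Proof.
  unfold wallis_ratio. apply Rdiv_lt_0_compat; [apply Rmult_lt_0_compat; apply pow_lt|]; try apply INR_fact_lt_0. lra.
Qed.

Lemma wallis_ratio_S (n : nat) : wallis_ratio (S n) = wallis_ratio n * (2 * INR (S n)) / (2 * INR n + 1).
Proof.
  unfold wallis_ratio. replace (2 * S n)%nat with (S (S (2 * n))) by lia.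
  rewrite !INR_fact_S. rewrite !S_INR, mult_INR. change (INR 2) with 2.
  assert (H := pos_INR n). simpl pow. field.
  repeat split; try apply INR_fact_neq_0; lra.
Qed.

Lemma wallis_even_odd (n : nat) :
  wallis (2 * n) = PI / 2 / wallis_ratio n /\ wallis (2 * n + 1) = wallis_ratio n / (2 * INR n + 1).
Proof.
  induction n as [|n [IH1 IH2]].
  - split; [change (wallis 0 = PI / 2 / wallis_ratio 0); rewrite wallis_0|
            change (wallis 1 = wallis_ratio 0 / (2 * INR 0 + 1)); rewrite wallis_1];
    unfold wallis_ratio; simpl; field.
  - replace (2 * S n)%nat with (S (S (2 * n))) by lia.
    replace (S (S (2 * n)) + 1)%nat with (S (S (2 * n + 1))) by lia.
    assert (H1 := wallis_rec (2 * n)). assert (H2 := wallis_rec (2 * n + 1)).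
    rewrite IH1 in H1. rewrite IH2 in H2. assert (Hn := pos_INR n). assert (Hc := wallis_ratio_pos n).
    rewrite !S_INR, mult_INR in H1. rewrite !S_INR, plus_INR, mult_INR in H2.
    change (INR 2) with 2 in *. simpl (INR 1) in *. rewrite wallis_ratio_S, S_INR.
    split.
    + apply Rmult_eq_reg_l with (2 * INR n + 1 + 1); [|lra]. rewrite H1. field. lra.
    + apply Rmult_eq_reg_l with (2 * INR n + 1 + 1 + 1); [|lra]. rewrite H2. field. lra.
Qed.

(** Wallis' product: [wallis (2n+1) <= wallis (2n) <= wallis (2n-1)], with each
    integral expressed by [wallis_ratio n]. *)
Lemma wallis_ratio_bounds (n : nat) :
  PI <= wallis_ratio (S n) ^ 2 / INR (S n) <= PI + PI / 2 * / INR (S n).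
Proof.
  assert (Hpi := PI_RGT_0). assert (Hn := INR_S_pos n). assert (Hc := wallis_ratio_pos (S n)).
  destruct (wallis_even_odd (S n)) as [H1 H2].
  assert (H3 := wallis_decr (2 * S n)). replace (S (2 * S n)) with (2 * S n + 1)%nat in H3 by lia.
  assert (H4 := wallis_decr (2 * n + 1)). replace (S (2 * n + 1)) with (2 * S n)%nat in H4 by lia.
  assert (H5 := wallis_rec (2 * n + 1)).
  replace (S (S (2 * n + 1))) with (2 * S n + 1)%nat in H5 by lia.
  replace (S (2 * n + 1)) with (2 * S n)%nat in H5 by lia.
  rewrite H2, plus_INR, mult_INR in H5. rewrite H1, H2 in H3. rewrite H1 in H4.
  change (INR 2) with 2 in H5. simpl (INR 1) in H5.
  set (x := INR (S n)) in *. set (c := wallis_ratio (S n)) in *. 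
  assert (H6 : wallis (2 * n + 1) = c / (2 * x)).
  { apply Rmult_eq_reg_l with (2 * x); [|lra]. rewrite <- H5. field. lra. }
  rewrite H6 in H4. clear H5 H6 H1 H2.
  assert (H3' : c ^ 2 <= PI / 2 * (2 * x + 1)).
  { apply Rmult_le_compat_r with (r := c * (2 * x + 1)) in H3; [|nra].
    replace (c / (2 * x + 1) * (c * (2 * x + 1))) with (c ^ 2) in H3 by (field; lra).
    replace (PI / 2 / c * (c * (2 * x + 1))) with (PI / 2 * (2 * x + 1)) in H3 by (field; lra). exact H3. }
  assert (H4' : PI * x <= c ^ 2).
  { apply Rmult_le_compat_r with (r := c * (2 * x)) in H4; [|nra].
    replace (c / (2 * x) * (c * (2 * x))) with (c ^ 2) in H4 by (field; lra).
    replace (PI / 2 / c * (c * (2 * x))) with (PI * x) in H4 by (field; lra). exact H4. }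
  split.
  - apply Rmult_le_reg_r with x; [exact Hn|].
    replace (c ^ 2 / x * x) with (c ^ 2) by (field; lra). exact H4'.
  - apply Rmult_le_reg_r with x; [exact Hn|].
    replace (c ^ 2 / x * x) with (c ^ 2) by (field; lra).
    replace ((PI + PI / 2 * / x) * x) with (PI / 2 * (2 * x + 1)) by (field; lra). exact H3'.
Qed.

Lemma ln_wallis_ratio_limit : is_lim_seq (fun n => ln (wallis_ratio (S n) ^ 2 / INR (S n))) (ln PI).
Proof.
  assert (H : is_lim_seq (fun n => wallis_ratio (S n) ^ 2 / INR (S n)) PI).
  { apply is_lim_seq_le_le with (fun _ => PI) (fun n => PI + PI / 2 * / INR (S n)).
    - apply wallis_ratio_bounds.
    - apply is_lim_seq_const.
    - replace (Finite PI) with (Finite (PI + PI / 2 * 0)) by (f_equal; ring).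
      apply is_lim_seq_plus'; [apply is_lim_seq_const|].
      apply (is_lim_seq_scal_l _ _ 0), is_lim_seq_inv_INR_S. }
  apply (is_lim_seq_continuous ln _ PI); [|exact H].
  apply derivable_continuous_pt. exists (/ PI). apply derivable_pt_lim_ln, PI_RGT_0.
Qed.

Section Stirling.
Variable B : nat -> R.
Hypothesis HB : is_bernoulli B.

Definition log_fact_main (x : R) : R := x * ln x - x + / 2 * ln x.

Definition stirling_sum (r N : nat) : R := sum_n (fun i => Bhat B (S (S i)) N) r.

Lemma sum_ln (n : nat) : sum_n (fun i => ln (INR (S i))) n = ln (INR (fact (S n))).
Proof.
  induction n as [|n IH].
  - rewrite sum_O. reflexivity.
  - rewrite sum_n_S, IH, (INR_fact_S (S n)), ln_mult; [|apply INR_S_pos|apply INR_fact_lt_0].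
    eq_R. ring.
Qed.

Lemma B_1 : B 1%nat = - / 2.
Proof.
  assert (H := bernoulli_recurrence B HB 2). rewrite !sum_n_S, sum_O in H.
  unfold X_coef in H. simpl in H. rewrite (B_0 B HB) in H. lra.
Qed.

Lemma em_sum_log (r n : nat) :
  em_sum B log_derivs (S (S r)) (INR (S n)) = log_fact_main (INR (S n)) + stirling_sum r (S n).
Proof.
  unfold em_sum, stirling_sum. rewrite !sum_n_first. 
  unfold em_coef at 1 2. rewrite (B_0 B HB), B_1. unfold log_derivs at 1 2, log_fact_main.
  rewrite (sum_n_ext_R (fun i => em_coef B (S (S i)) * _) (fun i => Bhat B (S (S i)) (S n))).
  - simpl (fact _). simpl (_ ^ 0). simpl (_ ^ 1). eq_R. simpl (INR 1). field.
  - intros i _. unfold em_coef, Bhat, log_derivs. rewrite !INR_fact_S.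
    replace (S (S i) - 1)%nat with (S i) by lia.
    replace ((-1) ^ S (S i)) with ((-1) ^ i) by (simpl; ring).
    assert (Hi : (-1) ^ i * (-1) ^ i = 1).
    { rewrite <- Rpow_mult_distr. replace (-1 * -1) with 1 by ring. apply pow1. }
    rewrite (S_INR (S i)). assert (H1 := INR_S_pos i). assert (H2 := INR_fact_neq_0 i).
    assert (H3 := INR_S_pos n). assert (H4 := pow_lt _ (S i) H3).
    transitivity (((-1) ^ i * (-1) ^ i) * B (S (S i)) / ((INR (S i) + 1) * INR (S i) * INR (S n) ^ S i)).
    + field. lra.
    + rewrite Hi. field. lra.
Qed.

(** The weak exponent [p] lets the same bound serve for terms that are to be
    absorbed into an error of order [n^-p]. *)
Lemma Bhat_abs_le (i n : nat) (p : nat) : (p <= S i)%nat ->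
  Rabs (Bhat B (S (S i)) (S n)) <= Rabs (B (S (S i))) / INR (S n) ^ p.
Proof.
  intros Hp. unfold Bhat. replace (S (S i) - 1)%nat with (S i) by lia.
  rewrite (S_INR (S i)). assert (H1 := INR_S_ge_1 i). assert (H3 := INR_S_ge_1 n).
  assert (H4 : 0 < INR (S n) ^ p) by (apply pow_lt; lra).
  assert (H5 : INR (S n) ^ p <= INR (S n) ^ S i) by (apply Rle_pow; [lra|exact Hp]).
  unfold Rdiv. rewrite Rabs_mult. apply Rmult_le_compat_l; [apply Rabs_pos|].
  rewrite Rabs_inv. apply Rinv_le_contravar; [exact H4|].
  rewrite Rabs_pos_eq; nra.
Qed.

(** Two more Bernoulli terms than wanted are used, so that the increments are
    small enough for the error [O(n^-(r+2))]; these two terms are of that order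
    themselves and join the error. *)
Lemma stirling_up_to_constant (r : nat) : exists l C : R,
  is_lim_seq (fun n => ln (INR (fact (S n))) - log_fact_main (INR (S n))) l /\
  forall n, Rabs (ln (INR (fact (S n))) - log_fact_main (INR (S n)) - stirling_sum r (S n) - l)
     <= C / INR (S n) ^ (r + 2).
Proof.
  destruct (em_converges B HB log_derivs (S (S (S (S r)))) (r + 2) (INR (fact (S (S (S r)))))) as [l [Hl Hb]].
  - lia.
  - intros m t Ht. apply is_derive_log_derivs. lra.
  - intros t Ht. unfold log_derivs. replace (r + 2 + 2)%nat with (S (S (S (S r)))) by lia.
    unfold Rdiv. rewrite !Rabs_mult, <- RPow_abs, Rabs_inv.
    replace (Rabs (-1)) with 1 by (unfold Rabs; destruct Rcase_abs; lra). rewrite pow1, Rmult_1_l.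
    rewrite (Rabs_pos_eq (INR _)) by apply pos_INR.
    rewrite (Rabs_pos_eq (t ^ _)) by (apply pow_le; lra). lra.
  - set (C0 := 2 * (INR (fact (S (S (S r)))) * em_const B (S (S (S (S r)))))) in *.
    exists l, (C0 + Rabs (B (S (S (S r)))) + Rabs (B (S (S (S (S r)))))). 
    assert (Hall : forall n, Rabs (ln (INR (fact (S n))) - log_fact_main (INR (S n)) - stirling_sum r (S n) - l)
     <= (C0 + Rabs (B (S (S (S r)))) + Rabs (B (S (S (S (S r)))))) / INR (S n) ^ (r + 2)).
    { intros n. assert (H := Hb n). unfold em_diff in H. rewrite em_sum_log in H.
      unfold stirling_sum in H. rewrite !(sum_n_S _ (S r)), (sum_n_S _ r) in H.
      fold (stirling_sum r (S n)) in H. 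
      change (sum_n (fun i => log_derivs 1 (INR (S i))) n) with (sum_n (fun i => ln (INR (S i))) n) in H.
      rewrite sum_ln in H.
      assert (H1 := Bhat_abs_le (S r) n (r + 2) ltac:(lia)).
      assert (H2 := Bhat_abs_le (S (S r)) n (r + 2) ltac:(lia)).
      unfold Rdiv in *. rewrite !Rmult_plus_distr_r.
      set (q := / INR (S n) ^ (r + 2)) in *.
      apply Rabs_le_between in H. apply Rabs_le_between in H1. apply Rabs_le_between in H2.
      apply Rabs_le. lra. }
    split; [|exact Hall].
    set (C := C0 + Rabs (B (S (S (S r)))) + Rabs (B (S (S (S (S r)))))) in *.
    set (C' := C + sum_n (fun i => Rabs (B (S (S i)))) r).
    apply is_lim_seq_le_le with (fun n => l - C' * / INR (S n)) (fun n => l + C' * / INR (S n)).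
    + intros n. assert (H := Hall n).
      assert (Hs : Rabs (stirling_sum r (S n)) <= sum_n (fun i => Rabs (B (S (S i)))) r * / INR (S n)).
      { unfold stirling_sum. eapply Rle_trans; [apply sum_n_abs|].
        rewrite Rmult_comm, <- sum_n_mul. apply sum_n_le. intros i _.
        replace (/ INR (S n) * Rabs (B (S (S i)))) with (Rabs (B (S (S i))) / INR (S n) ^ 1)
          by (rewrite pow_1; unfold Rdiv; ring).
        apply Bhat_abs_le. lia. }
      assert (HC : 0 <= C).
      { apply Rle_trans with (C / INR (S n) ^ (r + 2) * INR (S n) ^ (r + 2)).
        - apply Rmult_le_pos; [|apply pow_le, pos_INR].
          eapply Rle_trans; [apply Rabs_pos|exact H].
        - apply Req_le. field. apply pow_nonzero, Rgt_not_eq, INR_S_pos. }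
      assert (H' : C / INR (S n) ^ (r + 2) <= C * / INR (S n)).
      { apply Rmult_le_compat_l; [exact HC|]. apply Rinv_le_contravar; [apply INR_S_pos|].
        rewrite <- (pow_1 (INR (S n))) at 1. apply Rle_pow; [apply INR_S_ge_1|lia]. }
      apply Rabs_le_between in H. apply Rabs_le_between in Hs. unfold C'. rewrite !Rmult_plus_distr_r. lra.
    + replace (Finite l) with (Finite (l - C' * 0)) by (f_equal; ring).
      apply is_lim_seq_minus'; [apply is_lim_seq_const|].
      apply (is_lim_seq_scal_l _ _ 0), is_lim_seq_inv_INR_S.
    + replace (Finite l) with (Finite (l + C' * 0)) by (f_equal; ring).
      apply is_lim_seq_plus'; [apply is_lim_seq_const|].
      apply (is_lim_seq_scal_l _ _ 0), is_lim_seq_inv_INR_S.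
Qed.

(** If [s_n] tends to [l] then so does [2 s_n - s_(2n)], and this combination
    contains the factorials through [wallis_ratio] alone. *)
Lemma stirling_constant (l : R) :
  is_lim_seq (fun n => ln (INR (fact (S n))) - log_fact_main (INR (S n))) l -> l = / 2 * ln (2 * PI).
Proof.
  intros Hl. set (s := fun n => ln (INR (fact (S n))) - log_fact_main (INR (S n))) in *.
  assert (H2 : is_lim_seq (fun n => s (2 * n + 1)%nat) l).
  { apply is_lim_seq_subseq with (phi := fun n => (2 * n + 1)%nat) in Hl; [exact Hl|].
    apply eventually_subseq. intros n. lia. }
  assert (H3 : is_lim_seq (fun n => 2 * s n - s (2 * n + 1)%nat) (2 * l - l)).
  { apply is_lim_seq_minus'; [|exact H2]. apply (is_lim_seq_scal_l _ 2 l), Hl. }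
  assert (H4 : is_lim_seq (fun n => / 2 * ln (wallis_ratio (S n) ^ 2 / INR (S n)) + / 2 * ln 2) (2 * l - l)).
  { revert H3. apply is_lim_seq_ext. intros n. unfold s, log_fact_main.
    replace (S (2 * n + 1)) with (2 * S n)%nat by lia. rewrite mult_INR. change (INR 2) with 2.
    assert (Hn := INR_S_pos n). set (x := INR (S n)) in *.
    unfold wallis_ratio. assert (Hf := INR_fact_lt_0 (S n)). assert (Hf2 := INR_fact_lt_0 (2 * S n)).
    assert (H4 : 0 < 4 ^ S n) by (apply pow_lt; lra).
    rewrite ln_mult by lra.
    rewrite ln_div; [|apply pow_lt, Rdiv_lt_0_compat; [apply Rmult_lt_0_compat; [|apply pow_lt]|]; assumption|assumption].
    rewrite ln_pow; [|apply Rdiv_lt_0_compat; [apply Rmult_lt_0_compat; [|apply pow_lt]|]; assumption].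
    rewrite ln_div; [|apply Rmult_lt_0_compat; [|apply pow_lt]; assumption|assumption].
    rewrite ln_mult; [|assumption|apply pow_lt; assumption].
    rewrite (ln_pow (INR (fact (S n)))) by assumption. rewrite ln_pow by lra.
    replace (ln 4) with (2 * ln 2) by (replace 4 with (2 * 2) by ring; rewrite ln_mult by lra; ring).
    fold x. change (INR 2) with 2. field. }
  assert (H5 : is_lim_seq (fun n => / 2 * ln (wallis_ratio (S n) ^ 2 / INR (S n)) + / 2 * ln 2) (/ 2 * ln PI + / 2 * ln 2)).
  { apply is_lim_seq_plus'; [|apply is_lim_seq_const].
    apply (is_lim_seq_scal_l _ (/ 2) (ln PI)), ln_wallis_ratio_limit. }
  apply is_lim_seq_unique in H4. apply is_lim_seq_unique in H5. rewrite H4 in H5.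
  injection H5 as H5. rewrite ln_mult; [lra|lra|apply PI_RGT_0].
Qed.

Definition stirling_rem (r N : nat) : R :=
  ln (INR (fact N)) - (log_fact_main (INR N) + / 2 * ln (2 * PI) + stirling_sum r N).

Lemma stirling_rem_bound (r : nat) : exists C : R, 0 <= C /\ forall N, (1 <= N)%nat ->
  Rabs (stirling_rem r N) <= C / INR N ^ (r + 2).
Proof.
  destruct (stirling_up_to_constant r) as [l [C [Hl HC]]]. exists C.
  assert (HC' : forall N, (1 <= N)%nat -> Rabs (stirling_rem r N) <= C / INR N ^ (r + 2)).
  { intros [|n] HN; [lia|]. assert (H := HC n). rewrite (stirling_constant l Hl) in H.
    unfold stirling_rem. refine (Rle_trans _ _ _ (Req_le _ _ _) H). f_equal. ring. }
  split; [|exact HC'].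
  assert (H := HC' 1%nat ltac:(lia)). simpl (INR 1) in H. rewrite pow1 in H.
  assert (H0 := Rabs_pos (stirling_rem r 1)). lra.
Qed.

End Stirling.

(** * Complex power series *)

Definition Csum (a : nat -> C) (n : nat) : C := sum_n (G := C_AbelianMonoid) a n.

Lemma Csum_O (a : nat -> C) : Csum a 0 = a 0%nat.
Proof. exact (sum_O (G := C_AbelianMonoid) a). Qed.

Lemma Csum_S (a : nat -> C) (n : nat) : Csum a (S n) = (Csum a n + a (S n))%C.
Proof. exact (sum_Sn (G := C_AbelianMonoid) a n). Qed.

Lemma Csum_ext (a b : nat -> C) (n : nat) :
  (forall i, (i <= n)%nat -> a i = b i) -> Csum a n = Csum b n.
Proof. exact (sum_n_ext_loc (G := C_AbelianMonoid) a b n). Qed.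

Lemma Csum_add (a b : nat -> C) (n : nat) :
  Csum (fun i => a i + b i)%C n = (Csum a n + Csum b n)%C.
Proof. exact (sum_n_plus (G := C_AbelianMonoid) a b n). Qed.

Lemma Csum_mul (c : C) (a : nat -> C) (n : nat) :
  Csum (fun i => c * a i)%C n = (c * Csum a n)%C.
Proof. exact (sum_n_mult_l (K := C_Ring) c a n). Qed.

Lemma Csum_sub (a b : nat -> C) (n : nat) :
  Csum (fun i => a i - b i)%C n = (Csum a n - Csum b n)%C.
Proof.
  rewrite (Csum_ext _ (fun i => a i + (- (1)) * b i)%C) by (intros; ring).
  rewrite Csum_add, Csum_mul. ring.
Qed.

Lemma Csum_RtoC (a : nat -> R) (n : nat) : Csum (fun i => RtoC (a i)) n = RtoC (sum_n a n).
Proof.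
  induction n as [|n IH].
  - rewrite Csum_O, sum_O. reflexivity.
  - rewrite Csum_S, sum_n_S, IH, RtoC_plus. reflexivity.
Qed.

Lemma Cmod_Csum (a : nat -> C) (n : nat) : Cmod (Csum a n) <= sum_n (fun i => Cmod (a i)) n.
Proof.
  induction n as [|n IH].
  - rewrite Csum_O, sum_O. lra.
  - rewrite Csum_S, sum_n_S. eapply Rle_trans; [apply Cmod_triangle|]. lra.
Qed.

Lemma Cmod_minus_sym (x y : C) : Cmod (x - y) = Cmod (y - x).
Proof. rewrite <- Cmod_opp. f_equal. ring. Qed.

Lemma Cmod_triangle_minus (x y z : C) : Cmod (x - z) <= Cmod (x - y) + Cmod (y - z).
Proof. replace (x - z)%C with ((x - y) + (y - z))%C by ring. apply Cmod_triangle. Qed.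

Definition Clim (u : nat -> C) (l : C) : Prop := is_lim_seq (fun n => Cmod (u n - l)) 0.

Lemma Clim_squeeze (u : nat -> C) (l : C) (e : nat -> R) :
  (forall n, Cmod (u n - l) <= e n) -> is_lim_seq e 0 -> Clim u l.
Proof.
  intros H He. apply is_lim_seq_le_le with (fun _ => 0) e; [|apply is_lim_seq_const|exact He].
  intros n. split; [apply Cmod_ge_0|apply H].
Qed.

Lemma Clim_ext (u v : nat -> C) (l : C) : (forall n, u n = v n) -> Clim u l -> Clim v l.
Proof. intros E. apply is_lim_seq_ext. intros n. rewrite E. reflexivity. Qed.

Lemma Clim_const (l : C) : Clim (fun _ => l) l.
Proof.
  apply Clim_squeeze with (fun _ => 0); [|apply is_lim_seq_const].
  intros _. replace (l - l)%C with (RtoC 0) by ring. rewrite Cmod_0. lra.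
Qed.

Lemma Clim_add (u v : nat -> C) (l m : C) :
  Clim u l -> Clim v m -> Clim (fun n => u n + v n)%C (l + m)%C.
Proof.
  intros Hu Hv. apply Clim_squeeze with (fun n => Cmod (u n - l) + Cmod (v n - m)).
  - intros n. replace (u n + v n - (l + m))%C with ((u n - l) + (v n - m))%C by ring.
    apply Cmod_triangle.
  - replace (Finite 0) with (Finite (0 + 0)) by (f_equal; ring). apply is_lim_seq_plus'; assumption.
Qed.

Lemma Clim_mul (c : C) (u : nat -> C) (l : C) : Clim u l -> Clim (fun n => c * u n)%C (c * l)%C.
Proof.
  intros Hu. apply Clim_squeeze with (fun n => Cmod c * Cmod (u n - l)).
  - intros n. rewrite <- Cmod_mult. apply Req_le. f_equal. ring.
  - replace (Finite 0) with (Finite (Cmod c * 0)) by (f_equal; ring).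
    apply (is_lim_seq_scal_l _ _ 0), Hu.
Qed.

Lemma Clim_sub (u v : nat -> C) (l m : C) :
  Clim u l -> Clim v m -> Clim (fun n => u n - v n)%C (l - m)%C.
Proof.
  intros Hu Hv. apply (Clim_mul (- (1))) in Hv. assert (H := Clim_add _ _ _ _ Hu Hv).
  replace (l - m)%C with (l + - (1) * m)%C by ring. revert H. apply Clim_ext. intros; ring.
Qed.

Lemma Clim_unique (u : nat -> C) (l m : C) : Clim u l -> Clim u m -> l = m.
Proof.
  intros Hl Hm. assert (H := Clim_sub _ _ _ _ Hl Hm).
  assert (H' : Clim (fun _ => RtoC 0) (l - m)) by (revert H; apply Clim_ext; intros; ring).
  unfold Clim in H'. assert (E := is_lim_seq_unique _ _ H'). rewrite Lim_seq_const in E.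
  injection E as E. apply Cmod_eq_0 in E.
  replace l with (m - (0 - (l - m)))%C by ring. rewrite E. ring.
Qed.

Lemma Clim_RtoC (u : nat -> R) (l : R) : is_lim_seq u l -> Clim (fun n => RtoC (u n)) (RtoC l).
Proof.
  intros H. apply Clim_squeeze with (fun n => Rabs (u n - l)).
  - intros n. rewrite <- RtoC_minus, Cmod_R. lra.
  - replace (Finite 0) with (Finite (Rabs (l - l))) by (rewrite Rminus_diag, Rabs_R0; reflexivity).
    apply (is_lim_seq_abs _ (l - l)). apply is_lim_seq_minus'; [exact H|apply is_lim_seq_const].
Qed.

Lemma Clim_le (u : nat -> C) (l : C) (z : C) (K : R) (N : nat) :
  Clim u l -> (forall n, (N <= n)%nat -> Cmod (u n - z) <= K) -> Cmod (l - z) <= K.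
Proof.
  intros Hu H.
  assert (Hlim : is_lim_seq (fun n => Cmod (u n - l) + K) (0 + K)).
  { apply is_lim_seq_plus'; [exact Hu|apply is_lim_seq_const]. }
  rewrite Rplus_0_l in Hlim.
  refine (is_lim_seq_le_loc (fun _ => Cmod (l - z)) _ _ _ _ (is_lim_seq_const _) Hlim).
  exists N. intros n Hn. eapply Rle_trans; [apply (Cmod_triangle_minus l (u n))|].
  rewrite Cmod_minus_sym. apply Rplus_le_compat_l, H, Hn.
Qed.

Lemma pow_n_Cpow (z : C) (k : nat) : pow_n (K := C_Ring) z k = (z ^ k)%C.
Proof. induction k as [|k IH]; simpl; [reflexivity|]. rewrite IH. reflexivity. Qed.

Lemma is_series_Clim (a : nat -> C) (l : C) :
  is_series (K := C_AbsRing) (V := C_NormedModule) a l <-> Clim (Csum a) l.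
Proof.
  split.
  - intros H. apply is_lim_seq_spec. intros eps.
    assert (Hs : 0 < eps / sqrt 2) by (apply Rdiv_lt_0_compat; [apply cond_pos|apply Rlt_sqrt2_0]).
    destruct (proj1 (filterlim_locally (U := C_NormedModule) _ l) H (mkposreal _ Hs)) as [N HN].
    exists N. intros n Hn. specialize (HN n Hn).
    assert (H2 := C_NormedModule_mixin_compat2 l (Csum a n) (mkposreal _ Hs) HN).
    simpl in H2. rewrite Rminus_0_r, Rabs_pos_eq by apply Cmod_ge_0.
    assert (Hq := Rlt_sqrt2_0).
    replace (sqrt 2 * (eps / sqrt 2)) with (pos eps) in H2 by (field; lra). exact H2.
  - intros H. apply (proj2 (filterlim_locally (U := C_NormedModule) _ l)). intros eps.
    apply is_lim_seq_spec in H. destruct (H eps) as [N HN]. exists N. intros n Hn.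
    specialize (HN n Hn). rewrite Rminus_0_r, Rabs_pos_eq in HN by apply Cmod_ge_0.
    apply C_NormedModule_mixin_compat1. exact HN.
Qed.

Definition Cpsum (a : nat -> C) (z : C) (n : nat) : C := Csum (fun k => a k * z ^ k)%C n.

Definition Cpseries (a : nat -> C) (z l : C) : Prop := Clim (Cpsum a z) l.

Lemma is_pseries_C (a : nat -> C) (z l : C) :
  is_pseries (K := C_AbsRing) (V := C_NormedModule) a z l <-> Cpseries a z l.
Proof.
  unfold is_pseries. rewrite is_series_Clim. unfold Cpseries.
  assert (E : forall k, scal (K := C_AbsRing) (V := C_NormedModule) (pow_n (K := C_AbsRing) z k) (a k)
    = (a k * z ^ k)%C).
  { intros k. rewrite <- pow_n_Cpow. apply Cmult_comm. }
  split; apply Clim_ext; intros n; apply Csum_ext; intros k _; rewrite E; reflexivity.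
Qed.

(** Cauchy's estimates, the only form in which the size of coefficients is
    used: unlike absolute convergence they pass to termwise limits at once. *)
Definition coef_bound (a : nat -> C) (K r : R) : Prop :=
  forall k, Cmod (a k) <= K / r ^ k.

Lemma coef_bound_ge_0 (a : nat -> C) (K r : R) : coef_bound a K r -> 0 <= K.
Proof.
  intros H. assert (H0 := H O). assert (H1 := Cmod_ge_0 (a O)). simpl in H0. lra.
Qed.

Lemma coef_bound_term (a : nat -> C) (K r q : R) (z : C) (k : nat) :
  0 < r -> coef_bound a K r -> Cmod z <= q * r -> Cmod (a k * z ^ k)%C <= K * q ^ k.
Proof.
  intros Hr H Hz. rewrite Cmod_mult, Cmod_pow.
  assert (Hrk := pow_lt r k Hr).
  apply Rle_trans with (K / r ^ k * (q * r) ^ k).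
  - apply Rmult_le_compat; [apply Cmod_ge_0|apply pow_le, Cmod_ge_0|apply H|].
    apply pow_incr. split; [apply Cmod_ge_0|exact Hz].
  - rewrite Rpow_mult_distr. apply Req_le. field. lra.
Qed.

Lemma Cpsum_cauchy (a : nat -> C) (K r q : R) (z : C) (n m : nat) :
  0 < r -> 0 <= q < 1 -> coef_bound a K r -> Cmod z <= q * r ->
  Cmod (Cpsum a z (m + n) - Cpsum a z n) <= K * q ^ (S n) / (1 - q).
Proof.
  intros Hr Hq H Hz.
  assert (HK := coef_bound_ge_0 _ _ _ H).
  assert (Hm : Cmod (Cpsum a z (m + n) - Cpsum a z n) <= K * q ^ (S n) / (1 - q) * (1 - q ^ m)).
  { induction m as [|m IH].
    - simpl. replace (Cpsum a z n - Cpsum a z n)%C with (RtoC 0) by ring. rewrite Cmod_0. lra.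
    - simpl (S m + n)%nat. unfold Cpsum at 1. rewrite Csum_S. fold (Cpsum a z (m + n)).
      replace (Cpsum a z (m + n) + a (S (m + n)) * z ^ S (m + n) - Cpsum a z n)%C with
        ((Cpsum a z (m + n) - Cpsum a z n) + a (S (m + n)) * z ^ S (m + n))%C by ring.
      eapply Rle_trans; [apply Cmod_triangle|].
      assert (Ht := coef_bound_term a K r q z (S (m + n)) Hr H Hz).
      replace (K * q ^ S n / (1 - q) * (1 - q ^ S m)) with
        (K * q ^ S n / (1 - q) * (1 - q ^ m) + K * q ^ S (m + n)); [lra|].
      replace (S (m + n)) with (S n + m)%nat by lia. rewrite pow_add. simpl. field. lra. }
  eapply Rle_trans; [exact Hm|].
  assert (Hqm : 0 <= q ^ m) by (apply pow_le; lra).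
  rewrite <- (Rmult_1_r (K * q ^ S n / (1 - q))) at 2. apply Rmult_le_compat_l; [|lra].
  apply Rmult_le_pos; [apply Rmult_le_pos; [exact HK|apply pow_le; lra]|].
  left. apply Rinv_0_lt_compat. lra.
Qed.

Lemma Cpseries_remainder (a : nat -> C) (K r q : R) (z l : C) (n : nat) :
  0 < r -> 0 <= q < 1 -> coef_bound a K r -> Cmod z <= q * r ->
  Cpseries a z l -> Cmod (l - Cpsum a z n) <= K * q ^ (S n) / (1 - q).
Proof.
  intros Hr Hq H Hz Hl. apply (Clim_le _ _ _ _ n Hl).
  intros m Hm. replace m with (m - n + n)%nat by lia.
  apply Cpsum_cauchy with r; assumption.
Qed.

(** Comparison with a geometric series. *)
Lemma Cpseries_converges (a : nat -> C) (K r : R) (z : C) :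
  0 < r -> coef_bound a K r -> Cmod z < r -> exists l, Cpseries a z l.
Proof.
  intros Hr H Hz.
  set (q := Cmod z / r).
  assert (Hq : 0 <= q < 1).
  { unfold q. split; [apply Rdiv_le_0_compat; [apply Cmod_ge_0|exact Hr]|].
    apply Rlt_div_l; lra. }
  assert (Hzq : Cmod z <= q * r) by (unfold q; apply Req_le; field; lra).
  assert (Hex : ex_series (K := C_AbsRing) (V := C_CompleteNormedModule) (fun k => a k * z ^ k)%C).
  { apply (ex_series_le (K := C_AbsRing) (V := C_CompleteNormedModule) _ (fun k => K * q ^ k)).
    - intros k. change (Cmod (a k * z ^ k)%C <= K * q ^ k).
      apply coef_bound_term with r; assumption.
    - exists (K * / (1 - q)). apply (is_series_scal (K := R_AbsRing) (V := R_NormedModule) K).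
      apply is_series_geom. rewrite Rabs_pos_eq; lra. }
  destruct Hex as [l Hl]. exists l. apply is_series_Clim. exact Hl.
Qed.

Lemma Cpseries_coef_bound (a : nat -> C) (z l : C) :
  z <> 0%C -> Cpseries a z l -> exists K, coef_bound a K (Cmod z).
Proof.
  intros Hz Hl. assert (Hz0 : 0 < Cmod z) by (apply Cmod_gt_0, Hz).
  destruct (filterlim_bounded (K := R_AbsRing) (V := R_NormedModule)
    (fun n => Cmod (Cpsum a z n - l))) as [M HM].
  { exists 0. exact Hl. }
  assert (HM' : forall n, Cmod (Cpsum a z n - l) <= M).
  { intros n. eapply Rle_trans; [|apply HM]. apply Rle_abs. }
  exists (2 * M + Cmod l). intros k.
  assert (Ht : Cmod (a k * z ^ k)%C <= 2 * M + Cmod l).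
  { assert (HMk := HM' k). destruct k as [|k].
    - unfold Cpsum in HMk. rewrite Csum_O in HMk.
      replace (a O * z ^ 0)%C with (a O * z ^ 0 - l + l)%C by ring.
      eapply Rle_trans; [apply Cmod_triangle|]. assert (H := Cmod_ge_0 (a O * z ^ 0 - l)). lra.
    - assert (HMk' := HM' k). unfold Cpsum in HMk. rewrite Csum_S in HMk. fold (Cpsum a z k) in HMk.
      replace (a (S k) * z ^ S k)%C with ((Cpsum a z k + a (S k) * z ^ S k - l) - (Cpsum a z k - l))%C by ring.
      eapply Rle_trans; [apply Cmod_triangle|]. rewrite Cmod_opp. assert (H := Cmod_ge_0 l). lra. }
  rewrite Cmod_mult, Cmod_pow in Ht. assert (Hzk := pow_lt _ k Hz0).
  apply Rmult_le_reg_r with (Cmod z ^ k); [exact Hzk|].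
  replace ((2 * M + Cmod l) / Cmod z ^ k * Cmod z ^ k) with (2 * M + Cmod l) by (field; lra).
  exact Ht.
Qed.

(** If [a_n] were the first nonzero coefficient, the sum would be
    [a_n z^n + O(z^(n+1))], which has no small zeros except [0]. *)
Lemma Cpseries_zeros (a : nat -> C) (d : R) (f : C -> C) : 0 < d ->
  (forall z, Cmod z < d -> Cpseries a z (f z)) ->
  (forall eps, 0 < eps -> exists z, 0 < Cmod z < eps /\ f z = 0%C) ->
  forall n, a n = 0%C.
Proof.
  intros Hd Hf Hz.
  assert (Hd2 : Cmod (RtoC (d / 2)) = d / 2) by (rewrite Cmod_R, Rabs_pos_eq; lra).
  destruct (Cpseries_coef_bound a (RtoC (d / 2)) (f (RtoC (d / 2)))) as [K HK].
  { apply Cmod_gt_0. lra. }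
  { apply Hf. lra. }
  rewrite Hd2 in HK. assert (HK0 := coef_bound_ge_0 _ _ _ HK).
  intros n. induction n as [n IH] using (well_founded_induction Wf_nat.lt_wf).
  apply Cmod_eq_0. apply Rle_antisym; [|apply Cmod_ge_0].
  apply le_epsilon. intros eps Heps. rewrite Rplus_0_l.
  set (r := d / 2) in *.
  set (C0 := 2 * K / r ^ S n).
  assert (Hr : 0 < r) by (unfold r; lra).
  assert (HC0 : 0 <= C0).
  { unfold C0. apply Rdiv_le_0_compat; [lra|apply pow_lt; lra]. }
  destruct (Hz (Rmin (r / 2) (eps / (C0 + 1)))) as [z [[Hz0 Hz1] Hfz]].
  { apply Rmin_pos; [|apply Rdiv_lt_0_compat]; lra. }
  assert (Hz2 := Rlt_le_trans _ _ _ Hz1 (Rmin_l _ _)).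
  assert (Hz3 := Rlt_le_trans _ _ _ Hz1 (Rmin_r _ _)).
  set (q := Cmod z / r).
  assert (Hq : 0 <= q <= / 2).
  { unfold q. split; [apply Rdiv_le_0_compat; lra|]. apply Rle_div_l; lra. }
  assert (Hzq : Cmod z <= q * r) by (unfold q; apply Req_le; field; lra).
  assert (Hrem := Cpseries_remainder a K r q z (f z) n Hr ltac:(lra) HK Hzq
    ltac:(apply Hf; unfold r in *; lra)).
  assert (Hps : Cpsum a z n = (a n * z ^ n)%C).
  { unfold Cpsum. destruct n as [|n]; [apply Csum_O|]. rewrite Csum_S.
    rewrite (Csum_ext _ (fun _ => 0 * 0)%C).
    - rewrite Csum_mul. ring.
    - intros i Hi. rewrite IH by lia. ring. }
  rewrite Hps, Hfz in Hrem.
  replace (0 - a n * z ^ n)%C with (- (a n * z ^ n))%C in Hrem by ring.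
  rewrite Cmod_opp, Cmod_mult, Cmod_pow in Hrem.
  assert (Hzn := pow_lt _ n Hz0).
  assert (H1 : Cmod (a n) * Cmod z ^ n <= C0 * Cmod z * Cmod z ^ n).
  { eapply Rle_trans; [exact Hrem|].
    apply Rle_trans with (2 * K * q ^ S n).
    - assert (Hqp : 0 <= K * q ^ S n) by (apply Rmult_le_pos; [lra|apply pow_le; lra]).
      apply Rle_div_l; [lra|]. replace (2 * K * q ^ S n) with (2 * (K * q ^ S n)) by ring. nra.
    - unfold q, C0, Rdiv. rewrite Rpow_mult_distr, pow_inv. simpl pow. apply Req_le. field.
      assert (Hrn := pow_lt _ n Hr). lra. }
  apply Rmult_le_reg_r in H1; [|exact Hzn].
  eapply Rle_trans; [exact H1|].
  apply Rle_trans with ((C0 + 1) * (eps / (C0 + 1))); [nra|]. apply Req_le. field. lra.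
Qed.

(** The uniform estimate makes the tails of all the series small at once, and
    the finitely many other terms converge. *)
Lemma Cpseries_limit (W : nat -> nat -> C) (c : nat -> C) (K r : R) (z : C) (w : nat -> C) (g : C) :
  0 < r -> Cmod z < r ->
  (forall N, coef_bound (W N) K r) ->
  (forall j, Clim (fun N => W N j) (c j)) ->
  (forall N, Cpseries (W N) z (w N)) ->
  Clim w g -> Cpseries c z g.
Proof.
  intros Hr Hz HW Hc Hw Hg.
  assert (Hcb : coef_bound c K r).
  { intros k. replace (c k) with (c k - 0)%C by ring. apply (Clim_le _ _ _ _ 0 (Hc k)).
    intros N _. replace (W N k - 0)%C with (W N k) by ring. apply HW. }
  set (q := Cmod z / r).
  assert (Hq : 0 <= q < 1).
  { unfold q. split; [apply Rdiv_le_0_compat; [apply Cmod_ge_0|exact Hr]|].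
    apply Rlt_div_l; lra. }
  assert (Hzq : Cmod z <= q * r) by (unfold q; apply Req_le; field; lra).
  assert (Hps : forall n, Clim (fun N => Cpsum (W N) z n) (Cpsum c z n)).
  { intros n. unfold Cpsum. induction n as [|n IH].
    - apply Clim_ext with (fun N => z ^ 0 * W N O)%C; [intros; rewrite Csum_O; ring|].
      rewrite Csum_O. replace (c O * z ^ 0)%C with (z ^ 0 * c O)%C by ring. apply Clim_mul, Hc.
    - apply Clim_ext with (fun N => Csum (fun k => W N k * z ^ k) n + z ^ S n * W N (S n))%C;
        [intros; rewrite Csum_S; ring|].
      rewrite Csum_S. replace (c (S n) * z ^ S n)%C with (z ^ S n * c (S n))%C by ring.
      apply Clim_add; [exact IH|]. apply Clim_mul, Hc. }
  apply Clim_squeeze with (fun n => K / (1 - q) * q ^ S n).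
  - intros n. rewrite Cmod_minus_sym.
    assert (HL := Clim_sub _ _ _ _ Hg (Hps n)).
    replace (g - Cpsum c z n)%C with (g - Cpsum c z n - 0)%C by ring.
    apply (Clim_le _ _ _ _ 0 HL). intros N _.
    replace (w N - Cpsum (W N) z n - 0)%C with (w N - Cpsum (W N) z n)%C by ring.
    replace (K / (1 - q) * q ^ S n) with (K * q ^ S n / (1 - q)) by (field; lra).
    apply Cpseries_remainder with r; auto.
  - replace (Finite 0) with (Finite (K / (1 - q) * 0)) by (f_equal; ring).
    apply (is_lim_seq_scal_l _ _ 0). apply (is_lim_seq_incr_1 (fun n => q ^ n)).
    apply is_lim_seq_geom. rewrite Rabs_pos_eq; lra.
Qed.

Lemma Clim_coef_bound (W : nat -> nat -> C) (c : nat -> C) (K r : R) :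
  (forall N, coef_bound (W N) K r) -> (forall j, Clim (fun N => W N j) (c j)) ->
  coef_bound c K r.
Proof.
  intros HW Hc k. replace (c k) with (c k - 0)%C by ring. apply (Clim_le _ _ _ _ 0 (Hc k)).
  intros N _. replace (W N k - 0)%C with (W N k) by ring. apply HW.
Qed.

(** * Analytic functions *)

(** Coefficients of [(u + v z) a(z)]. *)
Definition affine_mul (u v : C) (a : nat -> C) (k : nat) : C :=
  match k with O => (u * a O)%C | S k' => (u * a (S k') + v * a k')%C end.

Lemma Cpsum_affine (u v : C) (a : nat -> C) (z : C) (n : nat) :
  Cpsum (affine_mul u v a) z n = ((u + v * z) * Cpsum a z n - v * z * (a n * z ^ n))%C.
Proof.
  unfold Cpsum. induction n as [|n IH].
  - rewrite !Csum_O. simpl. ring.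
  - rewrite !Csum_S, IH. simpl. ring.
Qed.

Lemma Cpseries_term_0 (a : nat -> C) (z l : C) :
  Cpseries a z l -> Clim (fun n => a n * z ^ n)%C 0%C.
Proof.
  intros H.
  assert (H1 : Clim (fun n => Cpsum a z (S n)) l).
  { apply (is_lim_seq_incr_1 (fun n => Cmod (Cpsum a z n - l))). exact H. }
  assert (H2 := Clim_sub _ _ _ _ H1 H). replace (l - l)%C with (RtoC 0) in H2 by ring.
  apply (is_lim_seq_incr_1 (fun n => Cmod (a n * z ^ n - 0)%C)). revert H2.
  apply Clim_ext. intros n. unfold Cpsum. rewrite Csum_S. ring.
Qed.

Lemma Cpseries_affine (u v : C) (a : nat -> C) (z l : C) :
  Cpseries a z l -> Cpseries (affine_mul u v a) z ((u + v * z) * l)%C.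
Proof.
  intros H.
  assert (H1 := Clim_sub _ _ _ _ (Clim_mul (u + v * z)%C _ _ H)
     (Clim_mul (v * z)%C _ _ (Cpseries_term_0 _ _ _ H))).
  replace ((u + v * z) * l)%C with ((u + v * z) * l - v * z * 0)%C by ring.
  revert H1. apply Clim_ext. intros n. rewrite Cpsum_affine. ring.
Qed.

Lemma Cpseries_sub (a b : nat -> C) (z l m : C) :
  Cpseries a z l -> Cpseries b z m -> Cpseries (fun k => a k - b k)%C z (l - m)%C.
Proof.
  intros H1 H2. assert (H := Clim_sub _ _ _ _ H1 H2). revert H. apply Clim_ext.
  intros n. unfold Cpsum. rewrite <- Csum_sub. apply Csum_ext. intros. ring.
Qed.

Lemma Cpseries_add (a b : nat -> C) (z l m : C) :
  Cpseries a z l -> Cpseries b z m -> Cpseries (fun k => a k + b k)%C z (l + m)%C.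
Proof.
  intros H1 H2. assert (H := Clim_add _ _ _ _ H1 H2). revert H. apply Clim_ext.
  intros n. unfold Cpsum. rewrite <- Csum_add. apply Csum_ext. intros. ring.
Qed.

Lemma Cpseries_mul (c : C) (a : nat -> C) (z l : C) :
  Cpseries a z l -> Cpseries (fun k => c * a k)%C z (c * l)%C.
Proof.
  intros H1. assert (H := Clim_mul c _ _ H1). revert H. apply Clim_ext.
  intros n. unfold Cpsum. rewrite <- Csum_mul. apply Csum_ext. intros. ring.
Qed.

Lemma Cpseries_Csum (a : nat -> nat -> C) (z : C) (l : nat -> C) (N : nat) :
  (forall i, (i <= N)%nat -> Cpseries (a i) z (l i)) ->
  Cpseries (fun k => Csum (fun i => a i k) N) z (Csum l N).
Proof.
  induction N as [|N IH]; intros H.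
  - rewrite Csum_O. assert (H0 := H O ltac:(lia)). revert H0. apply Clim_ext.
    intros n. apply Csum_ext. intros. rewrite Csum_O. reflexivity.
  - rewrite Csum_S. assert (H0 := Cpseries_add _ _ _ _ _ (IH ltac:(intros; apply H; lia)) (H (S N) ltac:(lia))).
    revert H0. apply Clim_ext. intros n. apply Csum_ext. intros. rewrite Csum_S. reflexivity.
Qed.

Definition one_coef (k : nat) : C := match k with O => RtoC 1 | S _ => RtoC 0 end.

Lemma Cpseries_one_coef (z : C) : Cpseries one_coef z 1%C.
Proof.
  assert (H := Clim_const 1%C). revert H. apply Clim_ext. intros n. unfold Cpsum.
  induction n as [|n IH].
  - rewrite Csum_O. simpl. ring.
  - rewrite Csum_S, <- IH. simpl. ring.
Qed.

Lemma coef_bound_affine (u v : C) (a : nat -> C) (K r : R) : 0 < r ->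
  coef_bound a K r -> coef_bound (affine_mul u v a) ((Cmod u + Cmod v * r) * K) r.
Proof.
  intros Hr H [|k]; simpl affine_mul.
  - assert (H0 := H O). simpl in *. rewrite Cmod_mult. unfold Rdiv in *. rewrite Rinv_1, Rmult_1_r in *.
    assert (0 <= Cmod v * r * K).
    { apply Rmult_le_pos; [apply Rmult_le_pos; [apply Cmod_ge_0|lra]|].
      exact (coef_bound_ge_0 _ _ _ H). }
    assert (Cmod u * Cmod (a O) <= Cmod u * K) by (apply Rmult_le_compat_l; [apply Cmod_ge_0|exact H0]).
    lra.
  - eapply Rle_trans; [apply Cmod_triangle|]. rewrite !Cmod_mult.
    replace ((Cmod u + Cmod v * r) * K / r ^ S k) with
      (Cmod u * (K / r ^ S k) + Cmod v * (K / r ^ k)).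
    + apply Rplus_le_compat; apply Rmult_le_compat_l; try apply Cmod_ge_0; apply H.
    + assert (Hk := pow_lt _ k Hr). simpl. field. lra.
Qed.

Lemma coef_bound_one_coef (r : R) : 0 < r -> coef_bound one_coef 1 r.
Proof.
  intros Hr [|k]; simpl one_coef.
  - rewrite Cmod_1. simpl. lra.
  - rewrite Cmod_0. apply Rdiv_le_0_compat; [lra|apply pow_lt, Hr].
Qed.

(** Coefficients of [(z0 + z)^n]; the recursion takes the place of the binomial
    theorem. *)
Fixpoint affine_pow (z0 : C) (n : nat) : nat -> C :=
  match n with O => one_coef | S n => affine_mul z0 1%C (affine_pow z0 n) end.

Lemma Cpseries_affine_pow (z0 h : C) (n : nat) : Cpseries (affine_pow z0 n) h ((z0 + h) ^ n)%C.
Proof.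
  induction n as [|n IH]; simpl; [apply Cpseries_one_coef|].
  replace (z0 + h)%C with (z0 + 1 * h)%C at 1 by ring. apply Cpseries_affine, IH.
Qed.

Lemma coef_bound_affine_pow (z0 : C) (r : R) (n : nat) : 0 < r ->
  coef_bound (affine_pow z0 n) ((Cmod z0 + r) ^ n) r.
Proof.
  intros Hr. induction n as [|n IH]; simpl; [apply coef_bound_one_coef, Hr|].
  replace (Cmod z0 + r) with (Cmod z0 + Cmod 1 * r) at 1 by (rewrite Cmod_1; ring).
  apply coef_bound_affine; assumption.
Qed.

Lemma geom_sum_le (q : R) (N : nat) : 0 <= q < 1 -> sum_n (fun n => q ^ n) N <= / (1 - q).
Proof.
  intros Hq. assert (E : (1 - q) * sum_n (fun n => q ^ n) N = 1 - q ^ (S N)).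
  { induction N as [|N IH].
    - rewrite sum_O. simpl. eq_R. ring.
    - rewrite sum_n_S, Rmult_plus_distr_l, IH. simpl. eq_R. ring. }
  apply Rmult_le_reg_l with (1 - q); [lra|]. rewrite E, Rinv_r by lra.
  assert (0 <= q ^ S N) by (apply pow_le; lra). lra.
Qed.

Lemma analytic_at_Cpseries (f : C -> C) (s0 : C) :
  analytic_at f s0 <-> exists (a : nat -> C) (d : R), 0 < d /\
    forall h, Cmod h < d -> Cpseries a h (f (s0 + h)%C).
Proof.
  split.
  - intros [a [d H]]. exists a, d. split; [apply cond_pos|]. intros h Hh.
    apply is_pseries_C. assert (E : (s0 + h - s0)%C = h) by ring.
    rewrite <- E at 1. apply H. rewrite E. exact Hh.
  - intros [a [d [Hd H]]]. exists a, (mkposreal d Hd). intros s Hs. apply is_pseries_C.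
    assert (E : (s0 + (s - s0))%C = s) by ring. rewrite <- E at 2. apply H. exact Hs.
Qed.

(** Re-expansion about [z0]: the partial sums of [c] are polynomials, so they
    have expansions in [h = z - z0], with coefficients estimated uniformly on a
    disk of radius [d] that stays inside the original one; [Cpseries_limit]
    then gives the expansion of the whole series. *)
Lemma analytic_at_of_Cpseries (c : nat -> C) (K r : R) (G : C -> C) (z0 : C) :
  coef_bound c K r -> (forall h, Cmod h < r -> Cpseries c h (G h)) ->
  Cmod z0 < r -> analytic_at G z0.
Proof.
  intros Hc HG Hz0. apply analytic_at_Cpseries.
  assert (H0 := Cmod_ge_0 z0).
  set (d := (r - Cmod z0) / 2). set (rho := Cmod z0 + d).
  assert (Hd : 0 < d) by (unfold d; lra). assert (Hrho : 0 < rho < r) by (unfold rho, d; lra).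
  set (q := rho / r). assert (Hq : 0 <= q < 1).
  { unfold q. split; [apply Rdiv_le_0_compat; lra|]. apply Rlt_div_l; lra. }
  assert (HK := coef_bound_ge_0 _ _ _ Hc).
  assert (Hterm : forall n k, Cmod (c n * affine_pow z0 n k)%C <= K * q ^ n / d ^ k).
  { intros n k. rewrite Cmod_mult.
    assert (Hrn : 0 < r ^ n) by (apply pow_lt; lra). assert (Hdk := pow_lt _ k Hd).
    apply Rle_trans with (K / r ^ n * (rho ^ n / d ^ k)).
    - apply Rmult_le_compat; try apply Cmod_ge_0; [apply Hc|].
      apply coef_bound_affine_pow, Hd.
    - apply Req_le. unfold q, Rdiv. rewrite Rpow_mult_distr, pow_inv. field. lra. }
  assert (Hex : forall k, exists b, Clim (Csum (fun n => c n * affine_pow z0 n k)%C) b).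
  { intros k. destruct (Cpseries_converges (fun n => c n * affine_pow z0 n k)%C (K / d ^ k) (/ q) 1%C) as [b Hb].
    - apply Rinv_0_lt_compat. unfold q. apply Rdiv_lt_0_compat; lra.
    - intros n. eapply Rle_trans; [apply Hterm|]. apply Req_le. rewrite pow_inv.
      assert (0 < q ^ n) by (apply pow_lt; unfold q; apply Rdiv_lt_0_compat; lra).
      assert (Hdk := pow_lt _ k Hd). field. lra.
    - rewrite Cmod_1. rewrite <- Rinv_1. apply Rinv_lt_contravar; [|lra].
      rewrite Rmult_1_r. unfold q; apply Rdiv_lt_0_compat; lra.
    - exists b. revert Hb. apply Clim_ext. intros N. apply Csum_ext. intros n _. rewrite Cpow_1_l. ring. }
  destruct (functional_choice _ Hex) as [b Hb].
  exists b, d. split; [exact Hd|]. intros h Hh.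
  apply (Cpseries_limit (fun N k => Csum (fun n => c n * affine_pow z0 n k)%C N) b
    (K * / (1 - q)) d h (fun N => Cpsum c (z0 + h) N)); auto.
  - intros N k. eapply Rle_trans; [apply Cmod_Csum|].
    apply Rle_trans with (sum_n (fun n => K / d ^ k * q ^ n) N).
    + apply sum_n_le. intros n _. eapply Rle_trans; [apply Hterm|]. apply Req_le. unfold Rdiv; ring.
    + rewrite sum_n_mul. assert (Hdk := pow_lt _ k Hd).
      replace (K * / (1 - q) / d ^ k) with (K / d ^ k * / (1 - q)) by (field; lra).
      apply Rmult_le_compat_l; [apply Rdiv_le_0_compat; lra|]. apply geom_sum_le, Hq.
  - intros N. apply Cpseries_Csum. intros n _. apply Cpseries_mul, Cpseries_affine_pow.
  - apply HG. eapply Rle_lt_trans; [apply Cmod_triangle|]. unfold d in Hh. lra.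
Qed.

Lemma analytic_at_sub (f g : C -> C) (s0 : C) :
  analytic_at f s0 -> analytic_at g s0 -> analytic_at (fun s => f s - g s)%C s0.
Proof.
  rewrite !analytic_at_Cpseries. intros [a [d [Hd Ha]]] [b [e [He Hb]]].
  exists (fun k => a k - b k)%C, (Rmin d e). split; [apply Rmin_pos; assumption|].
  intros h Hh. apply Cpseries_sub; [apply Ha|apply Hb].
  - apply (Rlt_le_trans _ _ _ Hh), Rmin_l.
  - apply (Rlt_le_trans _ _ _ Hh), Rmin_r.
Qed.

Lemma analytic_at_affine (u v : C) (f : C -> C) (s0 : C) :
  analytic_at f s0 -> analytic_at (fun s => (u + v * s) * f s)%C s0.
Proof.
  rewrite !analytic_at_Cpseries. intros [a [d [Hd Ha]]].
  exists (affine_mul (u + v * s0) v a), d. split; [exact Hd|].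
  intros h Hh. replace (u + v * (s0 + h))%C with (u + v * s0 + v * h)%C by ring.
  apply Cpseries_affine, Ha, Hh.
Qed.

Lemma analytic_at_translate (f : C -> C) (c s0 : C) :
  analytic_at f (s0 + c)%C -> analytic_at (fun s => f (s + c)%C) s0.
Proof.
  rewrite !analytic_at_Cpseries. intros [a [d [Hd Ha]]].
  exists a, d. split; [exact Hd|]. intros h Hh.
  replace (s0 + h + c)%C with (s0 + c + h)%C by ring. apply Ha, Hh.
Qed.

Definition locally_zero (f : C -> C) (s0 : C) : Prop :=
  exists d : R, 0 < d /\ forall s, Cmod (s - s0) < d -> f s = 0%C.

Lemma analytic_locally_zero (f : C -> C) (s0 : C) :
  analytic_at f s0 ->
  (forall eps, 0 < eps -> exists s, 0 < Cmod (s - s0) < eps /\ f s = 0%C) ->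
  locally_zero f s0.
Proof.
  rewrite analytic_at_Cpseries. intros [a [d [Hd Ha]]] Hz.
  assert (H0 := Cpseries_zeros a d (fun h => f (s0 + h)%C) Hd Ha).
  specialize (H0 ltac:(intros eps Heps; destruct (Hz eps Heps) as [s [Hs Hfs]];
    exists (s - s0)%C; split; [exact Hs|]; replace (s0 + (s - s0))%C with s by ring; exact Hfs)).
  exists d. split; [exact Hd|]. intros s Hs.
  assert (H1 := Ha _ Hs). replace (s0 + (s - s0))%C with s in H1 by ring.
  refine (Clim_unique _ _ _ H1 _). assert (H2 := Clim_const 0%C). revert H2. apply Clim_ext.
  intros n. unfold Cpsum. rewrite (Csum_ext _ (fun _ => 0 * 0)%C).
  - rewrite Csum_mul. ring.
  - intros i _. rewrite H0. ring.
Qed.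

(** The set of parameters up to which [f] vanishes near the segment has a
    supremum [x].  The zeros to the left of [x] accumulate at [x], so by
    analyticity [f] vanishes near [x] as well, and hence a little beyond [x]
    unless [x = 1]. *)
Lemma identity_on_segment (f : C -> C) (p v : C) : v <> 0%C ->
  (forall t, 0 <= t <= 1 -> analytic_at f (p + RtoC t * v)%C) ->
  locally_zero f p -> locally_zero f (p + v)%C.
Proof.
  intros Hv Han H0.
  assert (Hv0 : 0 < Cmod v) by (apply Cmod_gt_0, Hv).
  set (E := fun x => 0 <= x <= 1 /\ forall t, 0 <= t <= x -> locally_zero f (p + RtoC t * v)%C).
  assert (HE0 : E 0).
  { split; [lra|]. intros t Ht. replace t with 0 by lra.
    replace (p + 0 * v)%C with p by ring. exact H0. }
  destruct (completeness E) as [x [Hub Hlub]].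
  { exists 1. intros y [Hy _]. lra. }
  { exists 0. exact HE0. }
  assert (Hx0 : 0 <= x) by (apply Hub, HE0).
  assert (Hx1 : x <= 1) by (apply Hlub; intros y [Hy _]; lra).
  assert (Hdist : forall t u, Cmod ((p + RtoC t * v) - (p + RtoC u * v))%C = Rabs (t - u) * Cmod v).
  { intros t u. replace ((p + t * v) - (p + u * v))%C with (RtoC (t - u) * v)%C.
    - rewrite Cmod_mult, Cmod_R. reflexivity.
    - rewrite RtoC_minus. ring. }
  assert (Hbelow : forall t, 0 <= t < x -> locally_zero f (p + RtoC t * v)%C).
  { intros t Ht. destruct (classic (exists y, E y /\ t < y)) as [[y [[Hy1 Hy2] Hty]]|Hn].
    - apply Hy2. lra.
    - exfalso. assert (x <= t); [|lra]. apply Hlub. intros y Hy.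
      apply Rnot_lt_le. intros Hlt. apply Hn. exists y. auto. }
  assert (Hself : forall s, locally_zero f s -> f s = 0%C).
  { intros s [d [Hd Hf]]. apply Hf. replace (s - s)%C with (RtoC 0) by ring. rewrite Cmod_0. exact Hd. }
  assert (Hatx : locally_zero f (p + RtoC x * v)%C).
  { destruct (Req_dec x 0) as [->|Hxne].
    - apply (proj2 HE0). lra.
    - apply analytic_locally_zero; [apply Han; lra|]. intros eps Heps.
      set (t := Rmax (x / 2) (x - eps / (2 * Cmod v))).
      assert (Hev : 0 < eps / (2 * Cmod v)) by (apply Rdiv_lt_0_compat; lra).
      assert (Ht1 : x / 2 <= t) by apply Rmax_l.
      assert (Ht2 : x - eps / (2 * Cmod v) <= t) by apply Rmax_r.
      assert (Ht3 : t < x) by (apply Rmax_lub_lt; lra).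
      exists (p + RtoC t * v)%C. split.
      + rewrite Hdist. rewrite Rabs_left by lra. split.
        * apply Rmult_lt_0_compat; lra.
        * apply Rle_lt_trans with (eps / (2 * Cmod v) * Cmod v).
          -- apply Rmult_le_compat_r; lra.
          -- replace (eps / (2 * Cmod v) * Cmod v) with (eps / 2) by (field; lra). lra.
      + apply Hself, Hbelow. lra. }
  destruct (Req_dec x 1) as [->|Hxne].
  { replace (p + v)%C with (p + 1 * v)%C by ring. exact Hatx. }
  exfalso. destruct Hatx as [d [Hd Hf]].
  set (e := Rmin (1 - x) (d / (2 * Cmod v))).
  assert (He0 : 0 < e) by (apply Rmin_pos; [lra|apply Rdiv_lt_0_compat; lra]).
  assert (He1 : e <= 1 - x) by apply Rmin_l.
  assert (He2 : e <= d / (2 * Cmod v)) by apply Rmin_r.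
  assert (He3 : e * Cmod v <= d / 2).
  { apply Rle_trans with (d / (2 * Cmod v) * Cmod v); [apply Rmult_le_compat_r; lra|].
    apply Req_le. field. lra. }
  assert (HEe : E (x + e)).
  { split; [lra|]. intros t Ht. destruct (Rlt_le_dec t x) as [Hlt|Hge]; [apply Hbelow; lra|].
    exists (d / 2). split; [lra|]. intros s Hs. apply Hf.
    eapply Rle_lt_trans; [apply (Cmod_triangle_minus s (p + RtoC t * v))|].
    rewrite Hdist, Rabs_pos_eq by lra.
    assert ((t - x) * Cmod v <= e * Cmod v) by (apply Rmult_le_compat_r; lra). lra. }
  assert (Hle := Hub _ HEe). lra.
Qed.

Lemma C_derive_of_Cpseries (f : C -> C) (s0 : C) (a : nat -> C) (d : R) : 0 < d ->
  (forall h, Cmod h < d -> Cpseries a h (f (s0 + h)%C)) ->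
  f s0 = a O /\ C_derive f s0 = a 1%nat.
Proof.
  intros Hd Ha.
  assert (Hd2 : Cmod (RtoC (d / 2)) = d / 2) by (rewrite Cmod_R, Rabs_pos_eq; lra).
  destruct (Cpseries_coef_bound a (RtoC (d / 2)) (f (s0 + RtoC (d / 2))%C)) as [K HK].
  { apply Cmod_gt_0. lra. }
  { apply Ha. lra. }
  rewrite Hd2 in HK. assert (HK0 := coef_bound_ge_0 _ _ _ HK).
  set (r := d / 2) in *. assert (Hr : 0 < r) by (unfold r; lra).
  assert (H0 : f s0 = a O).
  { assert (H1 := Ha 0%C ltac:(rewrite Cmod_0; exact Hd)).
    replace (s0 + 0)%C with s0 in H1 by ring.
    refine (Clim_unique _ _ _ H1 _). assert (H2 := Clim_const (a O)). revert H2. apply Clim_ext.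
    intros n. unfold Cpsum. induction n as [|n IH].
    - rewrite Csum_O. simpl. ring.
    - rewrite Csum_S, <- IH. simpl. ring. }
  split; [exact H0|].
  assert (Hrem : forall h, Cmod h < r / 2 ->
    Cmod (f (s0 + h) - f s0 - a 1%nat * h)%C <= 2 * K / r ^ 2 * Cmod h ^ 2).
  { intros h Hh. set (q := Cmod h / r).
    assert (Hh0 := Cmod_ge_0 h).
    assert (Hq : 0 <= q <= / 2).
    { unfold q. split; [apply Rdiv_le_0_compat; lra|]. apply Rle_div_l; lra. }
    assert (Hzq : Cmod h <= q * r) by (unfold q; apply Req_le; field; lra).
    assert (H := Cpseries_remainder a K r q h (f (s0 + h)%C) 1 Hr ltac:(lra) HK Hzq
      ltac:(apply Ha; unfold r in *; lra)).
    unfold Cpsum in H. rewrite Csum_S, Csum_O in H.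
    replace (f (s0 + h) - f s0 - a 1%nat * h)%C with
      (f (s0 + h) - (a 0%nat * h ^ 0 + a 1%nat * h ^ 1))%C by (rewrite H0; simpl; ring).
    eapply Rle_trans; [exact H|].
    apply Rle_trans with (2 * K * q ^ 2).
    - assert (Hqp : 0 <= K * q ^ 2) by (apply Rmult_le_pos; [lra|apply pow_le; lra]).
      apply Rle_div_l; [lra|]. replace (2 * K * q ^ 2) with (2 * (K * q ^ 2)) by ring. nra.
    - apply Req_le. unfold q. field. lra. }
  apply is_C_derive_unique. split.
  { apply (is_linear_scal_l (K := C_AbsRing) (V := C_NormedModule)). }
  intros x Hx.
  assert (Ex : x = s0).
  { symmetry. apply (is_filter_lim_locally_unique (K := C_AbsRing) (V := AbsRing_NormedModule C_AbsRing)).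
    exact Hx. }
  subst x. intros eps. 
  set (C0 := 2 * K / r ^ 2). assert (HC0 : 0 <= C0).
  { unfold C0. apply Rdiv_le_0_compat; [lra|apply pow_lt, Hr]. }
  assert (He : 0 < Rmin (r / 2) (eps / (C0 + 1))).
  { apply Rmin_pos; [lra|apply Rdiv_lt_0_compat; [apply cond_pos|lra]]. }
  exists (mkposreal _ He).
  cut (forall y : C, Cmod (y - s0)%C < Rmin (r / 2) (eps / (C0 + 1)) ->
    Cmod ((f y - f s0) - (y - s0) * a 1%nat)%C <= eps * Cmod (y - s0)%C).
  { intros H y Hy. exact (H y Hy). }
  intros y Hy.
  assert (Hy1 := Rlt_le_trans _ _ _ Hy (Rmin_l _ _)).
  assert (Hy2 := Rlt_le_trans _ _ _ Hy (Rmin_r _ _)).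
  assert (H := Hrem _ Hy1). replace (s0 + (y - s0))%C with y in H by ring.
  replace (f y - f s0 - (y - s0) * a 1%nat)%C with (f y - f s0 - a 1%nat * (y - s0))%C by ring.
  eapply Rle_trans; [exact H|]. fold C0. set (m := Cmod (y - s0)) in *.
  assert (Hm : 0 <= m) by apply Cmod_ge_0. simpl pow. rewrite Rmult_1_r, <- Rmult_assoc.
  apply Rmult_le_compat_r; [exact Hm|].
  apply Rle_trans with ((C0 + 1) * (eps / (C0 + 1))); [nra|]. apply Req_le. field. lra.
Qed.

(** * The complex exponential *)

Lemma is_lim_pow_fact (x : R) : is_lim_seq (fun n => x ^ n / INR (fact n)) 0.
Proof.
  apply is_lim_seq_ext with (fun n => / INR (fact n) * x ^ n); [intros; unfold Rdiv; ring|].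
  apply ex_series_lim_0. exists (exp x). apply is_pseries_R, is_exp_Reals.
Qed.

(** The real parts of the successive derivatives in [t] of [u e^(tz)]; the
    choices [u = 1] and [u = -i] give real and imaginary parts of [e^(tz)]. *)
Definition cexp_re (u z : C) (m : nat) (t : R) : R :=
  Re (u * z ^ m * Cexp (RtoC t * z))%C.

Lemma is_derive_cexp_re (u z : C) (m : nat) (t : R) :
  is_derive (cexp_re u z m) t (cexp_re u z (S m) t).
Proof.
  set (w := (u * z ^ m)%C).
  apply is_derive_ext with (fun t => exp (t * Re z) * (Re w * cos (t * Im z) - Im w * sin (t * Im z))).
  { intros x. unfold cexp_re. fold w. unfold Cexp, Cmult, RtoC, Re, Im; simpl.
    replace (x * fst z - 0 * snd z) with (x * fst z) by ring.
    replace (x * snd z + 0 * fst z) with (x * snd z) by ring. eq_R. ring. }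
  replace (cexp_re u z (S m) t) with (exp (t * Re z) *
     (Re (w * z) * cos (t * Im z) - Im (w * z) * sin (t * Im z))).
  - unfold Cmult, Re, Im; simpl. auto_derive; [trivial|]. ring.
  - unfold cexp_re. replace (u * z ^ S m)%C with (w * z)%C by (unfold w; simpl; ring).
    generalize (w * z)%C. intros y. unfold Cexp, Cmult, RtoC, Re, Im; simpl.
    replace (t * fst z - 0 * snd z) with (t * fst z) by ring.
    replace (t * snd z + 0 * fst z) with (t * snd z) by ring. ring.
Qed.

Lemma Cmod_Cexp (z : C) : Cmod (Cexp z) = exp (Re z).
Proof.
  unfold Cmod, Cexp; simpl.
  replace (exp (Re z) * cos (Im z) * (exp (Re z) * cos (Im z) * 1) +
   exp (Re z) * sin (Im z) * (exp (Re z) * sin (Im z) * 1)) with (exp (Re z) * exp (Re z)).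
  - apply sqrt_square. left. apply exp_pos.
  - assert (E := sin2_cos2 (Im z)). unfold Rsqr in E.
    transitivity (exp (Re z) * exp (Re z) * (sin (Im z) * sin (Im z) + cos (Im z) * cos (Im z))); [|ring].
    rewrite E. ring.
Qed.

Lemma Re_Csum (a : nat -> C) (n : nat) : Re (Csum a n) = sum_n (fun i => Re (a i)) n.
Proof.
  induction n as [|n IH].
  - rewrite Csum_O, sum_O. reflexivity.
  - rewrite Csum_S, sum_n_S, <- IH. reflexivity.
Qed.

Definition exp_coef (k : nat) : C := RtoC (/ INR (fact k)).

Lemma RtoC_m1 : RtoC (-1) = (- (1))%C.
Proof. unfold RtoC, Copp; simpl. f_equal; ring. Qed.

(** Taylor's inequality between [t = -1] and [t = 0] for [u e^(-tz)], since
    [taylor_bound] expands at the right end point. *)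
Lemma cexp_taylor (u z : C) (n : nat) :
  Rabs (Re (u * (Cexp z - Cpsum exp_coef z n))%C) <=
  Cmod u * exp (Cmod z) * (Cmod z ^ S n / INR (fact (S n))).
Proof.
  assert (H := taylor_bound (cexp_re u (- z)) (-1) 0 (Cmod u * Cmod z ^ S n * exp (Cmod z)) n
    (fun m t _ => is_derive_cexp_re u (- z) m t)).
  specialize (H ltac:(intros t Ht; unfold cexp_re;
    eapply Rle_trans; [apply re_le_Cmod|];
    rewrite !Cmod_mult, Cmod_pow, Cmod_opp, Cmod_Cexp;
    apply Rmult_le_compat_l; [apply Rmult_le_pos; [|apply pow_le]; apply Cmod_ge_0|];
    assert (Hz := re_le_Cmod z); apply Rabs_le_between in Hz;
    assert (Hle : Re (RtoC t * - z) <= Cmod z);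
     [unfold Cmult, Copp, RtoC, Re in *; simpl in *; nra|];
    destruct Hle as [Hlt|Heq]; [left; apply exp_increasing, Hlt|rewrite Heq; lra])).
  specialize (H (-1) ltac:(lra)).
  replace (0 - -1) with 1 in H by ring. rewrite pow1 in H.
  replace (cexp_re u (- z) 0 (-1)) with (Re (u * Cexp z)%C) in H.
  2:{ unfold cexp_re. f_equal. replace (RtoC (-1) * - z)%C with z; [simpl; ring|].
      rewrite RtoC_m1. ring. }
  replace (sum_n _ n) with (Re (u * Cpsum exp_coef z n)%C) in H.
  - replace (Re (u * (Cexp z - Cpsum exp_coef z n))%C) with
      (Re (u * Cexp z) - Re (u * Cpsum exp_coef z n)).
    + refine (Rle_trans _ _ _ H (Req_le _ _ _)). unfold Rdiv. ring.
    + unfold Re, Cmult, Cminus, Cplus, Copp; simpl. ring.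
  - unfold Cpsum. rewrite <- Csum_mul, Re_Csum. apply sum_n_ext_R. intros i _.
    unfold cexp_re, exp_coef. replace (-1 - 0) with (-1) by ring.
    replace (Cexp (0 * - z)) with (RtoC 1).
    2:{ unfold Cexp, RtoC, Cmult, Re, Im; simpl.
        replace (0 * - fst z - 0 * - snd z) with 0 by ring.
        replace (0 * - snd z + 0 * - fst z) with 0 by ring.
        rewrite exp_0, cos_0, sin_0. f_equal; ring. }
    replace (u * (- z) ^ i * 1)%C with (RtoC ((-1) ^ i) * (u * z ^ i))%C.
    2:{ rewrite RtoC_pow. replace (- z)%C with (RtoC (-1) * z)%C; [rewrite Cpow_mult_l; ring|].
        rewrite RtoC_m1. ring. }
    replace (u * (RtoC (/ INR (fact i)) * z ^ i))%C with (RtoC (/ INR (fact i)) * (u * z ^ i))%C by ring.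
    generalize (u * z ^ i)%C. intros y. unfold Re, Cmult, RtoC; simpl.
    assert (E : (-1) ^ i * (-1) ^ i = 1).
    { rewrite <- Rpow_mult_distr. replace (-1 * -1) with 1 by ring. apply pow1. }
    transitivity (((-1) ^ i * (-1) ^ i) * (fst y * / INR (fact i))); [rewrite E; ring|].
    unfold Rdiv. ring.
Qed.

Lemma Cpseries_exp (z : C) : Cpseries exp_coef z (Cexp z).
Proof.
  apply Clim_squeeze with (fun n => 2 * exp (Cmod z) * (Cmod z ^ S n / INR (fact (S n)))).
  - intros n. rewrite Cmod_minus_sym.
    assert (H1 := cexp_taylor 1 z n). assert (H2 := cexp_taylor (- Ci) z n).
    rewrite Cmod_opp, Cmod_Ci in H2. rewrite Cmod_1 in H1.
    set (y := (Cexp z - Cpsum exp_coef z n)%C) in *.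
    replace (Re (1 * y)) with (Re y) in H1 by (unfold Re, Cmult, RtoC; simpl; ring).
    replace (Re (- Ci * y)) with (Im y) in H2 by (unfold Re, Im, Cmult, Copp, Ci; simpl; ring).
    apply Rle_trans with (Rabs (Re y) + Rabs (Im y)); [|lra].
    unfold Cmod. fold (Re y). fold (Im y).
    rewrite <- (sqrt_square (Rabs (Re y) + Rabs (Im y))).
    + apply sqrt_le_1_alt. rewrite <- (pow2_abs (Re y)), <- (pow2_abs (Im y)).
      assert (0 <= Rabs (Re y)) by apply Rabs_pos. assert (0 <= Rabs (Im y)) by apply Rabs_pos. nra.
    + assert (0 <= Rabs (Re y)) by apply Rabs_pos. assert (0 <= Rabs (Im y)) by apply Rabs_pos. lra.
  - replace (Finite 0) with (Finite (2 * exp (Cmod z) * 0)) by (f_equal; ring).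
    apply (is_lim_seq_scal_l _ _ 0). apply (is_lim_seq_incr_1 (fun n => Cmod z ^ n / INR (fact n))).
    apply is_lim_pow_fact.
Qed.

(** * Expansion of the zeta function about [-r] *)

Definition shift_coef (a : nat -> R) (j : nat) : R := match j with O => 0 | S j => a j end.

(** The coefficient of [h^j] in [(x-h) (x-1-h) ... (x-m+1-h) t^(-h)]. *)
Fixpoint power_coef (x : R) (m : nat) (t : R) (j : nat) : R :=
  match m with
  | O => (- ln t) ^ j / INR (fact j)
  | S m => (x - INR m) * power_coef x m t j - shift_coef (power_coef x m t) j
  end.

(** The coefficient of [h^j] in the [m]-th derivative of [t^(x-h)] with respect
    to [t]. *)
Definition power_derivs (x : R) (j m : nat) (t : R) : R := Rpower t (x - INR m) * power_coef x m t j.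

Lemma is_derive_power_coef (x : R) (m j : nat) (t : R) : 0 < t ->
  is_derive (fun t => power_coef x m t j) t (- / t * shift_coef (power_coef x m t) j).
Proof.
  intros Ht. revert j. induction m as [|m IH]; intros j.
  - destruct j as [|j].
    + apply is_derive_ext with (fun _ => 1 / 1); [reflexivity|].
      replace (- / t * shift_coef (power_coef x 0 t) 0) with 0 by (simpl; ring). apply is_derive_const_R.
    + simpl shift_coef. unfold power_coef. assert (Hf := INR_fact_neq_0 j). assert (HS := INR_S_pos j).
      rewrite INR_fact_S. auto_derive; [exact Ht|].
      change (match j with O => 1 | S _ => INR j + 1 end) with (INR (S j)). field. lra.
  - assert (Hs : is_derive (fun t => shift_coef (power_coef x m t) j) t (- / t * shift_coef (shift_coef (power_coef x m t)) j)).
    { destruct j as [|j].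
      - simpl. rewrite Rmult_0_r. apply is_derive_const_R.
      - apply IH. }
    replace (- / t * shift_coef (power_coef x (S m) t) j) with
      ((x - INR m) * (- / t * shift_coef (power_coef x m t) j) - - / t * shift_coef (shift_coef (power_coef x m t)) j).
    + apply (is_derive_minus (fun t => (x - INR m) * power_coef x m t j)); [|exact Hs].
      apply (is_derive_scal (fun t => power_coef x m t j)). apply IH.
    + destruct j as [|j]; simpl; ring.
Qed.

Lemma is_derive_power_derivs (x : R) (j m : nat) (t : R) : 0 < t ->
  is_derive (power_derivs x j m) t (power_derivs x j (S m) t).
Proof.
  intros Ht. unfold power_derivs.
  assert (Hp : is_derive (fun t => Rpower t (x - INR m)) t ((x - INR m) * Rpower t (x - INR m - 1))).
  { unfold Rpower. auto_derive; [exact Ht|].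
    replace ((x - INR m - 1) * ln t) with ((x - INR m) * ln t + - ln t) by ring.
    rewrite exp_plus, exp_Ropp, exp_ln by exact Ht. replace (x + - INR m) with (x - INR m) by ring. ring. }
  replace (Rpower t (x - INR (S m)) * power_coef x (S m) t j) with
    ((x - INR m) * Rpower t (x - INR m - 1) * power_coef x m t j +
     Rpower t (x - INR m) * (- / t * shift_coef (power_coef x m t) j)).
  - apply (is_derive_mult (K := R_AbsRing) (fun t => Rpower t (x - INR m)) (fun t => power_coef x m t j)).
    + exact Hp.
    + apply is_derive_power_coef, Ht.
    + intros; apply Rmult_comm.
  - rewrite S_INR. replace (x - (INR m + 1)) with (x - INR m - 1) by ring.
    replace (Rpower t (x - INR m)) with (Rpower t (x - INR m - 1) * t).
    + simpl. field. lra.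
    + rewrite <- (Rpower_1 t) at 2 by exact Ht. rewrite <- Rpower_plus. f_equal. ring.
Qed.

Fixpoint power_coef_K (x R0 : R) (m : nat) : R :=
  match m with O => 1 | S m => (Rabs (x - INR m) + R0) * power_coef_K x R0 m end.

Lemma pow_fact_le_exp (x : R) (j : nat) : 0 <= x -> x ^ j / INR (fact j) <= exp x.
Proof.
  intros Hx.
  assert (Hs := proj1 (is_pseries_R _ _ _) (is_exp_Reals x)).
  assert (Hpos : forall n, 0 <= / INR (fact n) * x ^ n).
  { intros n. apply Rmult_le_pos; [left; apply Rinv_0_lt_compat, INR_fact_lt_0|apply pow_le, Hx]. }
  assert (Hle : forall n, (j <= n)%nat -> x ^ j / INR (fact j) <= sum_n (fun n => / INR (fact n) * x ^ n) n).
  { intros n. induction n as [|n IH]; intros Hn.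
    - replace j with O by lia. rewrite sum_O. simpl. lra.
    - rewrite sum_n_S. destruct (Nat.eq_dec j (S n)) as [->|Hne].
      + assert (0 <= sum_n (fun n => / INR (fact n) * x ^ n) n).
        { rewrite <- (Rmult_0_l (sum_n (fun _ => 0) n)), <- sum_n_mul. apply sum_n_le.
          intros. rewrite Rmult_0_l. apply Hpos. }
        unfold Rdiv. lra.
      + assert (H1 := IH ltac:(lia)). assert (H2 := Hpos (S n)). lra. }
  change (is_lim_seq (sum_n (fun n => / INR (fact n) * x ^ n)) (exp x)) in Hs.
  refine (is_lim_seq_le_loc (fun _ => _) _ _ _ _ (is_lim_seq_const _) Hs).
  exists j. apply Hle.
Qed.

(** Cauchy's estimate for [t^(-h)] on [|h| = R0] is [t^R0], and each factor
    [x - i - h] is at most [|x - i| + R0] there. *)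
Lemma power_coef_bound (x R0 : R) (m j : nat) (t : R) : 0 < R0 -> 1 <= t ->
  Rabs (power_coef x m t j) <= power_coef_K x R0 m * Rpower t R0 / R0 ^ j.
Proof.
  intros HR Ht. revert j.
  assert (Hl : 0 <= ln t). { rewrite <- ln_1. apply ln_le; lra. }
  induction m as [|m IH]; intros j; simpl power_coef; simpl power_coef_K.
  - unfold Rdiv. rewrite Rabs_mult, <- RPow_abs, Rabs_Ropp, (Rabs_pos_eq (ln t)) by exact Hl.
    rewrite (Rabs_pos_eq (/ _)) by (left; apply Rinv_0_lt_compat, INR_fact_lt_0).
    assert (HRj := pow_lt _ j HR). rewrite Rmult_1_l. fold (Rdiv (Rpower t R0) (R0 ^ j)).
    apply (Rle_div_r _ _ (R0 ^ j)); [exact HRj|].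
    replace (ln t ^ j * / INR (fact j) * R0 ^ j) with ((R0 * ln t) ^ j / INR (fact j))
      by (rewrite Rpow_mult_distr; unfold Rdiv; ring).
    unfold Rpower. apply pow_fact_le_exp. apply Rmult_le_pos; lra.
  - assert (Hs : Rabs (shift_coef (power_coef x m t) j) <= R0 * (power_coef_K x R0 m * Rpower t R0 / R0 ^ j)).
    { destruct j as [|j]; simpl shift_coef.
      - rewrite Rabs_R0. apply Rmult_le_pos; [lra|]. eapply Rle_trans; [apply Rabs_pos|apply (IH O)].
      - refine (Rle_trans _ _ _ (IH j) (Req_le _ _ _)). simpl. field.
        assert (HRj := pow_lt _ j HR). lra. }
    eapply Rle_trans; [apply Rabs_triang|]. rewrite Rabs_Ropp, Rabs_mult.
    replace ((Rabs (x - INR m) + R0) * power_coef_K x R0 m * Rpower t R0 / R0 ^ j) with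
      (Rabs (x - INR m) * (power_coef_K x R0 m * Rpower t R0 / R0 ^ j) +
       R0 * (power_coef_K x R0 m * Rpower t R0 / R0 ^ j)) by (unfold Rdiv; ring).
    apply Rplus_le_compat; [|exact Hs]. apply Rmult_le_compat_l; [apply Rabs_pos|apply IH].
Qed.

Fixpoint Cfalling_fact (x : R) (m : nat) (h : C) : C :=
  match m with O => RtoC 1 | S m => ((RtoC (x - INR m) - h) * Cfalling_fact x m h)%C end.

Lemma Cpseries_power_coef (x : R) (m : nat) (t : R) (h : C) :
  Cpseries (fun j => RtoC (power_coef x m t j)) h (Cfalling_fact x m h * Cexp (- (h * RtoC (ln t))))%C.
Proof.
  induction m as [|m IH]; simpl Cfalling_fact.
  - assert (H := Cpseries_exp (- (h * RtoC (ln t)))).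
    replace (1 * Cexp (- (h * RtoC (ln t))))%C with (Cexp (- (h * RtoC (ln t)))) by ring.
    revert H. apply Clim_ext. intros n. apply Csum_ext. intros j _. unfold exp_coef. simpl power_coef.
    unfold Rdiv. rewrite RtoC_mult, RtoC_pow, RtoC_opp.
    replace (- (h * RtoC (ln t)))%C with (- RtoC (ln t) * h)%C by ring.
    rewrite Cpow_mult_l. ring.
  - assert (H := Cpseries_affine (RtoC (x - INR m)) (- (1)) _ _ _ IH).
    replace ((RtoC (x - INR m) - h) * Cfalling_fact x m h * Cexp (- (h * ln t)))%C with
      ((RtoC (x - INR m) + - (1) * h) * (Cfalling_fact x m h * Cexp (- (h * ln t))))%C by ring.
    revert H. apply Clim_ext. intros n. apply Csum_ext. intros j _. f_equal.
    destruct j as [|j]; simpl affine_mul; simpl power_coef.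
    + rewrite (RtoC_minus (_ * _)), RtoC_mult. simpl shift_coef. ring.
    + rewrite (RtoC_minus (_ * _)), RtoC_mult. ring.
Qed.

Lemma Cexp_RtoC_plus (a : R) (z : C) : Cexp (RtoC a + z)%C = (RtoC (exp a) * Cexp z)%C.
Proof.
  unfold Cexp, RtoC, Cplus, Cmult, Re, Im; simpl. rewrite exp_plus, Rplus_0_l.
  f_equal; ring.
Qed.

Lemma Rpower_nonpos_le_1 (t y : R) : 1 <= t -> y <= 0 -> Rpower t y <= 1.
Proof.
  intros Ht Hy. unfold Rpower. rewrite <- exp_0.
  assert (Hl : 0 <= ln t). { rewrite <- ln_1. apply ln_le; lra. }
  assert (Hle : y * ln t <= 0) by nra.
  destruct Hle as [Hlt|Heq]; [left; apply exp_increasing, Hlt|rewrite Heq; lra].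
Qed.

Lemma is_lim_Rpower_neg (y : R) : y < 0 -> is_lim_seq (fun n => Rpower (INR (S n)) y) 0.
Proof.
  intros Hy. apply is_lim_seq_spec. intros eps.
  destruct (archimed_cor1 (Rpower eps (- / y))) as [N [HN HN0]]; [apply exp_pos|].
  exists N. intros n Hn. assert (HNp : 0 < INR N) by (apply lt_0_INR; lia).
  rewrite Rminus_0_r, Rabs_pos_eq by (left; apply exp_pos).
  assert (HnN : INR N <= INR (S n)) by (apply le_INR; lia).
  assert (Hi : / INR (S n) < Rpower eps (- / y)).
  { apply Rle_lt_trans with (/ INR N); [apply Rinv_le_contravar; lra|exact HN]. }
  assert (Hl : - ln (INR (S n)) < - / y * ln eps).
  { rewrite <- ln_Rinv by apply INR_S_pos. unfold Rpower in Hi.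
    rewrite <- (ln_exp (- / y * ln eps)). apply ln_increasing; [apply Rinv_0_lt_compat, INR_S_pos|exact Hi]. }
  unfold Rpower. rewrite <- (exp_ln eps) by apply cond_pos. apply exp_increasing.
  replace (y * ln (INR (S n))) with (- y * - ln (INR (S n))) by ring.
  replace (ln eps) with (- y * (- / y * ln eps)) by (field; lra).
  apply Rmult_lt_compat_l; lra.
Qed.

Section Zeta.
Variables (zeta : C -> C) (B : nat -> R).
Hypotheses (Hzeta : is_riemann_zeta zeta) (HB : is_bernoulli B).
Variable r : nat.

(* The exponent of [t^(1-s)] at [s = -r]. *)
Let x : R := INR (S r).
(* The disk about [-r] of this radius contains the point [2 + i], which lies in
   the half plane of convergence, and a neighbourhood of it. *)
Let rad : R := INR (r + 4).
(* The number of Bernoulli terms makes the exponent [x - (M + 1) + rad] equal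
   to [-2]. *)
Let M : nat := (2 * r + 6)%nat.

(** The coefficient of [h^j] in [(1-s) sum_(nu<=n+1) nu^(-s) - T_(n+1)(s)], where
    [s = h - r]. *)
Definition zeta_em (n j : nat) : R := em_diff B (power_derivs x j) M n.

Lemma rad_pos : 0 < rad.
Proof. apply lt_0_INR. lia. Qed.

Lemma power_derivs_last (j : nat) (t : R) : 1 <= t ->
  Rabs (power_derivs x j (S M) t) <= power_coef_K x rad (S M) / rad ^ j / t ^ (0 + 2).
Proof.
  intros Ht. unfold power_derivs. rewrite Rabs_mult.
  rewrite (Rabs_pos_eq (Rpower _ _)) by (left; apply exp_pos).
  assert (H := power_coef_bound x rad (S M) j t rad_pos Ht).
  apply Rle_trans with (Rpower t (x - INR (S M)) * (power_coef_K x rad (S M) * Rpower t rad / rad ^ j)).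
  - apply Rmult_le_compat_l; [left; apply exp_pos|exact H].
  - assert (E : Rpower t (x - INR (S M)) * Rpower t rad = / t ^ (0 + 2)).
    { rewrite <- Rpower_plus. simpl (0 + 2)%nat. rewrite <- (Rpower_pow 2) by lra.
      rewrite <- Rpower_Ropp. f_equal. unfold x, rad, M. rewrite !S_INR, !plus_INR, mult_INR. simpl. ring. }
    apply Req_le. unfold Rdiv. rewrite <- E. ring.
Qed.

Lemma power_derivs_at_1 (j m : nat) : Rabs (power_derivs x j m 1) <= power_coef_K x rad m / rad ^ j.
Proof.
  unfold power_derivs. assert (H := power_coef_bound x rad m j 1 rad_pos ltac:(lra)).
  unfold Rpower in *. rewrite ln_1, !Rmult_0_r, exp_0, Rmult_1_r in *. rewrite Rmult_1_l. exact H.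
Qed.

Definition zeta_em_K : R :=
  power_coef_K x rad 1 + sum_n (fun m => Rabs (em_coef B m) * power_coef_K x rad m) M
  + 4 * (power_coef_K x rad (S M) * em_const B M).

(** The error in [em_converges] carries the factor [rad^(-j)], and so does the
    first term of the sequence, whence the estimate uniform in [n]. *)
Lemma zeta_em_converges : exists c : nat -> R,
  (forall j, is_lim_seq (fun n => zeta_em n j) (c j)) /\
  (forall n j, Rabs (zeta_em n j) <= zeta_em_K / rad ^ j).
Proof.
  assert (H : forall j, exists l : R, is_lim_seq (fun n => zeta_em n j) l /\
    forall n, Rabs (zeta_em n j - l) <= 2 * (power_coef_K x rad (S M) / rad ^ j * em_const B M)).
  { intros j. destruct (em_converges B HB (power_derivs x j) M 0 (power_coef_K x rad (S M) / rad ^ j)) as [l [Hl Hb]].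
    - unfold M; lia.
    - intros m t Ht. apply is_derive_power_derivs. lra.
    - intros t Ht. apply power_derivs_last, Ht.
    - exists l. split; [exact Hl|]. intros n. refine (Rle_trans _ _ _ (Hb n) (Req_le _ _ _)).
      simpl. field. apply pow_nonzero. assert (H := rad_pos). lra. }
  destruct (functional_choice _ H) as [c Hc]. exists c. split; [intros j; apply Hc|].
  intros n j. destruct (Hc j) as [_ Hb].
  assert (H0 : Rabs (zeta_em 0 j) <= power_coef_K x rad 1 / rad ^ j +
    sum_n (fun m => Rabs (em_coef B m) * power_coef_K x rad m) M * / rad ^ j).
  { unfold zeta_em, em_diff. rewrite sum_O. simpl (INR 1).
    eapply Rle_trans; [apply Rabs_triang|]. rewrite Rabs_Ropp. apply Rplus_le_compat; [apply power_derivs_at_1|].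
    unfold em_sum. eapply Rle_trans; [apply sum_n_abs|].
    rewrite Rmult_comm, <- sum_n_mul. apply sum_n_le. intros m _. rewrite Rabs_mult.
    replace (/ rad ^ j * (Rabs (em_coef B m) * power_coef_K x rad m)) with
      (Rabs (em_coef B m) * (power_coef_K x rad m / rad ^ j)) by (unfold Rdiv; ring).
    apply Rmult_le_compat_l; [apply Rabs_pos|apply power_derivs_at_1]. }
  assert (H1 := Hb n). assert (H2 := Hb O).
  replace (zeta_em_K / rad ^ j) with (power_coef_K x rad 1 / rad ^ j +
    sum_n (fun m => Rabs (em_coef B m) * power_coef_K x rad m) M * / rad ^ j +
    2 * (2 * (power_coef_K x rad (S M) / rad ^ j * em_const B M))) by (unfold zeta_em_K, Rdiv; ring).
  apply Rabs_le_between in H0. apply Rabs_le_between in H1. apply Rabs_le_between in H2.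
  apply Rabs_le. lra.
Qed.

Definition zterm (m : nat) (t : R) (h : C) : C :=
  (RtoC (Rpower t (x - INR m)) * (Cfalling_fact x m h * Cexp (- (h * RtoC (ln t)))))%C.

Definition zeta_em_C (h : C) (n : nat) : C :=
  (Csum (fun i => zterm 1 (INR (S i)) h) n -
   Csum (fun m => RtoC (em_coef B m) * zterm m (INR (S n)) h) M)%C.

Lemma Cpseries_zeta_em (n : nat) (h : C) :
  Cpseries (fun j => RtoC (zeta_em n j)) h (zeta_em_C h n).
Proof.
  assert (Hz : forall m t, Cpseries (fun j => RtoC (power_derivs x j m t)) h (zterm m t h)).
  { intros m t. assert (H := Cpseries_mul (RtoC (Rpower t (x - INR m))) _ _ _ (Cpseries_power_coef x m t h)).
    revert H. apply Clim_ext. intros N. apply Csum_ext. intros j _. unfold power_derivs.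
    rewrite RtoC_mult. reflexivity. }
  assert (H1 := Cpseries_Csum (fun i j => RtoC (power_derivs x j 1 (INR (S i)))) h
    (fun i => zterm 1 (INR (S i)) h) n (fun i _ => Hz 1%nat (INR (S i)))).
  assert (H2 := Cpseries_Csum (fun m j => RtoC (em_coef B m) * RtoC (power_derivs x j m (INR (S n))))%C h
    (fun m => RtoC (em_coef B m) * zterm m (INR (S n)) h)%C M
    (fun m _ => Cpseries_mul _ _ _ _ (Hz m (INR (S n))))).
  assert (H := Cpseries_sub _ _ _ _ _ H1 H2). revert H.
  apply Clim_ext. intros N. apply Csum_ext. intros j _. f_equal.
  unfold zeta_em, em_diff, em_sum. rewrite RtoC_minus, <- !Csum_RtoC.
  f_equal. apply Csum_ext. intros m _. rewrite RtoC_mult. reflexivity.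
Qed.

Lemma Cmod_zterm (m : nat) (t : R) (h : C) :
  Cmod (zterm m t h) = Cmod (Cfalling_fact x m h) * Rpower t (x - INR m - Re h).
Proof.
  unfold zterm. rewrite !Cmod_mult, Cmod_R, Cmod_Cexp, Rabs_pos_eq by (left; apply exp_pos).
  replace (x - INR m - Re h) with ((x - INR m) + - Re h) by ring.
  rewrite Rpower_plus. unfold Rpower at 3.
  replace (Re (- (h * RtoC (ln t)))%C) with (- Re h * ln t); [ring|].
  unfold Re, Copp, Cmult, RtoC; simpl. ring.
Qed.

Lemma zterm_natCpow (n : nat) (s : C) :
  zterm 1 (INR (S n)) (s + RtoC (INR r))%C = ((1 - s) * natCpow (S n) (- s))%C.
Proof.
  unfold zterm, natCpow, Rpower.
  replace (- s * RtoC (ln (INR (S n))))%C with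
    (RtoC ((x - INR 1) * ln (INR (S n))) + - ((s + RtoC (INR r)) * RtoC (ln (INR (S n)))))%C.
  - rewrite Cexp_RtoC_plus. unfold Cfalling_fact, x. rewrite S_INR. simpl (INR 0).
    rewrite Rminus_0_r, RtoC_plus. ring.
  - unfold x. rewrite S_INR. simpl (INR 1). replace (INR r + 1 - 1) with (INR r) by ring.
    rewrite RtoC_mult. ring.
Qed.

(** In the half plane of convergence all boundary terms are
    [O(n^(1 - Re s))]. *)
Lemma zeta_em_C_lim (s : C) : 1 < Re s ->
  Clim (zeta_em_C (s + RtoC (INR r))) ((1 - s) * zeta s)%C.
Proof.
  intros Hs. set (h := (s + RtoC (INR r))%C).
  assert (Hh : Re h = Re s + INR r) by (unfold h, Re, Cplus, RtoC; simpl; ring).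
  assert (H1 := proj1 (is_series_Clim _ _) (proj1 Hzeta s Hs)).
  apply (Clim_mul (1 - s)%C) in H1.
  assert (H2 : Clim (fun n => Csum (fun m => RtoC (em_coef B m) * zterm m (INR (S n)) h)%C M) 0%C).
  { apply Clim_squeeze with (fun n =>
      sum_n (fun m => Rabs (em_coef B m) * Cmod (Cfalling_fact x m h)) M * Rpower (INR (S n)) (1 - Re s)).
    - intros n. replace (Csum _ M - 0)%C with (Csum (fun m => RtoC (em_coef B m) * zterm m (INR (S n)) h)%C M) by ring.
      eapply Rle_trans; [apply Cmod_Csum|]. rewrite Rmult_comm, <- sum_n_mul.
      apply sum_n_le. intros m _. rewrite Cmod_mult, Cmod_R, Cmod_zterm.
      replace (x - INR m - Re h) with ((1 - Re s) + - INR m) by (unfold x; rewrite S_INR, Hh; ring).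
      rewrite Rpower_plus.
      assert (Hp := Rpower_nonpos_le_1 (INR (S n)) (- INR m) (INR_S_ge_1 n)
         ltac:(assert (Hm := pos_INR m); lra)).
      assert (Hq : 0 < Rpower (INR (S n)) (1 - Re s)) by apply exp_pos.
      assert (Ha : 0 <= Rabs (em_coef B m) * Cmod (Cfalling_fact x m h))
        by (apply Rmult_le_pos; [apply Rabs_pos|apply Cmod_ge_0]).
      replace (Rabs (em_coef B m) * (Cmod (Cfalling_fact x m h) * (Rpower (INR (S n)) (1 - Re s) * Rpower (INR (S n)) (- INR m))))
        with (Rpower (INR (S n)) (1 - Re s) * (Rabs (em_coef B m) * Cmod (Cfalling_fact x m h)) * Rpower (INR (S n)) (- INR m)) by ring.
      rewrite <- (Rmult_1_r (Rpower (INR (S n)) (1 - Re s) * _)) at 2.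
      apply Rmult_le_compat_l; [apply Rmult_le_pos; [lra|exact Ha]|exact Hp].
    - replace (Finite 0) with (Finite (sum_n (fun m => Rabs (em_coef B m) * Cmod (Cfalling_fact x m h)) M * 0))
        by (f_equal; ring).
      apply (is_lim_seq_scal_l _ _ 0). apply is_lim_Rpower_neg. lra. }
  assert (H := Clim_sub _ _ _ _ H1 H2).
  replace ((1 - s) * zeta s - 0)%C with ((1 - s) * zeta s)%C in H by ring.
  revert H. apply Clim_ext. intros n. unfold zeta_em_C. f_equal.
  rewrite <- Csum_mul. apply Csum_ext. intros i _. unfold h. rewrite zterm_natCpow. reflexivity.
Qed.

(** The power series with coefficients [c] and [(1-s) zeta(s)] agree near
    [2 + i], hence near [-r] by the identity theorem along the segment between
    these points.  The claims compare the first two coefficients of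
    [(r + 1 - h) zeta(-r + h)]. *)
Lemma zeta_from_em (c : nat -> R) :
  (forall j, is_lim_seq (fun n => zeta_em n j) (c j)) ->
  INR (S r) * zeta_neg zeta r = c O /\
  INR (S r) * zeta'_neg zeta r - zeta_neg zeta r = c 1%nat.
Proof.
  intros Hc. destruct zeta_em_converges as [c' [Hc' Hb]].
  set (W := fun n j => RtoC (zeta_em n j)). set (cc := fun j => RtoC (c j)).
  assert (HW : forall n, coef_bound (W n) zeta_em_K rad).
  { intros n j. unfold W. rewrite Cmod_R. apply Hb. }
  assert (HWc : forall j, Clim (fun n => W n j) (cc j)).
  { intros j. apply Clim_RtoC, Hc. }
  assert (Hcc : coef_bound cc zeta_em_K rad) by (apply Clim_coef_bound with W; assumption).
  assert (HG : exists G : C -> C, forall h, Cmod h < rad -> Cpseries cc h (G h)).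
  { apply (functional_choice (fun h g => Cmod h < rad -> Cpseries cc h g)). intros h.
    destruct (Rlt_le_dec (Cmod h) rad) as [Hlt|Hge].
    - destruct (Cpseries_converges cc zeta_em_K rad h rad_pos Hcc Hlt) as [g Hg]. exists g. auto.
    - exists 0%C. intros. lra. }
  destruct HG as [G HG].
  set (f := fun s => ((1 + - (1) * s) * zeta s - G (s + RtoC (INR r)))%C).
  assert (Hfz : forall s, 1 < Re s -> Cmod (s + RtoC (INR r))%C < rad -> f s = 0%C).
  { intros s Hs Hm.
    assert (H : Cpseries cc (s + RtoC (INR r))%C ((1 - s) * zeta s)%C).
    { apply (Cpseries_limit W cc zeta_em_K rad _ (zeta_em_C (s + RtoC (INR r))%C)); auto.
      - apply rad_pos.
      - intros N. apply Cpseries_zeta_em.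
      - apply zeta_em_C_lim, Hs. }
    unfold f. rewrite (Clim_unique _ _ _ (HG _ Hm) H). ring. }
  (* On the segment the imaginary part vanishes only at the end [-r], so the
     point [1] is not met. *)
  set (p := (RtoC 2 + Ci)%C). set (v := (RtoC (- INR r) - p)%C).
  assert (Hpr : Cmod (p + RtoC (INR r))%C <= INR r + 3).
  { unfold p. replace (RtoC 2 + Ci + RtoC (INR r))%C with (RtoC (2 + INR r) + Ci)%C by (rewrite RtoC_plus; ring).
    eapply Rle_trans; [apply Cmod_triangle|]. rewrite Cmod_R, Cmod_Ci.
    assert (H := pos_INR r). rewrite Rabs_pos_eq; lra. }
  assert (Hrad : rad = INR r + 4) by (unfold rad; rewrite plus_INR; simpl; ring).
  assert (Hloc : locally_zero f (p + v)%C).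
  { apply identity_on_segment.
    - intros Hv. apply (f_equal Im) in Hv. unfold v, p, Im, Ci in Hv; simpl in Hv. lra.
    - intros t Ht.
      assert (Hs1 : (p + RtoC t * v)%C <> RtoC 1).
      { intros E. assert (E1 := f_equal Re E). assert (E2 := f_equal Im E).
        assert (Hr := pos_INR r). unfold v, p, Re, Im, Ci in E1, E2; simpl in E1, E2. nra. }
      unfold f. apply analytic_at_sub.
      + apply analytic_at_affine, (proj2 Hzeta), Hs1.
      + apply analytic_at_translate, (analytic_at_of_Cpseries cc zeta_em_K rad); auto.
        replace (p + RtoC t * v + RtoC (INR r))%C with (RtoC (1 - t) * (p + RtoC (INR r)))%C.
        * rewrite Cmod_mult, Cmod_R, Rabs_pos_eq by lra.
          assert (H0 := Cmod_ge_0 (p + RtoC (INR r))). nra.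
        * unfold v. rewrite RtoC_opp, RtoC_minus. ring.
    - exists (/ 2). split; [lra|]. intros s Hs. apply Hfz.
      + assert (H := re_le_Cmod (s - p)). apply Rabs_le_between in H.
        unfold p, Ci, Re, Cminus, Cplus, Copp, RtoC in *; simpl in *. lra.
      + replace (s + RtoC (INR r))%C with ((s - p) + (p + RtoC (INR r)))%C by ring.
        eapply Rle_lt_trans; [apply Cmod_triangle|]. lra. }
  replace (p + v)%C with (RtoC (- INR r)) in Hloc by (unfold v; ring).
  set (s0 := RtoC (- INR r)) in *.
  assert (Hs01 : s0 <> RtoC 1).
  { intros E. apply RtoC_inj in E. assert (Hr := pos_INR r). lra. }
  destruct (proj1 (analytic_at_Cpseries _ _) (proj2 Hzeta s0 Hs01)) as [a [d [Hd Ha]]].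
  destruct (C_derive_of_Cpseries zeta s0 a d Hd Ha) as [Ha0 Ha1].
  destruct Hloc as [e [He Hfe]].
  set (dd := Rmin d rad).
  assert (Hdd : 0 < dd) by (apply Rmin_pos; [exact Hd|apply rad_pos]).
  assert (Hcoef : forall j, (affine_mul (1 + - (1) * s0) (- (1)) a j - cc j)%C = 0%C).
  { apply (Cpseries_zeros _ dd (fun h => f (s0 + h)%C) Hdd).
    - intros h Hh. unfold f. apply Cpseries_sub.
      + replace (1 + - (1) * (s0 + h))%C with (1 + - (1) * s0 + - (1) * h)%C by ring.
        apply Cpseries_affine, Ha. apply (Rlt_le_trans _ _ _ Hh), Rmin_l.
      + replace (s0 + h + RtoC (INR r))%C with h by (unfold s0; rewrite RtoC_opp; ring).
        apply HG. apply (Rlt_le_trans _ _ _ Hh), Rmin_r.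
    - intros eps Heps. set (q := Rmin eps e / 2).
      assert (Hq0 : 0 < Rmin eps e) by (apply Rmin_pos; assumption).
      assert (Hq1 := Rmin_l eps e). assert (Hq2 := Rmin_r eps e).
      exists (RtoC q). rewrite Cmod_R, Rabs_pos_eq by (unfold q; lra). split; [unfold q; lra|].
      apply Hfe. replace (s0 + RtoC q - s0)%C with (RtoC q) by ring.
      rewrite Cmod_R, Rabs_pos_eq; unfold q; lra. }
  assert (E0 := Hcoef O). assert (E1 := Hcoef 1%nat). simpl affine_mul in E0, E1.
  rewrite <- Ha0 in E0, E1. rewrite <- Ha1 in E1.
  unfold zeta_neg, zeta'_neg. fold s0. rewrite S_INR. unfold cc in *.
  generalize dependent (C_derive zeta s0). generalize dependent (zeta s0).
  intros z _ E0 z' _ E1. unfold s0 in E0, E1.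
  apply (f_equal Re) in E0. apply (f_equal Re) in E1.
  unfold Re, Cminus, Cplus, Copp, Cmult, RtoC in E0, E1 |- *; simpl in E0, E1 |- *.
  split; lra.
Qed.

End Zeta.

Lemma harmonic_0 : harmonic 0 = 0.
Proof. unfold harmonic. rewrite sum_n_m_zero by lia. reflexivity. Qed.

Lemma harmonic_S (n : nat) : harmonic (S n) = harmonic n + / INR (S n).
Proof. unfold harmonic. rewrite sum_n_Sm by lia. reflexivity. Qed.

Lemma power_coef_0 (x : R) (m : nat) (t : R) : power_coef x m t 0 = falling_fact x m.
Proof.
  induction m as [|m IH]; simpl power_coef; simpl falling_fact.
  - simpl. field.
  - rewrite IH. ring.
Qed.

Fixpoint falling_fact_deriv (x : R) (m : nat) : R :=
  match m with O => 0 | S m => (x - INR m) * falling_fact_deriv x m + falling_fact x m end.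

Lemma power_coef_1 (x : R) (m : nat) (t : R) : power_coef x m t 1 = - (falling_fact x m * ln t + falling_fact_deriv x m).
Proof.
  induction m as [|m IH]; simpl power_coef; simpl falling_fact; simpl falling_fact_deriv.
  - simpl. field.
  - rewrite IH. rewrite power_coef_0. ring.
Qed.

(** The logarithmic derivative of the falling factorial is a sum of reciprocals. *)
Lemma falling_fact_deriv_harmonic (n m : nat) : (m <= n)%nat ->
  falling_fact_deriv (INR n) m = falling_fact (INR n) m * (harmonic n - harmonic (n - m)).
Proof.
  induction m as [|m IH]; intros Hm.
  - rewrite Nat.sub_0_r. simpl. ring.
  - simpl. rewrite IH by lia.
    replace (n - m)%nat with (S (n - S m)) by lia. rewrite harmonic_S.
    rewrite <- minus_INR by lia. replace (n - m)%nat with (S (n - S m)) by lia.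
    field. apply Rgt_not_eq, INR_S_pos.
Qed.

Lemma Rpower_falling_fact (n m : nat) (t : R) : 0 < t ->
  Rpower t (INR n - INR m) * falling_fact (INR n) m = pow_derivs n m t.
Proof.
  intros Ht. unfold pow_derivs. destruct (Nat.le_gt_cases m n) as [Hle|Hgt].
  - rewrite <- minus_INR by exact Hle. rewrite Rpower_pow by exact Ht. ring.
  - rewrite falling_fact_0 by exact Hgt. ring.
Qed.

Lemma sum_n_split (a : nat -> R) (n k : nat) :
  sum_n a (S n + k) = sum_n a n + sum_n (fun i => a (S n + i)%nat) k.
Proof.
  induction k as [|k IH].
  - rewrite Nat.add_0_r, sum_n_S, sum_O, Nat.add_0_r. reflexivity.
  - rewrite <- plus_n_Sm, sum_n_S, IH, sum_n_S, <- plus_n_Sm. eq_R. ring.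
Qed.

Lemma is_lim_sum_n (u : nat -> nat -> R) (k : nat) :
  (forall i, is_lim_seq (fun n => u n i) 0) -> is_lim_seq (fun n => sum_n (u n) k) 0.
Proof.
  intros H. induction k as [|k IH].
  - apply is_lim_seq_ext with (fun n => u n O); [intros; rewrite sum_O; reflexivity|apply H].
  - apply is_lim_seq_ext with (fun n => sum_n (u n) k + u n (S k)); [intros; rewrite sum_n_S; reflexivity|].
    replace (Finite 0) with (Finite (0 + 0)) by (f_equal; ring). apply is_lim_seq_plus'; auto.
Qed.

(** * Generalized Glaisher-Kinkelin constants *)
Section Glaisher.
Variables (zeta : C -> C) (B : nat -> R).
Hypotheses (Hzeta : is_riemann_zeta zeta) (HB : is_bernoulli B).

Lemma em_sum_pow_derivs (r k : nat) (y : R) :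
  em_sum B (pow_derivs (S r)) (S (S r) + k) y = em_sum B (pow_derivs (S r)) (S r) y.
Proof.
  unfold em_sum. rewrite sum_n_split.
  rewrite (sum_n_ext_R (fun i => em_coef B (S (S r) + i) * _) (fun _ => 0 * 0)).
  - rewrite sum_n_mul. eq_R. ring.
  - intros i _. unfold pow_derivs. rewrite falling_fact_0 by lia. ring.
Qed.

(** For [j = 0] the function is a power of [t], with exact summation, so the
    sequence is constant. *)
Lemma zeta_em_0 (r n : nat) : zeta_em B r n 0 = - (em_coef B (S r) * INR (fact (S r))).
Proof.
  unfold zeta_em, em_diff.
  rewrite (sum_n_ext_R _ (fun i => INR (S r) * INR (S i) ^ r)).
  - rewrite sum_n_mul, (sum_powers B HB).
    replace (em_sum B (power_derivs (INR (S r)) 0) (2 * r + 6) (INR (S n))) with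
      (em_sum B (pow_derivs (S r)) (S (S r) + (r + 4)) (INR (S n))).
    + rewrite em_sum_pow_derivs, Spoly_em_sum. ring.
    + replace (2 * r + 6)%nat with (S (S r) + (r + 4))%nat by lia.
      apply sum_n_ext_R. intros m _. unfold power_derivs. rewrite power_coef_0, Rpower_falling_fact by apply INR_S_pos.
      reflexivity.
  - intros i _. unfold power_derivs. rewrite power_coef_0, Rpower_falling_fact by apply INR_S_pos.
    unfold pow_derivs. replace (S r - 1)%nat with r by lia. cbn [falling_fact]. change (INR 0) with 0. rewrite Rminus_0_r. ring.
Qed.

Definition harmonic_sum (r : nat) (y : R) : R :=
  sum_n (fun j => Scoef B r j * y ^ (j + 1) * harmonic (j + 1)) r.

Lemma logQ_alt (r : nat) (y : R) : logQ zeta B r y =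
  (Spoly B r y - zeta_neg zeta r) * ln y + harmonic r * Spoly B r y - harmonic_sum r y.
Proof.
  unfold logQ, harmonic_sum, Spoly.
  change (sum_n_m ?f 0 r) with (sum_n f r).
  rewrite (sum_n_ext_R (fun j => Scoef B r j * y ^ (j + 1) * (harmonic r - harmonic (j + 1)))
    (fun j => harmonic r * (Scoef B r j * y ^ (j + 1)) - Scoef B r j * y ^ (j + 1) * harmonic (j + 1)))
    by (intros; ring).
  rewrite sum_n_sub, sum_n_mul. ring.
Qed.

Lemma em_sum_harmonic (r : nat) (y : R) :
  sum_n (fun m => em_coef B m * (pow_derivs (S r) m y * harmonic (S r - m))) (S r) =
  INR (S r) * harmonic_sum r y.
Proof.
  rewrite sum_n_S, Nat.sub_diag, harmonic_0, !Rmult_0_r, Rplus_0_r.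
  rewrite sum_n_rev. unfold harmonic_sum. rewrite <- sum_n_mul.
  apply sum_n_ext_R. intros j Hj. unfold Scoef, pow_derivs, em_coef, Binomial.C.
  rewrite falling_fact_quotient by lia.
  replace (S r - (r - j))%nat with (S j) by lia.
  replace (j + 1)%nat with (S j) by lia. rewrite !INR_fact_S.
  field. repeat split; try apply INR_fact_neq_0; apply Rgt_not_eq, INR_S_pos.
Qed.

(** For exponents [m > r + 1] the falling factorial vanishes but its derivative
    does not: these boundary terms remain at [j = 1], with negative powers of
    [n + 1]. *)
Definition zeta_em_tail (r n : nat) : R :=
  sum_n (fun i => em_coef B (S (S r) + i) *
    (Rpower (INR (S n)) (INR (S r) - INR (S (S r) + i)) * falling_fact_deriv (INR (S r)) (S (S r) + i))) (r + 4).

Lemma zeta_em_tail_lim (r : nat) : is_lim_seq (zeta_em_tail r) 0.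
Proof.
  apply (is_lim_sum_n (fun n i => em_coef B (S (S r) + i) *
    (Rpower (INR (S n)) (INR (S r) - INR (S (S r) + i)) * falling_fact_deriv (INR (S r)) (S (S r) + i)))).
  intros i. apply is_lim_seq_ext with (fun n => em_coef B (S (S r) + i) * falling_fact_deriv (INR (S r)) (S (S r) + i) *
    Rpower (INR (S n)) (INR (S r) - INR (S (S r) + i))); [intros; ring|].
  replace (Finite 0) with (Finite (em_coef B (S (S r) + i) * falling_fact_deriv (INR (S r)) (S (S r) + i) * 0)) by (f_equal; ring).
  apply (is_lim_seq_scal_l _ _ 0), is_lim_Rpower_neg.
  rewrite plus_INR, !S_INR. assert (H := pos_INR i). lra.
Qed.

(** The derivative in [h] falls on [t^(-h)], which gives logarithms, or on the
    falling factorials, which gives the harmonic numbers of [log Q_r]. *)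
Lemma zeta_em_1 (r n : nat) : zeta_em B r n 1 =
  - INR (S r) * sum_n (fun i => INR (S i) ^ r * ln (INR (S i))) n - Spoly B r (INR (S n))
  + (ln (INR (S n)) + harmonic (S r)) * (INR (S r) * Spoly B r (INR (S n)) + em_coef B (S r) * INR (fact (S r)))
  - INR (S r) * harmonic_sum r (INR (S n)) + zeta_em_tail r n.
Proof.
  unfold zeta_em, em_diff.
  rewrite (sum_n_ext_R (fun i => power_derivs (INR (S r)) 1 1 (INR (S i)))
    (fun i => - INR (S r) * (INR (S i) ^ r * ln (INR (S i))) - INR (S i) ^ r)).
  2:{ intros i _. unfold power_derivs. rewrite power_coef_1. cbn [falling_fact falling_fact_deriv]. change (INR 0) with 0.
      rewrite <- (Rpower_pow r) by apply INR_S_pos.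
      replace (INR r) with (INR (S r) - INR 1) by (rewrite S_INR; simpl; ring). ring. }
  rewrite sum_n_sub, sum_n_mul, (sum_powers B HB).
  set (N := INR (S n)).
  assert (HN : 0 < N) by apply INR_S_pos.
  assert (E : em_sum B (power_derivs (INR (S r)) 1) (2 * r + 6) N =
     - ((ln N + harmonic (S r)) * em_sum B (pow_derivs (S r)) (S r) N) +
     INR (S r) * harmonic_sum r N - zeta_em_tail r n).
  { unfold em_sum at 1. replace (2 * r + 6)%nat with (S (S r) + (r + 4))%nat by lia.
    rewrite sum_n_split.
    rewrite (sum_n_ext_R (fun i => em_coef B (S (S r) + i) * power_derivs (INR (S r)) 1 (S (S r) + i) N)
      (fun i => -1 * (em_coef B (S (S r) + i) *
        (Rpower N (INR (S r) - INR (S (S r) + i)) * falling_fact_deriv (INR (S r)) (S (S r) + i))))).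
    2:{ intros i _. unfold power_derivs. rewrite power_coef_1, falling_fact_0 by lia. ring. }
    rewrite sum_n_mul. fold (zeta_em_tail r n).
    rewrite (sum_n_ext_R (fun m => em_coef B m * power_derivs (INR (S r)) 1 m N)
      (fun m => em_coef B m * (pow_derivs (S r) m N * harmonic (S r - m)) -
         (ln N + harmonic (S r)) * (em_coef B m * pow_derivs (S r) m N))).
    - rewrite sum_n_sub, sum_n_mul, em_sum_harmonic. unfold em_sum, zeta_em_tail. fold N. eq_R. ring.
    - intros m Hm. unfold power_derivs. rewrite power_coef_1, falling_fact_deriv_harmonic by exact Hm.
      rewrite <- Rpower_falling_fact by exact HN. ring. }
  rewrite E, Spoly_em_sum. ring.
Qed.

(** [zeta_from_em] gives the limits of the sequences in [zeta_em_0] and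
    [zeta_em_1]; elimination of the Bernoulli number between them leaves
    [log A_r]. *)
Lemma glaisher_limit (r : nat) :
  is_lim_seq (fun n => sum_n (fun i => INR (S i) ^ r * ln (INR (S i))) n - logQ zeta B r (INR (S n)))
    (- zeta_neg zeta r * harmonic r - zeta'_neg zeta r).
Proof.
  destruct (zeta_em_converges B HB r) as [c [Hc _]].
  destruct (zeta_from_em zeta B Hzeta HB r c Hc) as [Z0 Z1].
  assert (HS := INR_S_pos r).
  assert (E0 : c O = - (em_coef B (S r) * INR (fact (S r)))).
  { assert (H := Hc O).
    apply (is_lim_seq_ext _ (fun _ => - (em_coef B (S r) * INR (fact (S r))))) in H;
      [|intros n; apply zeta_em_0].
    apply is_lim_seq_unique in H. rewrite Lim_seq_const in H. injection H as H. auto. }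
  assert (H : is_lim_seq (fun n => - / INR (S r) * (zeta_em B r n 1 - zeta_em_tail r n) - harmonic (S r) * zeta_neg zeta r)
    (- / INR (S r) * (c 1%nat - 0) - harmonic (S r) * zeta_neg zeta r)).
  { apply is_lim_seq_minus'; [|apply is_lim_seq_const].
    apply (is_lim_seq_scal_l _ _ (c 1%nat - 0)). apply is_lim_seq_minus'; [apply Hc|apply zeta_em_tail_lim]. }
  replace (- zeta_neg zeta r * harmonic r - zeta'_neg zeta r) with
    (- / INR (S r) * (c 1%nat - 0) - harmonic (S r) * zeta_neg zeta r).
  - revert H. apply is_lim_seq_ext. intros n. rewrite zeta_em_1, logQ_alt, harmonic_S.
    replace (em_coef B (S r) * INR (fact (S r))) with (- (INR (S r) * zeta_neg zeta r)) by lra.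
    field. lra.
  - rewrite <- Z1, harmonic_S. field. lra.
Qed.

End Glaisher.

(** * The space Omega *)

Lemma Omega_ext (d : nat) (f g : R -> R) :
  (forall x, 0 < x -> f x = g x) -> Omega d f -> Omega d g.
Proof. intros E [a [b H]]. exists a, b. intros x Hx. rewrite <- E by exact Hx. apply H, Hx. Qed.

Lemma Omega_add (d : nat) (f g : R -> R) : Omega d f -> Omega d g -> Omega d (fun x => f x + g x).
Proof.
  intros [a [b H]] [a' [b' H']]. exists (fun i => a i + a' i), (fun i => b i + b' i).
  intros x Hx. rewrite H, H' by exact Hx. change (sum_n_m ?f 0 d) with (sum_n f d).
  rewrite <- sum_n_add. apply sum_n_ext_R. intros. ring.
Qed.

Lemma Omega_scal (d : nat) (c : R) (f : R -> R) : Omega d f -> Omega d (fun x => c * f x).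
Proof.
  intros [a [b H]]. exists (fun i => c * a i), (fun i => c * b i).
  intros x Hx. rewrite H by exact Hx. change (sum_n_m ?f 0 d) with (sum_n f d).
  rewrite <- sum_n_mul. apply sum_n_ext_R. intros. ring.
Qed.

Lemma sum_n_single (a : nat -> R) (d m : nat) : (m <= d)%nat ->
  (forall i, i <> m -> a i = 0) -> sum_n a d = a m.
Proof.
  intros Hm H. induction d as [|d IH].
  - replace m with O by lia. apply sum_O.
  - rewrite sum_n_S. destruct (Nat.eq_dec m (S d)) as [->|Hne].
    + rewrite (sum_n_ext_R _ (fun _ => 0 * 0)) by (intros; rewrite H by lia; ring).
      rewrite sum_n_mul. eq_R. ring.
    + rewrite IH by lia. rewrite (H (S d)) by lia. eq_R. ring.
Qed.

Lemma Omega_pow (d m : nat) : (m <= d)%nat -> Omega d (fun x => x ^ m).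
Proof.
  intros Hm. exists (fun i => if Nat.eqb i m then 1 else 0), (fun _ => 0). intros x _.
  change (sum_n_m ?f 0 d) with (sum_n f d). rewrite (sum_n_single _ d m Hm).
  - rewrite Nat.eqb_refl. ring.
  - intros i Hi. apply Nat.eqb_neq in Hi. rewrite Hi. ring.
Qed.

Lemma Omega_ln (d : nat) : Omega d ln.
Proof.
  exists (fun _ => 0), (fun i => if Nat.eqb i 0 then 1 else 0). intros x _.
  change (sum_n_m ?f 0 d) with (sum_n f d). rewrite (sum_n_single _ d 0 (Nat.le_0_l _)).
  - simpl. ring.
  - intros i Hi. apply Nat.eqb_neq in Hi. rewrite Hi. ring.
Qed.

Lemma Omega_sum_n_m (d n m : nat) (f : nat -> R -> R) :
  (forall i, Omega d (f i)) -> Omega d (fun x => sum_n_m (fun i => f i x) n m).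
Proof.
  intros H.
  assert (H0 : Omega d (fun _ => 0)).
  { apply Omega_ext with (fun x => 0 * ln x); [intros; ring|]. apply Omega_scal, Omega_ln. }
  induction m as [|m IH].
  - destruct n as [|n].
    + apply Omega_ext with (f O); [|apply H]. intros x _. rewrite sum_n_n. reflexivity.
    + apply Omega_ext with (fun _ => 0); [|exact H0].
      intros x _. rewrite sum_n_m_zero by lia. reflexivity.
  - destruct (Nat.le_gt_cases n (S m)) as [Hle|Hgt].
    + apply Omega_ext with (fun x => sum_n_m (fun i => f i x) n m + f (S m) x).
      * intros x _. rewrite sum_n_Sm by exact Hle. reflexivity.
      * apply Omega_add; [exact IH|apply H].
    + apply Omega_ext with (fun _ => 0); [|exact H0].
      intros x _. rewrite sum_n_m_zero by lia. reflexivity.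
Qed.

Lemma Omega_Spoly (B : nat -> R) (d r : nat) : (r + 1 <= d)%nat -> Omega d (Spoly B r).
Proof.
  intros Hr. unfold Spoly.
  apply Omega_ext with (fun x => sum_n_m (fun j => Scoef B r j * x ^ (Nat.min j r + 1)) 0 r).
  - intros x _. apply sum_n_ext_R. intros j Hj. rewrite Nat.min_l by lia. reflexivity.
  - apply (Omega_sum_n_m d 0 r (fun j x => Scoef B r j * x ^ (Nat.min j r + 1))).
    intros i. apply Omega_scal, Omega_pow. lia.
Qed.

Lemma Omega_logP (B : nat -> R) (r k : nat) : Omega (r + 2) (logP B r k).
Proof.
  unfold logP. repeat apply Omega_add.
  - apply Omega_ext with (fun x => (/ 2 * ln (2 * PI * INR k)) * Spoly B r x); [intros; ring|].
    apply Omega_scal, Omega_Spoly. lia.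
  - apply Omega_ext with (fun x => (INR k * ln (INR k / exp 1)) * Spoly B (r + 1) x); [intros; ring|].
    apply Omega_scal, Omega_Spoly. lia.
  - apply Omega_scal, Omega_ln.
  - apply (Omega_sum_n_m (r + 2) 1 _ (fun j x => Bhat B (2 * j) k * Spoly B (r + 1 - 2 * j) x)).
    intros i. apply Omega_scal, Omega_Spoly. lia.
Qed.

(** * Products of factorials *)

Lemma prod_1_n_S (f : nat -> R) (n : nat) : prod_1_n f (S n) = prod_1_n f n * f (S n).
Proof.
  unfold prod_1_n. rewrite seq_S, map_app, fold_right_app. 
  change (fold_right Rmult 1 (map f ((1 + n)%nat :: nil))) with (f (S n) * 1). rewrite Rmult_1_r. generalize (f (S n)). intros y.
  induction (map f (seq 1 n)) as [|z l IH]; simpl; [ring|]. rewrite IH. ring.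
Qed.

Lemma ln_prod_1_n (f : nat -> R) (n : nat) : (forall i, 0 < f i) ->
  0 < prod_1_n f (S n) /\ ln (prod_1_n f (S n)) = sum_n (fun i => ln (f (S i))) n.
Proof.
  intros Hf. induction n as [|n [IH1 IH2]].
  - rewrite prod_1_n_S, sum_O. change (prod_1_n f 0) with 1. rewrite Rmult_1_l. split; [apply Hf|reflexivity].
  - rewrite prod_1_n_S. split; [apply Rmult_lt_0_compat; [exact IH1|apply Hf]|].
    rewrite ln_mult by (try exact IH1; apply Hf). rewrite IH2, sum_n_S. reflexivity.
Qed.

Lemma ln_fact_prod (r k n : nat) :
  0 < fact_prod r k (S n) /\
  ln (fact_prod r k (S n)) = sum_n (fun i => INR (S i) ^ r * ln (INR (fact (k * S i)))) n.
Proof.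
  destruct (ln_prod_1_n (fun nu => INR (fact (k * nu)) ^ (nu ^ r)) n) as [H1 H2].
  { intros i. apply pow_lt, INR_fact_lt_0. }
  split; [exact H1|]. unfold fact_prod. rewrite H2. apply sum_n_ext_R. intros i _.
  rewrite ln_pow by apply INR_fact_lt_0. rewrite pow_INR. reflexivity.
Qed.

Lemma sum_n_m_even (f : nat -> R) (n : nat) : (1 <= n)%nat ->
  (forall m, Nat.odd m = true -> m <> 1%nat -> f m = 0) ->
  sum_n_m f 2 n = sum_n_m (fun j => f (2 * j)%nat) 1 (Nat.div n 2).
Proof.
  intros Hn Hodd. induction n as [|n IH]; [lia|].
  destruct n as [|n].
  - simpl Nat.div. rewrite !sum_n_m_zero by lia. reflexivity.
  - rewrite sum_n_Sm by lia. rewrite IH by lia.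
    destruct (Nat.Even_or_Odd (S (S n))) as [[p Hp]|[p Hp]].
    + rewrite Hp. replace (2 * p / 2)%nat with p by (rewrite Nat.mul_comm, Nat.div_mul; lia).
      destruct p as [|p]; [lia|].
      replace (S n / 2)%nat with p.
      * rewrite sum_n_Sm by lia. reflexivity.
      * apply Nat.div_unique with 1%nat; lia.
    + rewrite Hodd by (try lia; apply Nat.odd_spec; exists p; exact Hp).
      replace (S (S n) / 2)%nat with p by (apply Nat.div_unique with 1%nat; lia).
      replace (S n / 2)%nat with p by (apply Nat.div_unique with 0%nat; lia).
      apply Rplus_0_r.
Qed.

Lemma sum_n_shift2 (h : nat -> R) (r : nat) :
  sum_n (fun i => h (S (S i))) r = sum_n_m h 2 (S r) + h (S (S r)).
Proof.
  assert (E : sum_n (fun i => h (S (S i))) r = sum_n_m h 2 (S (S r))).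
  { induction r as [|r IH].
    - rewrite sum_O, sum_n_n. reflexivity.
    - rewrite sum_n_S, IH, (sum_n_Sm h 2 (S (S r))) by lia. reflexivity. }
  rewrite E, sum_n_Sm by lia. reflexivity.
Qed.

Lemma sum_n_sum_n_m (c : nat -> R) (u : nat -> nat -> R) (p q n : nat) :
  sum_n (fun i => sum_n_m (fun j => c j * u j i) p q) n =
  sum_n_m (fun j => c j * sum_n (u j) n) p q.
Proof.
  induction n as [|n IH].
  - rewrite sum_O. apply sum_n_m_ext. intros j. rewrite sum_O. reflexivity.
  - rewrite sum_n_S, IH.
    rewrite (sum_n_m_ext (fun j => c j * sum_n (u j) (S n))
      (fun j => plus (c j * sum_n (u j) n) (c j * u j (S n)))).
    + rewrite sum_n_m_plus. reflexivity.
    + intros j. rewrite sum_n_S. apply Rmult_plus_distr_l.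
Qed.

Section Assembly.
Variable B : nat -> R.
Hypothesis HB : is_bernoulli B.

Lemma Bhat_mul (m k n : nat) : (1 <= k)%nat ->
  Bhat B m (k * S n) = Bhat B m k / INR (S n) ^ (m - 1).
Proof.
  intros Hk. unfold Bhat. rewrite mult_INR, Rpow_mult_distr. unfold Rdiv.
  rewrite !Rinv_mult. ring.
Qed.

(** The vanishing of the odd Bernoulli numbers restricts the sum to even
    indices; the term [r + 2] stands apart because its power of [nu] is
    [-1]. *)
Lemma stirling_sum_scaled (r k n : nat) : (1 <= k)%nat ->
  INR (S n) ^ r * stirling_sum B r (k * S n) =
  sum_n_m (fun j => Bhat B (2 * j) k * INR (S n) ^ (r + 1 - 2 * j)) 1 (Nat.div (r + 1) 2)
  + Bhat B (S (S r)) k * / INR (S n).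
Proof.
  intros Hk. assert (HN := INR_S_pos n). set (N := INR (S n)) in *.
  set (h := fun m => if Nat.leb m (S r) then Bhat B m k * N ^ (r + 1 - m) else Bhat B m k * / N).
  assert (E : N ^ r * stirling_sum B r (k * S n) = sum_n (fun i => h (S (S i))) r).
  { unfold stirling_sum. rewrite <- sum_n_mul. apply sum_n_ext_R. intros i Hi.
    rewrite Bhat_mul by exact Hk. fold N. unfold h. replace (S (S i) - 1)%nat with (S i) by lia.
    destruct (Nat.leb_spec (S (S i)) (S r)) as [Hle|Hgt].
    - replace r with (S i + (r + 1 - S (S i)))%nat at 1 by lia. rewrite pow_add. field.
      apply pow_nonzero. lra.
    - replace i with r by lia. simpl pow. field. repeat split; try apply pow_nonzero; lra. }
  rewrite E, sum_n_shift2. f_equal.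
  - rewrite sum_n_m_even; [|lia|].
    + replace (r + 1)%nat with (S r) by lia. apply sum_n_m_ext_loc. intros j Hj. unfold h.
      assert (Hj2 : (2 * j <= S r)%nat).
      { destruct Hj as [_ Hj]. apply Nat.le_trans with (2 * (S r / 2))%nat; [lia|].
        apply Nat.Div0.mul_div_le. }
      apply Nat.leb_le in Hj2. rewrite Hj2. replace (S r) with (r + 1)%nat by lia. reflexivity.
    + intros m Ho H1. unfold h, Bhat. rewrite (bernoulli_odd B HB m Ho H1).
      unfold Rdiv. rewrite !Rmult_0_l. destruct (Nat.leb m (S r)); reflexivity.
  - unfold h. replace (Nat.leb (S (S r)) (S r)) with false by (symmetry; apply Nat.leb_gt; lia). reflexivity.
Qed.

Definition stirling_rem_sum (r k n : nat) : R :=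
  sum_n (fun i => INR (S i) ^ r * stirling_rem B r (k * S i)) n.

Lemma ln_fact_prod_expansion (r k n : nat) : (1 <= k)%nat ->
  ln (fact_prod r k (S n)) =
    INR k * sum_n (fun i => INR (S i) ^ (r + 1) * ln (INR (S i))) n
  + / 2 * sum_n (fun i => INR (S i) ^ r * ln (INR (S i))) n
  + (logP B r k (INR (S n)) - Bhat B (S (S r)) k * ln (INR (S n)))
  + Bhat B (S (S r)) k * sum_n (fun i => / INR (S i)) n
  + stirling_rem_sum r k n.
Proof.
  intros Hk. rewrite (proj2 (ln_fact_prod r k n)).
  assert (HkR : 0 < INR k) by (apply lt_0_INR; lia).
  assert (Hpi := PI_RGT_0).
  rewrite (sum_n_ext_R _ (fun i =>
    (INR k * (INR (S i) ^ (r + 1) * ln (INR (S i))) + / 2 * (INR (S i) ^ r * ln (INR (S i))))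
    + ((/ 2 * ln (2 * PI * INR k)) * INR (S i) ^ r
       + (INR k * ln (INR k / exp 1)) * INR (S i) ^ (r + 1)
       + sum_n_m (fun j => Bhat B (2 * j) k * INR (S i) ^ (r + 1 - 2 * j)) 1 (Nat.div (r + 1) 2))
    + Bhat B (S (S r)) k * / INR (S i)
    + INR (S i) ^ r * stirling_rem B r (k * S i))).
  - rewrite !sum_n_add, !sum_n_mul.
    rewrite (sum_n_sum_n_m (fun j => Bhat B (2 * j) k) (fun j i => INR (S i) ^ (r + 1 - 2 * j))).
    rewrite !(sum_powers B HB). unfold logP, stirling_rem_sum.
    rewrite (sum_n_m_ext (fun j => Bhat B (2 * j) k * sum_n _ n)
      (fun j => Bhat B (2 * j) k * Spoly B (r + 1 - 2 * j) (INR (S n)))).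
    + replace (r + 2)%nat with (S (S r)) by lia. eq_R. ring.
    + intros j. rewrite (sum_powers B HB). reflexivity.
  - intros i _. assert (HN := INR_S_pos i).
    rewrite !Rplus_assoc, <- (Rplus_assoc (sum_n_m _ _ _)).
    rewrite <- stirling_sum_scaled by exact Hk.
    unfold stirling_rem, log_fact_main. rewrite mult_INR. set (N := INR (S i)) in *.
    rewrite (ln_mult (INR k) N) by assumption. rewrite ln_div by (try exact HkR; apply exp_pos).
    rewrite ln_exp. rewrite !ln_mult by lra. replace (r + 1)%nat with (S r) by lia. simpl pow. field.
Qed.

(** By [stirling_rem_bound] at [k nu] the terms are [O(k^-(r+2) nu^-2)]; the
    weaker power [k^-1] is enough. *)
Lemma stirling_rem_sum_lim (r : nat) : exists K : R, forall k, (1 <= k)%nat ->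
  is_lim_seq (stirling_rem_sum r k) (real (Lim_seq (stirling_rem_sum r k))) /\
  Rabs (real (Lim_seq (stirling_rem_sum r k))) <= K * / INR k.
Proof.
  destruct (stirling_rem_bound B HB r) as [K [HK0 HK]]. exists (3 * K). intros k Hk.
  assert (HkR : 1 <= INR k) by (change 1 with (INR 1); apply le_INR, Hk).
  assert (Hb : forall i, Rabs (INR (S i) ^ r * stirling_rem B r (k * S i)) <= K * / INR k / INR (S i) ^ 2).
  { intros i. assert (HN := INR_S_pos i). rewrite Rabs_mult, (Rabs_pos_eq (_ ^ r)) by (apply pow_le; lra).
    assert (H := HK (k * S i)%nat ltac:(nia)). rewrite mult_INR in H. set (N := INR (S i)) in *.
    assert (HNr := pow_lt _ r HN). assert (Hkr : 0 < INR k ^ (r + 2)) by (apply pow_lt; lra).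
    apply Rle_trans with (N ^ r * (K / (INR k * N) ^ (r + 2))).
    - apply Rmult_le_compat_l; [lra|exact H].
    - replace (N ^ r * (K / (INR k * N) ^ (r + 2))) with (K * / INR k ^ (r + 2) / N ^ 2).
      + apply Rmult_le_compat_r; [left; apply Rinv_0_lt_compat, pow_lt, HN|].
        apply Rmult_le_compat_l; [exact HK0|]. apply Rinv_le_contravar; [lra|].
        rewrite <- (pow_1 (INR k)) at 1. apply Rle_pow; [exact HkR|lia].
      + rewrite Rpow_mult_distr, (pow_add N). field. repeat split; lra. }
  destruct (lim_of_increments (stirling_rem_sum r k) (K * / INR k) 0) as [l [Hl Hl']].
  { intros n. unfold stirling_rem_sum. rewrite sum_n_S.
    match goal with |- Rabs ?a <= _ => replace a with (INR (S (S n)) ^ r * stirling_rem B r (k * S (S n))) by ring end.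
    eapply Rle_trans; [apply Hb|]. apply Rmult_le_compat_l.
    - apply Rmult_le_pos; [exact HK0|]. left. apply Rinv_0_lt_compat. lra.
    - apply Rinv_le_contravar; [apply pow_lt, INR_S_pos|]. apply pow_incr.
      split; [apply pos_INR|apply le_INR; lia]. }
  assert (E : real (Lim_seq (stirling_rem_sum r k)) = l) by (rewrite (is_lim_seq_unique _ _ Hl); reflexivity).
  rewrite E. split; [exact Hl|].
  assert (H0 := Hl' O). assert (H1 := Hb O). unfold stirling_rem_sum in H0. rewrite sum_O in H0.
  simpl (INR 1) in *. rewrite pow1 in *.
  apply Rabs_le_between in H0. apply Rabs_le_between in H1. apply Rabs_le.
  simpl (1 ^ 0) in H0. lra.
Qed.

End Assembly.

Theorem theorem5p3 (zeta : C -> C) (B : nat -> R)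
    (Hzeta : is_riemann_zeta zeta) (HB : is_bernoulli B) :
  exists F : nat -> nat -> R,
    (forall k r : nat, (1 <= k)%nat ->
       0 < F r k /\
       asymp_equiv (fun n : nat => fact_prod r k n)
         (fun n : nat =>
            F r k * sqrt (glaisher zeta r) * glaisher zeta (r + 1) ^ k
            * Pfun B r k (INR n)
            * sqrt (Qfun zeta B r (INR n)) * Qfun zeta B (r + 1) (INR n) ^ k)) /\
    (forall r : nat, is_lim_seq (fun k : nat => F r k) 1) /\
    (forall k r : nat, (1 <= k)%nat ->
       Omega (r + 2) (fun x : R => ln (Pfun B r k x))).
Proof.
  destruct (harmonic_asymptotic B HB) as [gamma Hgamma].
  exists (fun r k => exp (Bhat B (S (S r)) k * gamma + real (Lim_seq (stirling_rem_sum B r k)))).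
  split; [|split].
  - intros k r Hk. split; [apply exp_pos|].
    destruct (stirling_rem_sum_lim B HB r) as [K HK]. destruct (HK k Hk) as [Hrem _].
    set (Th := real (Lim_seq (stirling_rem_sum B r k))) in *.
    set (Lr := - zeta_neg zeta r * harmonic r - zeta'_neg zeta r).
    set (Lr1 := - zeta_neg zeta (r + 1) * harmonic (r + 1) - zeta'_neg zeta (r + 1)).
    assert (Hexp : forall a, sqrt (exp a) = exp (/ 2 * a)).
    { intros a. rewrite <- (sqrt_square (exp (/ 2 * a))) by (left; apply exp_pos).
      rewrite <- exp_plus. f_equal. f_equal. field. }
    assert (Hpow : forall a, exp a ^ k = exp (INR k * a)).
    { intros a. rewrite <- Rpower_pow by apply exp_pos. unfold Rpower. rewrite ln_exp. reflexivity. }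
    unfold asymp_equiv. apply is_lim_seq_incr_1.
    apply is_lim_seq_ext with (fun n => exp (
       (INR k * (sum_n (fun i => INR (S i) ^ (r + 1) * ln (INR (S i))) n - logQ zeta B (r + 1) (INR (S n)))
       + / 2 * (sum_n (fun i => INR (S i) ^ r * ln (INR (S i))) n - logQ zeta B r (INR (S n)))
       + Bhat B (S (S r)) k * (sum_n (fun i => / INR (S i)) n - ln (INR (S n)))
       + stirling_rem_sum B r k n) - (INR k * Lr1 + / 2 * Lr + Bhat B (S (S r)) k * gamma + Th))).
    + intros n. unfold glaisher, Pfun, Qfun. fold Lr Lr1. rewrite !Hexp, !Hpow, <- !exp_plus.
      rewrite <- (exp_ln (fact_prod r k (S n))) by apply ln_fact_prod.
      rewrite (ln_fact_prod_expansion B HB r k n Hk).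
      unfold Rdiv. rewrite <- exp_Ropp, <- exp_plus. f_equal. ring.
    + rewrite <- exp_0. apply (is_lim_seq_continuous exp _ 0).
      { apply derivable_continuous_pt, derivable_pt_exp. }
      rewrite <- (Rminus_diag (INR k * Lr1 + / 2 * Lr + Bhat B (S (S r)) k * gamma + Th)).
      apply is_lim_seq_minus'; [|apply is_lim_seq_const].
      apply is_lim_seq_plus'; [|exact Hrem].
      apply is_lim_seq_plus'; [apply is_lim_seq_plus'|].
      * apply (is_lim_seq_scal_l _ _ Lr1), (glaisher_limit zeta B Hzeta HB).
      * apply (is_lim_seq_scal_l _ _ Lr), (glaisher_limit zeta B Hzeta HB).
      * apply (is_lim_seq_scal_l _ _ gamma), Hgamma.
  - intros r. destruct (stirling_rem_sum_lim B HB r) as [K HK].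
    rewrite <- exp_0. apply (is_lim_seq_continuous exp _ 0).
    { apply derivable_continuous_pt, derivable_pt_exp. }
    apply is_lim_seq_incr_1. apply is_lim_seq_abs_0.
    set (K' := Rabs (B (S (S r))) * Rabs gamma + K).
    apply is_lim_seq_le_le with (fun _ => 0) (fun k => K' * / INR (S k)).
    + intros k. split; [apply Rabs_pos|]. destruct (HK (S k) ltac:(lia)) as [_ Hrem].
      assert (Hb := Bhat_abs_le B r k 1 ltac:(lia)). rewrite pow_1 in Hb.
      eapply Rle_trans; [apply Rabs_triang|]. rewrite Rabs_mult. unfold K'.
      assert (Hg := Rmult_le_compat_r _ _ _ (Rabs_pos gamma) Hb). unfold Rdiv in Hg. lra.
    + apply is_lim_seq_const.
    + replace (Finite 0) with (Finite (K' * 0)) by (f_equal; ring).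
      apply (is_lim_seq_scal_l _ _ 0), is_lim_seq_inv_INR_S.
  - intros k r _. apply Omega_ext with (logP B r k); [|apply Omega_logP].
    intros x _. unfold Pfun. rewrite ln_exp. reflexivity.
Qed.
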